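(* Let $X$ be a semilocally 2-connected space and let $E=(\mathrm{ev}_0,\mathrm{ev}_1)\colon X^I\to X\times X$ be the endpoint evaluation map on the path space. Then applying $\Pi_1^{vert}$ to $E$ gives a topological bigroupoid $\Pi_2(X)$: its object space is $B_0=X$, its topological groupoid $\underline B_1$ is $\Pi_1^{vert}(E)$ with its canonical functor $(S,T)$ to $\mathrm{disc}(X\times X)$, and its composition, unit and inverse functors and its natural isomorphisms $a,r,l,e,i$ are those induced by applying $\Pi_1^{vert}$ to path concatenation, constant paths, path reversal, and the usual homotopies (vertical over $X\times X$) showing that path concatenation is associative, unital and has inverses up to homotopy.
   Context: $I=[0,1]$; $X^I$ has the compact-open topology. $X$ is semilocally 2-connected if it has an open neighbourhood basis of 1-connected (path-connected and simply connected) sets $U$ whose inclusion induces the zero map $\pi_2(U)\to\pi_2(X)$. ''Basic open neighbourhoods'' are members of a chosen basis of the topology; when the base space has a basis of 1-connected open sets, its basic open sets are taken to be 1-connected. Vertical fundamental groupoid $\Pi_1^{vert}(p)$ of a map $p\colon Y\to Z$: the object space is $Y$. Arrows are classes $[f]$ of vertical paths $f\colon I\to Y$ (paths with $p\circ f$ constant) modulo vertical homotopy (homotopy through vertical paths) relative to $\{0,1\}$. Source and target are evaluation at $0$ and $1$, units are constant paths, inversion is path reversal, composition is concatenation. The topology on the set of arrows has as basic open neighbourhoods of $[f]$ the sets $$\langle [f],U,V_0,V_1\rangle=\{[g]\mid \exists\, h\colon I^2\to p^{-1}(U),\ h(0,-)=f,\ h(1,-)=g,\ h(t,\epsilon)\in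 V_\epsilon \text{ for all } t\in I,\ \epsilon=0,1\},$$ where $U\subset Z$ is a basic open neighbourhood of $p(f(0))$ and $V_0,V_1\subset Y$ are basic open neighbourhoods of $f(0)$, $f(1)$ respectively. It has a functor to $Z$, viewed as the groupoid $\mathrm{disc}(Z)$ with object space $Z$ and only identity arrows. Commuting squares of maps induce functors, and homotopies over the base induce natural transformations. A topological bigroupoid $B$ is a topological groupoid $\underline B_1$ with a functor $(S,T)\colon\underline B_1\to\mathrm{disc}(B_0\times B_0)$ for a space $B_0$, together with: (1) functors $C\colon\underline B_1\times_{S,\mathrm{disc}(B_0),T}\underline B_1\to\underline B_1$ (written $(g,f)\mapsto g\circ f$) and $I\colon\mathrm{disc}(B_0)\to\underline B_1$ over $\mathrm{disc}(B_0\times B_0)$, and a functor $\overline{(-)}\colon\underline B_1\to\underline B_1$ covering the swap map of $\mathrm{disc}(B_0\times B_0)$; (2) continuous maps $a\colon \mathrm{Obj}(\underline B_1)\times_{S,B_0,T}\mathrm{Obj}(\underline B_1)\times_{S,B_0,T}\mathrm{Obj}(\underline B_1)\to\mathrm{Mor}(\underline B_1)$ and $r,l,e,i\colon\mathrm{Obj}(\underline B_1)\to\mathrm{Mor}(\underline B_1)$ that are the components of natural isomorphisms $a_{hgf}\colon(h\circ g)\circ f\to h\circ(g\circ f)$, $r_f\colon f\circ I\to f$, $l_f\colon I\circ f\to f$, $e_f\colon\overline f\circ f\to I_{S(f)}$, $i_f\colon I_{T(f)}\to f\circ\overline f$; such that the following hold for all composable objects $k,h,g,f$ of $\underline B_1$: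 - pentagon: $a_{kh(g\circ f)}\,a_{(k\circ h)gf}=(\mathrm{id}_k\circ a_{hgf})\,a_{k(h\circ g)f}\,(a_{khg}\circ\mathrm{id}_f)$; - triangle: $(\mathrm{id}_g\circ l_f)\,a_{gIf}=r_g\circ\mathrm{id}_f$; - inverse: $(\mathrm{id}_f\circ e_f)\,a_{f\overline f f}\,(i_f\circ\mathrm{id}_f)=r_f^{-1}\,l_f$ as maps $I\circ f\to f\circ I$. (Juxtaposition is composition of arrows in $\underline B_1$, written in function order.) *)

(* Defs.v *)
From HB Require Import structures.
From mathcomp Require Import all_boot all_order all_algebra generic_quotient.
From mathcomp Require Import all_classical all_reals topology normedtype.
From mathcomp Require Import ring lra.

Set Implicit Arguments.
Unset Strict Implicit.
Unset Printing Implicit Defensive.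

Import Order.TTheory GRing.Theory Num.Theory numFieldNormedType.Exports.
Local Open Scope classical_set_scope.
Local Open Scope ring_scope.

Section UnitInterval.
Variable R : realType.

Definition unitI : Type := set_type `[0%R : R, 1%R : R]%classic.

HB.instance Definition _ := Uniform.on unitI.

Lemma clamp_subproof (x : R) :
  Num.max 0 (Num.min 1 x) \in `[0%R : R, 1%R : R]%classic.
Proof.
by apply/mem_set; rewrite /= in_itv /= le_max lexx /= ge_max ler01 ge_min lexx.
Qed.

(* the retraction of R onto [0,1] *)
Definition clamp (x : R) : unitI := SigSub (clamp_subproof x).

Definition ival (s : unitI) : R := \val s.

Definition i0 : unitI := clamp 0.
Definition i1 : unitI := clamp 1.

Lemma ivalP (s : unitI) : 0 <= ival s <= 1.
Proof. by case: s => x /=; rewrite /ival /= => /set_mem; rewrite /= in_itv. Qed.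

Lemma ival_inj : injective ival.
Proof. exact: val_inj. Qed.

Lemma clampE (x : R) : 0 <= x <= 1 -> ival (clamp x) = x.
Proof. by case/andP => x0 x1; rewrite /ival /= (min_idPr x1) (max_idPr x0). Qed.

Lemma ivalK : cancel ival clamp.
Proof. by move=> s; apply: ival_inj; rewrite clampE // ivalP. Qed.

Lemma ival_continuous : continuous ival.
Proof. exact: (@initial_continuous unitI R set_val). Qed.

Lemma clamp_continuous : continuous clamp.
Proof.
apply: (@continuous_comp_initial unitI R R set_val).
apply: (@max_fun_continuous _ R R) => [x|]; first exact: cvg_cst.
apply: (@min_fun_continuous _ R R) => [x|x]; [exact: cvg_cst|exact: cvg_id].
Qed.

Lemma ival0 : ival i0 = 0. Proof. by rewrite clampE // lexx ler01. Qed.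
Lemma ival1 : ival i1 = 1. Proof. by rewrite clampE // lexx ler01. Qed.

Lemma unitI_compact : compact [set: unitI].
Proof.
rewrite compact_ultra => F UF _.
have cI : compact `[0%R : R, 1%R : R]%classic := @segment_compact R 0 1.
have [] := cI (ival @ F) _.
  by apply: (@filterE _ F) => s /=; rewrite in_itv; exact: ivalP.
move=> x [/= x01 /= cl].
have ucl : (ival @ F) --> x.
  move=> A nA.
  have [//|FnA] := in_ultra_setVsetC (@ival @^-1` A) UF.
  by have [y []] := cl (~` A) A FnA nA.
have x01' : x \in `[0%R : R, 1%R : R]%classic by exact/mem_set.
pose s : unitI := SigSub x01'; exists s; split => //=.
move=> A [_ [[W oW <-] /= Wx sB]].
apply: filterS sB _; apply: (ucl W).
by apply: open_nbhs_nbhs.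
Qed.

Lemma unitI_locally_compact : locally_compact [set: unitI].
Proof.
move=> s _; exists setT; first by rewrite withinET; exact: filterT.
split; [exact: unitI_compact|exact: closedT].
Qed.

Lemma unitI_regular : regular_space unitI.
Proof. exact: uniform_regular. Qed.

End UnitInterval.

Section Paths.
Variable R : realType.
Local Notation I := (unitI R).
Local Notation i0 := (i0 R).
Local Notation i1 := (i1 R).

Definition pathspace (Y : topologicalType) : Type := continuousType I Y.

HB.instance Definition _ (Y : topologicalType) := Choice.on (pathspace Y).
HB.instance Definition _ (Y : topologicalType) :=
  Topological.copy (pathspace Y)
    (@initial_topology (pathspace Y) {compact-open, I -> Y} id).

Definition mkpath (Y : topologicalType) (f : I -> Y) (cf : continuous f) :
  pathspace Y := mkcts cf : continuousType I Y.

Lemma path_continuous (Y : topologicalType) (f : pathspace Y) : continuous f.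
Proof. exact: cts_fun. Qed.

Lemma path_ext (Y : topologicalType) (f g : pathspace Y) :
  (forall s, f s = g s) -> f = g.
Proof. by move=> fg; apply/continuousEP. Qed.

Lemma curry_path_subproof (T Y : topologicalType) (H : T * I -> Y) :
  continuous H -> forall t, continuous (fun s => H (t, s)).
Proof. by move=> /continuous_curry[_]; exact. Qed.

Definition curry_path (T Y : topologicalType) (H : T * I -> Y)
  (cH : continuous H) (t : T) : pathspace Y := mkpath (@curry_path_subproof T Y H cH t).

Lemma curry_path_continuous (T Y : topologicalType) (H : T * I -> Y)
  (cH : continuous H) : continuous (curry_path cH).
Proof.
apply: (@continuous_comp_initial (pathspace Y) T {compact-open, I -> Y} id).
exact: (continuous_curry cH).1.
Qed.

Lemma uncurry_path_continuous (T Y : topologicalType) (F : T -> pathspace Y) :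
  continuous F -> continuous (fun z : T * I => F z.1 z.2).
Proof.
move=> cF.
have -> : (fun z : T * I => F z.1 z.2) =
          uncurry ((fun t => F t : I -> Y) : T -> {compact-open, I -> Y}).
  by apply/funext => -[].
apply: continuous_uncurry_regular => [| | |t].
- exact: unitI_locally_compact.
- exact: unitI_regular.
- move=> t; apply: (@continuous_comp T (pathspace Y) {compact-open, I -> Y} F id).
    exact: cF.
  exact: (@initial_continuous (pathspace Y) {compact-open, I -> Y} id).
- exact: path_continuous.
Qed.

Lemma paste_continuous (T Y : topologicalType) (c : T -> R) (F G : T -> Y) :
  continuous c -> continuous F -> continuous G ->
  (forall z, c z = 2^-1 -> F z = G z) ->
  continuous (fun z => if c z <= 2^-1 then F z else G z).
Proof.
move=> cc cF cG FG; apply/continuous_subspace_setT.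
have -> : [set: T] = [set z | c z <= 2^-1] `|` [set z | 2^-1 <= c z].
  by apply/seteqP; split => // z _; case: (leP (c z) 2^-1) => h; [left|right; exact: ltW].
apply: withinU_continuous.
- apply: (@preimage_closed _ _ c [set x | x <= 2^-1]) ; first by move=> z _; exact: cc.
  exact: (@closed_le R 2^-1).
- apply: (@preimage_closed _ _ c [set x | 2^-1 <= x]) ; first by move=> z _; exact: cc.
  exact: (@closed_ge R 2^-1).
- apply: (@subspace_eq_continuous _ _ _ F); last exact: continuous_subspaceT.
  by move=> z /set_mem /= h; rewrite /from_subspace h.
- apply: (@subspace_eq_continuous _ _ _ G); last exact: continuous_subspaceT.
  move=> z /set_mem /= h; rewrite /from_subspace; case: ifP => // h'; apply/esym/FG/eqP.
  by rewrite eq_le h'.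
Qed.

Lemma clamp_comp_continuous (T : topologicalType) (c : T -> R) :
  continuous c -> continuous (fun z => clamp (c z)).
Proof.
move=> cc z; apply: (@continuous_comp T R I c (@clamp R)); first exact: cc.
exact: clamp_continuous.
Qed.

Lemma pair_continuous (T U V : topologicalType) (f : T -> U) (g : T -> V) :
  continuous f -> continuous g -> continuous (fun z => (f z, g z)).
Proof. by move=> cf cg z; apply: cvg_pair; [exact: cf|exact: cg]. Qed.

Lemma comp_continuous (T U V : topologicalType) (f : T -> U) (g : U -> V) :
  continuous f -> continuous g -> continuous (fun z => g (f z)).
Proof. by move=> cf cg z; apply: continuous_comp; [exact: cf|exact: cg]. Qed.

Lemma fst_continuous (T U : topologicalType) : continuous (@fst T U).
Proof. by move=> z; exact: cvg_fst. Qed.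

Lemma snd_continuous (T U : topologicalType) : continuous (@snd T U).
Proof. by move=> z; exact: cvg_snd. Qed.

Definition lft (s : I) : I := clamp (2 * ival s).
Definition rgt (s : I) : I := clamp (2 * ival s - 1).
Definition flip (s : I) : I := clamp (1 - ival s).

Lemma lft_continuous : continuous lft.
Proof.
apply: clamp_comp_continuous => s.
apply: (@continuousM R I (cst 2) (@ival R)); first exact: cst_continuous.
exact: ival_continuous.
Qed.

Lemma rgt_continuous : continuous rgt.
Proof.
apply: clamp_comp_continuous => s.
apply: (@continuousB R R I (fun s => 2 * ival s) (cst 1)).
  apply: (@continuousM R I (cst 2) (@ival R)); first exact: cst_continuous.
  exact: ival_continuous.
exact: cst_continuous.
Qed.

Lemma flip_continuous : continuous flip.
Proof.
apply: clamp_comp_continuous => s.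
apply: (@continuousB R R I (cst 1) (@ival R)); first exact: cst_continuous.
exact: ival_continuous.
Qed.

Lemma lft_half s : ival s = 2^-1 -> lft s = i1.
Proof. by move=> e; rewrite /lft e divff ?pnatr_eq0. Qed.
Lemma rgt_half s : ival s = 2^-1 -> rgt s = i0.
Proof. by move=> e; rewrite /rgt e divff ?pnatr_eq0 ?subrr. Qed.
Lemma lft0 : lft i0 = i0. Proof. by rewrite /lft ival0 mulr0. Qed.
Lemma rgt1 : rgt i1 = i1.
Proof. by rewrite /rgt ival1 mulr1; congr clamp; ring. Qed.
Lemma flip0 : flip i0 = i1. Proof. by rewrite /flip ival0 subr0. Qed.
Lemma flip1 : flip i1 = i0. Proof. by rewrite /flip ival1 subrr. Qed.

Lemma half_ge0 : (ival i0 <= 2^-1) = true.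
Proof. by rewrite ival0 invr_ge0 ler0n. Qed.
Lemma half_lt1 : (ival i1 <= 2^-1) = false.
Proof. by rewrite ival1; apply/negbTE; rewrite -ltNge invf_lt1 ?ltr1n ?ltr0n. Qed.

(* concatenation in function order: first f, then g *)
Definition cat_fun (Y : Type) (g f : I -> Y) (s : I) : Y :=
  if ival s <= 2^-1 then f (lft s) else g (rgt s).

Lemma cat_fun_continuous (Y : topologicalType) (g f : pathspace Y) :
  g i0 = f i1 -> continuous (cat_fun g f).
Proof.
move=> gf; apply: paste_continuous.
- exact: ival_continuous.
- by apply: comp_continuous; [exact: lft_continuous|exact: path_continuous].
- by apply: comp_continuous; [exact: rgt_continuous|exact: path_continuous].
- by move=> s e; rewrite lft_half ?rgt_half ?gf.
Qed.

(* meaningful when g i0 = f i1; the other value is junk *)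
Definition pcat (Y : topologicalType) (g f : pathspace Y) : pathspace Y :=
  match pselect (g i0 = f i1) with
  | left gf => mkpath (cat_fun_continuous gf)
  | right _ => f
  end.

Lemma pcatE (Y : topologicalType) (g f : pathspace Y) s :
  g i0 = f i1 -> pcat g f s = cat_fun g f s.
Proof. by move=> gf; rewrite /pcat; case: pselect. Qed.

Lemma prev_subproof (Y : topologicalType) (f : pathspace Y) :
  continuous (fun s => f (flip s)).
Proof. by apply: comp_continuous; [exact: flip_continuous|exact: path_continuous]. Qed.

Definition prev (Y : topologicalType) (f : pathspace Y) : pathspace Y :=
  mkpath (@prev_subproof Y f).

Lemma prevE (Y : topologicalType) (f : pathspace Y) s : prev f s = f (flip s).
Proof. by []. Qed.

Definition pcst (Y : topologicalType) (y : Y) : pathspace Y :=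
  (cst y : continuousType I Y).

Lemma path_valued_continuous (T Y : topologicalType) (F : T -> pathspace Y) :
  continuous (fun z : T * I => F z.1 z.2) -> continuous F.
Proof.
move=> cF; suff -> : F = curry_path cF by exact: curry_path_continuous.
by apply/funext => t; apply: path_ext.
Qed.

Lemma pcat_continuous (T Y : topologicalType) (G F : T -> pathspace Y) :
  continuous G -> continuous F -> (forall t, G t i0 = F t i1) ->
  continuous (fun t => pcat (G t) (F t)).
Proof.
move=> /uncurry_path_continuous cG /uncurry_path_continuous cF GF.
apply: path_valued_continuous.
have -> : (fun z : T * I => pcat (G z.1) (F z.1) z.2) =
    (fun z => if ival z.2 <= 2^-1 then F z.1 (lft z.2) else G z.1 (rgt z.2)).
  by apply/funext => z; rewrite pcatE.
apply: paste_continuous.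
- by apply: comp_continuous; [exact: snd_continuous|exact: ival_continuous].
- apply: (@comp_continuous _ _ _ (fun z : T * I => (z.1, lft z.2)) _ _ cF).
  apply: pair_continuous; first exact: fst_continuous.
  by apply: comp_continuous; [exact: snd_continuous|exact: lft_continuous].
- apply: (@comp_continuous _ _ _ (fun z : T * I => (z.1, rgt z.2)) _ _ cG).
  apply: pair_continuous; first exact: fst_continuous.
  by apply: comp_continuous; [exact: snd_continuous|exact: rgt_continuous].
- by move=> z e; rewrite lft_half ?rgt_half ?GF.
Qed.

Lemma prev_continuous (Y : topologicalType) : continuous (@prev Y).
Proof.
apply: path_valued_continuous => /=.
apply: (@comp_continuous _ _ _ (fun z : pathspace Y * I => (z.1, flip z.2))
         (fun z => (z.1 : pathspace Y) z.2)).
  apply: pair_continuous; first exact: fst_continuous.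
  by apply: comp_continuous; [exact: snd_continuous|exact: flip_continuous].
by apply: (@uncurry_path_continuous _ _ id) => f; exact: cvg_id.
Qed.

End Paths.

Section VerticalPaths.
Variables (R : realType) (Y : topologicalType) (Z : Type) (p : Y -> Z).
Local Notation I := (unitI R).
Local Notation i0 := (i0 R).
Local Notation i1 := (i1 R).

Definition vertical (f : pathspace R Y) : Prop := forall s t, p (f s) = p (f t).

Definition vpath : Type := {f : pathspace R Y | `[< vertical f >]}.

HB.instance Definition _ := Choice.on vpath.

Definition vpval (f : vpath) : continuousType I Y := \val f.
Coercion vpval : vpath >-> Continuous.type.

Definition mkvpath (f : pathspace R Y) (vf : vertical f) : vpath :=
  exist _ f (asboolT vf).

Lemma vpathP (f : vpath) : vertical f.
Proof. exact: asboolW (valP f). Qed.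

Definition vhomotopic (f g : vpath) : Prop :=
  exists h : I * I -> Y,
    [/\ continuous h,
        forall s, h (i0, s) = f s,
        forall s, h (i1, s) = g s,
        forall t s s', p (h (t, s)) = p (h (t, s'))
      & forall t, h (t, i0) = f i0 /\ h (t, i1) = f i1].

Definition paste1 (h k : I * I -> Y) (z : I * I) : Y :=
  if ival z.1 <= 2^-1 then h (lft z.1, z.2) else k (rgt z.1, z.2).

Lemma paste1_continuous (h k : I * I -> Y) :
  continuous h -> continuous k -> (forall s, h (i1, s) = k (i0, s)) ->
  continuous (paste1 h k).
Proof.
move=> ch ck hk; apply: paste_continuous.
- by apply: comp_continuous; [exact: fst_continuous|exact: ival_continuous].
- apply: (@comp_continuous _ _ _ (fun z : I * I => (lft z.1, z.2)) _ _ ch).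
  apply: pair_continuous; last exact: snd_continuous.
  by apply: comp_continuous; [exact: fst_continuous|exact: lft_continuous].
- apply: (@comp_continuous _ _ _ (fun z : I * I => (rgt z.1, z.2)) _ _ ck).
  apply: pair_continuous; last exact: snd_continuous.
  by apply: comp_continuous; [exact: fst_continuous|exact: rgt_continuous].
- by move=> z e; rewrite lft_half ?rgt_half.
Qed.

Lemma paste1_0 h k s : paste1 h k (i0, s) = h (i0, s).
Proof. by rewrite /paste1 /= half_ge0 lft0. Qed.

Lemma paste1_1 h k s : paste1 h k (i1, s) = k (i1, s).
Proof. by rewrite /paste1 /= half_lt1 rgt1. Qed.

Lemma vhomotopic_refl f : vhomotopic f f.
Proof.
exists (fun z => f z.2); split=> //.
  by apply: comp_continuous; [exact: snd_continuous|exact: path_continuous].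
by move=> t s s'; exact: vpathP.
Qed.

Lemma vhomotopic_sym f g : vhomotopic f g -> vhomotopic g f.
Proof.
move=> [h [ch h0 h1 hv he]]; exists (fun z => h (flip z.1, z.2)); split => /=.
- apply: (@comp_continuous _ _ _ (fun z : I * I => (flip z.1, z.2)) _ _ ch).
  apply: pair_continuous; last exact: snd_continuous.
  by apply: comp_continuous; [exact: fst_continuous|exact: flip_continuous].
- by move=> s; rewrite flip0.
- by move=> s; rewrite flip1.
- by move=> t s s'; exact: hv.
- move=> t; have [-> ->] := he (flip t).
  by rewrite -!h1; have [-> ->] := he i1.
Qed.

Lemma vhomotopic_trans g f k :
  vhomotopic f g -> vhomotopic g k -> vhomotopic f k.
Proof.
move=> [h [ch h0 h1 hv he]] [h' [ch' h'0 h'1 h'v h'e]].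
have eqs : g i0 = f i0 /\ g i1 = f i1 by rewrite -!h1; exact: he.
exists (paste1 h h'); split.
- by apply: paste1_continuous => // s; rewrite h1 h'0.
- by move=> s; rewrite paste1_0.
- by move=> s; rewrite paste1_1.
- by move=> t s s'; rewrite /paste1 /=; case: ifP => _; [exact: hv|exact: h'v].
- move=> t; rewrite /paste1 /=; case: ifP => _; first exact: he.
  by have [<- <-] := eqs; exact: h'e.
Qed.

Definition vhomotopicb (f g : vpath) : bool := `[< vhomotopic f g >].

Lemma vhomotopicb_refl : reflexive vhomotopicb.
Proof. by move=> f; apply/asboolP; exact: vhomotopic_refl. Qed.

Lemma vhomotopicb_sym : symmetric vhomotopicb.
Proof.
by move=> f g; apply: asbool_equiv_eq; split; exact: vhomotopic_sym.
Qed.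

Lemma vhomotopicb_trans : transitive vhomotopicb.
Proof.
move=> g f k /asboolP fg /asboolP gk; apply/asboolP.
exact: vhomotopic_trans fg gk.
Qed.

Definition vhomotopy_rel : equiv_rel vpath :=
  EquivRel vhomotopicb vhomotopicb_refl vhomotopicb_sym vhomotopicb_trans.

Definition vclass : Type := {eq_quot vhomotopy_rel}%qT.

HB.instance Definition _ := Choice.on vclass.

Definition cls (f : vpath) : vclass := (\pi_({eq_quot vhomotopy_rel}) f)%qT.

Definition rep (a : vclass) : vpath := repr (a : {eq_quot vhomotopy_rel}%qT).

Lemma repK : cancel rep cls. Proof. exact: reprK. Qed.

Lemma clsP f g : cls f = cls g <-> vhomotopic f g.
Proof.
split=> [/eqmodP/asboolP //|fg]; by apply/eqmodP/asboolP.
Qed.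

Lemma rep_cls f : vhomotopic (rep (cls f)) f.
Proof. by apply/clsP; rewrite repK. Qed.

Lemma vhomotopic_ends f g : vhomotopic f g -> f i0 = g i0 /\ f i1 = g i1.
Proof. by move=> [h [_ h0 h1 _ he]]; rewrite -!h1; have [-> ->] := he i1. Qed.

(* read on representatives: see vsrcE, vtgtE, inv_classE and comp_classE *)
Definition vsrc (a : vclass) : Y := rep a i0.
Definition vtgt (a : vclass) : Y := rep a i1.

Lemma vsrcE f : vsrc (cls f) = f i0.
Proof. by have [] := vhomotopic_ends (rep_cls f). Qed.

Lemma vtgtE f : vtgt (cls f) = f i1.
Proof. by have [] := vhomotopic_ends (rep_cls f). Qed.

Lemma vertical_cst (y : Y) : vertical (pcst R y). Proof. by []. Qed.

Lemma vertical_rev (f : vpath) : vertical (prev f).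
Proof. by move=> s t; exact: vpathP. Qed.

Lemma vertical_cat (g f : vpath) : vertical (pcat g f).
Proof.
move=> s t; rewrite /pcat; case: pselect => [gf|_]; last exact: vpathP.
suff E u : p (cat_fun g f u) = p (f i1) by rewrite /= !E.
rewrite /cat_fun; case: ifP => _; first exact: vpathP.
by rewrite -gf; exact: vpathP.
Qed.

Definition vcst (y : Y) : vpath := mkvpath (vertical_cst y).
Definition vrev (f : vpath) : vpath := mkvpath (@vertical_rev f).
Definition vcat (g f : vpath) : vpath := mkvpath (@vertical_cat g f).

Lemma vrevE f s : vrev f s = f (flip s). Proof. by []. Qed.
Lemma vcatE (g f : vpath) s : g i0 = f i1 -> vcat g f s = cat_fun g f s.
Proof. exact: pcatE. Qed.

Definition idn_class (y : Y) : vclass := cls (vcst y).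
Definition inv_class (a : vclass) : vclass := cls (vrev (rep a)).
(* meaningful when vsrc b = vtgt a *)
Definition comp_class (b a : vclass) : vclass := cls (vcat (rep b) (rep a)).

Lemma inv_classE f : inv_class (cls f) = cls (vrev f).
Proof.
have [h [ch h0 h1 hv he]] := rep_cls f; apply/clsP.
exists (fun z => h (z.1, flip z.2)); split=> /=.
- apply: (@comp_continuous _ _ _ (fun z : I * I => (z.1, flip z.2)) _ _ ch).
  apply: pair_continuous; first exact: fst_continuous.
  by apply: comp_continuous; [exact: snd_continuous|exact: flip_continuous].
- by move=> s; rewrite h0.
- by move=> s; rewrite h1.
- by move=> t s s'; exact: hv.
- by move=> t; rewrite !vrevE flip0 flip1; have [-> ->] := he t.
Qed.

Lemma comp_classE (g f : vpath) : g i0 = f i1 ->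
  comp_class (cls g) (cls f) = cls (vcat g f).
Proof.
move=> gf; have [k [ck k0 k1 kv ke]] := rep_cls g.
have [h [ch h0 h1 hv he]] := rep_cls f; apply/clsP.
have [eg0 eg1] := vhomotopic_ends (rep_cls g).
have [ef0 ef1] := vhomotopic_ends (rep_cls f).
have kh t : k (t, i0) = h (t, i1).
  by have [-> _] := ke t; have [_ ->] := he t; rewrite eg0 ef1.
have pE t u : p (if ival u <= 2^-1 then h (t, lft u) else k (t, rgt u)) =
              p (h (t, i1)).
  case: ifP => _; first exact: hv.
  by rewrite -kh; exact: kv.
exists (fun z => if ival z.2 <= 2^-1 then h (z.1, lft z.2)
                 else k (z.1, rgt z.2)); split.
- apply: paste_continuous.
  + by apply: comp_continuous; [exact: snd_continuous|exact: ival_continuous].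
  + apply: (@comp_continuous _ _ _ (fun z : I * I => (z.1, lft z.2)) _ _ ch).
    apply: pair_continuous; first exact: fst_continuous.
    by apply: comp_continuous; [exact: snd_continuous|exact: lft_continuous].
  + apply: (@comp_continuous _ _ _ (fun z : I * I => (z.1, rgt z.2)) _ _ ck).
    apply: pair_continuous; first exact: fst_continuous.
    by apply: comp_continuous; [exact: snd_continuous|exact: rgt_continuous].
  + by move=> z e; rewrite lft_half ?rgt_half ?kh.
- by move=> s; rewrite vcatE ?eg0 ?ef1 // /cat_fun h0 k0.
- by move=> s; rewrite vcatE // /cat_fun h1 k1.
- by move=> t s s'; rewrite /= !pE.
- move=> t /=; rewrite half_ge0 half_lt1 lft0 rgt1 !vcatE ?eg0 ?ef1 //.
  rewrite /cat_fun half_ge0 half_lt1 lft0 rgt1.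
  by have [-> _] := he t; have [_ ->] := ke t.
Qed.

End VerticalPaths.

Record open_basis (T : topologicalType) := OpenBasis {
  basis_sets :> set T -> Prop;
  basis_setsP : basis basis_sets }.

Lemma open_basis_nbhs (T : topologicalType) (B : open_basis T) (x : T)
  (A : set T) : nbhs x A -> exists U, [/\ B U, U x & U `<=` A].
Proof. by move=> nA; have [U [BU Ux] UA] := (basis_setsP B).2 x A nA; exists U. Qed.

Lemma open_basis_open_nbhs (T : topologicalType) (B : open_basis T) (x : T) U :
  B U -> U x -> nbhs x U.
Proof. by move=> BU Ux; apply: open_nbhs_nbhs; split => //; exact: (basis_setsP B).1. Qed.

Lemma open_basis_refine (T : topologicalType) (B : open_basis T) (x : T) U V :
  B U -> U x -> B V -> V x -> exists W, [/\ B W, W x, W `<=` U & W `<=` V].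
Proof.
move=> BU Ux BV Vx.
have nUV : nbhs x (U `&` V).
  by apply: filterI; [exact: open_basis_open_nbhs BU Ux|
    exact: open_basis_open_nbhs BV Vx].
have [W [BW Wx WUV]] := open_basis_nbhs B nUV.
by exists W; split => // w /WUV [].
Qed.

Section VerticalTopology.
Variables (R : realType) (Y Z : topologicalType).
Variables (BY : open_basis Y) (BZ : open_basis Z) (p : Y -> Z).
Local Notation I := (unitI R).
Local Notation i0 := (i0 R).
Local Notation i1 := (i1 R).
Local Notation vpath := (vpath R p).
Local Notation vclass := (vclass R p).

Definition basic_nbhd (f : vpath) (U : set Z) (V0 V1 : set Y) : set vclass :=
  [set a | exists g : vpath, a = cls g /\ exists h : I * I -> Y,
     [/\ continuous h,
         forall z, U (p (h z)),
         forall s, h (i0, s) = f s,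
         forall s, h (i1, s) = g s
       & forall t, V0 (h (t, i0)) /\ V1 (h (t, i1))]].

Definition is_basic_nbhd (W : set vclass) : Prop :=
  exists (f : vpath) (U : set Z) (V0 V1 : set Y),
    [/\ BZ U /\ U (p (f i0)), BY V0 /\ V0 (f i0), BY V1 /\ V1 (f i1)
      & W = basic_nbhd f U V0 V1].

Lemma basic_nbhd_refl (f : vpath) U V0 V1 :
  U (p (f i0)) -> V0 (f i0) -> V1 (f i1) -> basic_nbhd f U V0 V1 (cls f).
Proof.
move=> Uf V0f V1f; exists f; split => //; exists (fun z => f z.2); split => //.
  by apply: comp_continuous; [exact: snd_continuous|exact: path_continuous].
by move=> z; rewrite (vpathP f z.2 i0).
Qed.

Lemma basic_nbhd_sub (f g : vpath) U V0 V1 U' V0' V1' :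
  basic_nbhd f U V0 V1 (cls g) -> U' `<=` U -> V0' `<=` V0 -> V1' `<=` V1 ->
  basic_nbhd g U' V0' V1' `<=` basic_nbhd f U V0 V1.
Proof.
move=> [g' [/esym/clsP [k [ck k0 k1 kv ke]] [h [ch hU h0 h1 hV]]]] UU' VV0 VV1.
have g'U s : U (p (g' s)) by rewrite -h1.
have g'V : V0 (g' i0) /\ V1 (g' i1) by rewrite -!h1; exact: hV.
move=> _ [l [-> [m [cm mU m0 m1 mV]]]]; exists l; split => //.
exists (paste1 (paste1 h k) m); split.
- apply: paste1_continuous => //.
    by apply: paste1_continuous => // s; rewrite h1 k0.
  by move=> s; rewrite paste1_1 k1 m0.
- move=> z; rewrite /paste1; case: ifP => _ /=; last exact/UU'/mU.
  by case: ifP => _; [exact: hU|rewrite (kv _ _ i0); have [-> _] := ke (rgt (lft z.1))].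
- by move=> s; rewrite !paste1_0.
- by move=> s; rewrite paste1_1.
- move=> t; rewrite /paste1 /=; case: ifP => _.
    by case: ifP => _; [exact: hV|have [-> ->] := ke (rgt (lft t))].
  by have [/VV0 ? /VV1 ?] := mV (rgt t).
Qed.

(* the bases are kept in the type because the topology is built from them *)
Definition varrow : Type := let _ := (BY, BZ) in vclass.

HB.instance Definition _ := Choice.copy varrow vclass.

Lemma basic_nbhd_cover : \bigcup_(W in is_basic_nbhd) W = [set: varrow].
Proof.
apply/seteqP; split=> // a _; pose f := rep a.
have [U [BU Uf _]] := @open_basis_nbhs Z BZ (p (f i0)) _ filterT.
have [V0 [BV0 V0f _]] := @open_basis_nbhs Y BY (f i0) _ filterT.
have [V1 [BV1 V1f _]] := @open_basis_nbhs Y BY (f i1) _ filterT.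
exists (basic_nbhd f U V0 V1); first by exists f, U, V0, V1.
by rewrite -[a]repK; exact: basic_nbhd_refl.
Qed.

Lemma basic_nbhd_join (W W' : set varrow) (a : varrow) :
  is_basic_nbhd W -> is_basic_nbhd W' -> W a -> W' a ->
  exists W'', [/\ is_basic_nbhd W'', W'' a & W'' `<=` W `&` W'].
Proof.
move=> [f [U [V0 [V1 [[BU _] [BV0 _] [BV1 _] ->]]]]].
move=> [f' [U' [V0' [V1' [[BU' _] [BV0' _] [BV1' _] ->]]]]].
rewrite -[a]repK; set g := rep a => ga g'a.
have ends f1 U1 V01 V11 : basic_nbhd f1 U1 V01 V11 (cls g) ->
    [/\ U1 (p (g i0)), V01 (g i0) & V11 (g i1)].
  move=> [k [/clsP /vhomotopic_ends [-> ->] [h [_ hU _ h1 hV]]]].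
  by rewrite -!h1; have [? ?] := hV i1; split.
have [Ug V0g V1g] := ends _ _ _ _ ga.
have [U'g V0'g V1'g] := ends _ _ _ _ g'a.
have [U2 [BU2 U2g UU UU']] := open_basis_refine BU Ug BU' U'g.
have [W0 [BW0 W0g VW0 VW0']] := open_basis_refine BV0 V0g BV0' V0'g.
have [W1 [BW1 W1g VW1 VW1']] := open_basis_refine BV1 V1g BV1' V1'g.
exists (basic_nbhd g U2 W0 W1); split.
- by exists g, U2, W0, W1.
- exact: basic_nbhd_refl.
- by move=> b Wb; split; [exact: basic_nbhd_sub ga _ _ _ _ Wb|
    exact: basic_nbhd_sub g'a _ _ _ _ Wb].
Qed.

HB.instance Definition _ := @isBaseTopological.Build varrow (set varrow)
  is_basic_nbhd id basic_nbhd_cover basic_nbhd_join.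

Lemma varrow_openP (W : set varrow) : open W <->
  forall a, W a -> exists N, [/\ is_basic_nbhd N, N a & N `<=` W].
Proof.
split=> [[D sD <-] a [N DN Na]|WN].
  by exists N; split; [exact: sD|exact: Na|move=> b Nb; exists N].
exists [set N | is_basic_nbhd N /\ N `<=` W]; first by move=> N [].
apply/seteqP; split=> [a [N [_ NW] Na]|a /WN [N [bN Na NW]]]; first exact: NW.
by exists N.
Qed.

End VerticalTopology.

Section Connectedness.
Variables (R : realType) (X : topologicalType).
Local Notation I := (unitI R).
Local Notation i0 := (i0 R).
Local Notation i1 := (i1 R).

Definition path_connected (U : set X) : Prop :=
  forall x y, U x -> U y -> exists f : I -> X,
    [/\ continuous f, forall s, U (f s), f i0 = x & f i1 = y].

(* With (K, dK) = (I^n, boundary of I^n): for every base point x of U the map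
   pi_n(U, x) -> pi_n(V, x) induced by the inclusion is zero. *)
Definition zero_on_pi (K : topologicalType) (dK : set K) (U V : set X) : Prop :=
  forall (x : X) (f : K -> X), U x -> continuous f ->
    (forall z, U (f z)) -> (forall z, dK z -> f z = x) ->
    exists h : I * K -> X,
      [/\ continuous h,
          forall w, V (h w),
          forall z, h (i0, z) = f z,
          forall z, h (i1, z) = x
        & forall t z, dK z -> h (t, z) = x].

Definition boundary1 : set I := [set s | s = i0 \/ s = i1].
Definition boundary2 : set (I * I) :=
  [set z | boundary1 z.1 \/ boundary1 z.2].

Definition simply_connected (U : set X) : Prop := zero_on_pi boundary1 U U.

Definition one_connected (U : set X) : Prop :=
  path_connected U /\ simply_connected U.

Definition semilocally_2_connected : Prop :=
  exists B : open_basis X, forall U, B U ->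
    one_connected U /\ zero_on_pi boundary2 U [set: X].

End Connectedness.

Section ProductBasis.
Variables (R : realType) (X : topologicalType).

Lemma one_connectedX (U V : set X) :
  one_connected R U -> one_connected R V -> one_connected R (U `*` V).
Proof.
move=> [pU sU] [pV sV]; split.
  move=> [x y] [x' y'] [/= Ux Vy] [/= Ux' Vy'].
  have [f [cf fU f0 f1]] := pU _ _ Ux Ux'.
  have [g [cg gV g0 g1]] := pV _ _ Vy Vy'.
  exists (fun s => (f s, g s)); split; rewrite ?f0 ?f1 ?g0 ?g1 //.
    exact: pair_continuous.
  by move=> s; split; [exact: fU|exact: gV].
move=> [x y] f [/= Ux Vy] cf fUV fxy.
have [|||h [ch hU h0 h1 hb]] := sU x (fun s => (f s).1) Ux.
- by apply: comp_continuous cf _; exact: fst_continuous.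
- by move=> s; have [] := fUV s.
- by move=> s /fxy ->.
have [|||k [ck kV k0 k1 kb]] := sV y (fun s => (f s).2) Vy.
- by apply: comp_continuous cf _; exact: snd_continuous.
- by move=> s; have [] := fUV s.
- by move=> s /fxy ->.
exists (fun w => (h w, k w)); split => //.
- exact: pair_continuous.
- by move=> w; split; [exact: hU|exact: kV].
- by move=> s; rewrite h0 k0 -surjective_pairing.
- by move=> s; rewrite h1 k1.
- by move=> t s bs; rewrite hb ?kb.
Qed.

(* so 1-connected basic open sets can be chosen on X * X *)
Lemma one_connected_basisX : semilocally_2_connected R X ->
  exists B : open_basis (X * X)%type, forall W, B W -> one_connected R W.
Proof.
move=> [B hB].
pose B2 := [set W : set (X * X) | exists U V, [/\ B U, B V & W = U `*` V]].
have bB2 : basis B2.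
  split.
    move=> _ [U [V [BU BV ->]]].
    rewrite /= openE => -[x y] [/= Ux Vy]; exists (U, V) => //=.
    by split; [exact: open_basis_open_nbhs BU Ux|
      exact: open_basis_open_nbhs BV Vy].
  move=> [x y] A [[P Q] /= [nP nQ] PQA].
  have [U [BU Ux UP]] := open_basis_nbhs B nP.
  have [V [BV Vy VQ]] := open_basis_nbhs B nQ.
  exists (U `*` V); first by split => //; exists U, V.
  by move=> [a b] [/= /UP Pa /VQ Qb]; exact: PQA.
exists (OpenBasis bB2) => _ [U [V [BU BV ->]]].
by apply: one_connectedX; [exact: (hB U BU).1|exact: (hB V BV).1].
Qed.

End ProductBasis.

(* Groupoids internal to spaces.  Objects and arrows form the subspaces ob and
   ar of the ambient spaces Ob and Ar, and the operations are total on the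
   ambient spaces but are constrained only on these subspaces (composition only
   on composable pairs).  This makes pullbacks of groupoids easy to form. *)
Record groupoid_data := GroupoidData {
  Ob : topologicalType;
  Ar : topologicalType;
  ob : set Ob;
  ar : set Ar;
  gsrc : Ar -> Ob;
  gtgt : Ar -> Ob;
  gid : Ob -> Ar;
  ginv : Ar -> Ar;
  gcomp : Ar -> Ar -> Ar }.

Definition composable (G : groupoid_data) : set (Ar G * Ar G) :=
  [set ba | [/\ ar ba.1, ar ba.2 & gsrc ba.1 = gtgt ba.2]].

Record is_topological_groupoid (G : groupoid_data) : Prop := {
  tg_src_ob : forall a : Ar G, ar a -> ob (gsrc a);
  tg_tgt_ob : forall a : Ar G, ar a -> ob (gtgt a);
  tg_idn_ar : forall x : Ob G, ob x -> ar (gid x);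
  tg_inv_ar : forall a : Ar G, ar a -> ar (ginv a);
  tg_comp_ar : forall b a : Ar G, composable (b, a) -> ar (gcomp b a);
  tg_src_idn : forall x : Ob G, ob x -> gsrc (gid x) = x;
  tg_tgt_idn : forall x : Ob G, ob x -> gtgt (gid x) = x;
  tg_src_inv : forall a : Ar G, ar a -> gsrc (ginv a) = gtgt a;
  tg_tgt_inv : forall a : Ar G, ar a -> gtgt (ginv a) = gsrc a;
  tg_src_comp : forall b a : Ar G, composable (b, a) -> gsrc (gcomp b a) = gsrc a;
  tg_tgt_comp : forall b a : Ar G, composable (b, a) -> gtgt (gcomp b a) = gtgt b;
  tg_compA : forall c b a : Ar G, composable (c, b) -> composable (b, a) ->
    gcomp c (gcomp b a) = gcomp (gcomp c b) a;
  tg_comp_idl : forall a : Ar G, ar a -> gcomp (gid (gtgt a)) a = a;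
  tg_comp_idr : forall a : Ar G, ar a -> gcomp a (gid (gsrc a)) = a;
  tg_comp_invl : forall a : Ar G, ar a -> gcomp (ginv a) a = gid (gsrc a);
  tg_comp_invr : forall a : Ar G, ar a -> gcomp a (ginv a) = gid (gtgt a);
  tg_src_cts : {within @ar G, continuous (@gsrc G)};
  tg_tgt_cts : {within @ar G, continuous (@gtgt G)};
  tg_idn_cts : {within @ob G, continuous (@gid G)};
  tg_inv_cts : {within @ar G, continuous (@ginv G)};
  tg_comp_cts : {within @composable G,
    continuous (fun ba : Ar G * Ar G => gcomp ba.1 ba.2)} }.

Record functor_data (G H : groupoid_data) := FunctorData {
  fob : Ob G -> Ob H;
  far : Ar G -> Ar H }.

Record is_functor (G H : groupoid_data) (F : functor_data G H) : Prop := {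
  fct_ob : forall x, ob x -> ob (fob F x);
  fct_ar : forall a, ar a -> ar (far F a);
  fct_src : forall a, ar a -> gsrc (far F a) = fob F (gsrc a);
  fct_tgt : forall a, ar a -> gtgt (far F a) = fob F (gtgt a);
  fct_idn : forall x, ob x -> far F (gid x) = gid (fob F x);
  fct_comp : forall b a, composable (b, a) ->
    far F (gcomp b a) = gcomp (far F b) (far F a);
  fct_ob_cts : {within @ob G, continuous (fob F)};
  fct_ar_cts : {within @ar G, continuous (far F)} }.

Definition functor_eq (G H : groupoid_data) (F F' : functor_data G H) : Prop :=
  (forall x, ob x -> fob F x = fob F' x) /\
  (forall a, ar a -> far F a = far F' a).

(* invertibility of the components is automatic in a groupoid *)
Record is_natural_iso (G H : groupoid_data) (F F' : functor_data G H)
    (n : Ob G -> Ar H) : Prop := {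
  nat_ar : forall x, ob x -> ar (n x);
  nat_src : forall x, ob x -> gsrc (n x) = fob F x;
  nat_tgt : forall x, ob x -> gtgt (n x) = fob F' x;
  nat_comm : forall a, ar a ->
    gcomp (n (gtgt a)) (far F a) = gcomp (far F' a) (n (gsrc a));
  nat_cts : {within @ob G, continuous n} }.

Definition fid (G : groupoid_data) : functor_data G G :=
  FunctorData (G := G) (H := G) id id.

Definition fcomp (G H K : groupoid_data)
    (F' : functor_data H K) (F : functor_data G H) : functor_data G K :=
  FunctorData (fob F' \o fob F) (far F' \o far F).

Definition disc (Z : topologicalType) : groupoid_data :=
  @GroupoidData Z Z setT setT id id id id (fun b a => a).

Definition disc_map (Z Z' : topologicalType) (m : Z -> Z') :
  functor_data (disc Z) (disc Z') := @FunctorData (disc Z) (disc Z') m m.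

(* the pullback of G -> K <- H *)
Definition pullback (G H K : groupoid_data)
    (s : functor_data G K) (t : functor_data H K) : groupoid_data :=
  @GroupoidData (Ob G * Ob H)%type (Ar G * Ar H)%type
    [set x | [/\ ob x.1, ob x.2 & fob s x.1 = fob t x.2]]
    [set a | [/\ ar a.1, ar a.2 & far s a.1 = far t a.2]]
    (fun a => (gsrc a.1, gsrc a.2))
    (fun a => (gtgt a.1, gtgt a.2))
    (fun x => (gid x.1, gid x.2))
    (fun a => (ginv a.1, ginv a.2))
    (fun b a => (gcomp b.1 a.1, gcomp b.2 a.2)).

Definition pullback_snd (G H K : groupoid_data)
    (s : functor_data G K) (t : functor_data H K) :
  functor_data (pullback s t) H :=
  @FunctorData (pullback s t) H snd snd.

Section Bigroupoid.
Variables (B0 : topologicalType) (B1 : groupoid_data).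
Variable ST : functor_data B1 (disc (B0 * B0)%type).

Definition Sfun : functor_data B1 (disc B0) := fcomp (disc_map fst) ST.
Definition Tfun : functor_data B1 (disc B0) := fcomp (disc_map snd) ST.

(* pairs (g, f) with S g = T f *)
Definition pairs : groupoid_data := pullback Sfun Tfun.

(* triples ((h, g), f) with S h = T g and S g = T f *)
Definition triples : groupoid_data :=
  pullback (fcomp Sfun (@pullback_snd _ _ _ Sfun Tfun)) Tfun.

End Bigroupoid.

Record bigroupoid_data := BigroupoidData {
  bobj : topologicalType;
  bhom : groupoid_data;
  bST : functor_data bhom (disc (bobj * bobj)%type);
  bcomp : functor_data (pairs bST) bhom;
  bunit : functor_data (disc bobj) bhom;
  binv : functor_data bhom bhom;
  a_ : Ob (triples bST) -> Ar bhom;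
  r_ : Ob bhom -> Ar bhom;
  l_ : Ob bhom -> Ar bhom;
  e_ : Ob bhom -> Ar bhom;
  i_ : Ob bhom -> Ar bhom }.

Section BigroupoidAxioms.
Variable B : bigroupoid_data.
Local Notation B0 := (bobj B).
Local Notation B1 := (bhom B).
Local Notation ST := (@bST B).
Local Notation pairs := (pairs ST).
Local Notation triples := (triples ST).

Definition S0 (f : Ob B1) : B0 := (fob ST f).1.
Definition T0 (f : Ob B1) : B0 := (fob ST f).2.
Definition hc0 (g f : Ob B1) : Ob B1 := fob (bcomp B) (g, f).
Definition hc1 (b a : Ar B1) : Ar B1 := far (bcomp B) (b, a).
Definition assoc (h g f : Ob B1) : Ar B1 := a_ (b := B) (h, g, f).

Local Notation "g \c f" := (hc0 g f) (at level 40, left associativity).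
Local Notation "b \h a" := (hc1 b a) (at level 40, left associativity).
Local Notation "b \v a" := (gcomp b a) (at level 45, left associativity).

Definition outer_ends : functor_data pairs (disc (B0 * B0)%type) :=
  @FunctorData pairs (disc (B0 * B0)%type)
    (fun gf => (S0 gf.2, T0 gf.1))
    (fun ba => ((far ST ba.2).1, (far ST ba.1).2)).

Definition compl : functor_data triples B1 :=
  @FunctorData triples B1
    (fun x => (x.1.1 \c x.1.2) \c x.2)
    (fun x => (x.1.1 \h x.1.2) \h x.2).

Definition compr : functor_data triples B1 :=
  @FunctorData triples B1
    (fun x => x.1.1 \c (x.1.2 \c x.2))
    (fun x => x.1.1 \h (x.1.2 \h x.2)).

Definition unitr : functor_data B1 B1 :=
  @FunctorData B1 B1
    (fun f => f \c fob (bunit B) (S0 f))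
    (fun a => a \h far (bunit B) (far ST a).1).

Definition unitl : functor_data B1 B1 :=
  @FunctorData B1 B1
    (fun f => fob (bunit B) (T0 f) \c f)
    (fun a => far (bunit B) (far ST a).2 \h a).

Definition barl : functor_data B1 B1 :=
  @FunctorData B1 B1
    (fun f => fob (binv B) f \c f)
    (fun a => far (binv B) a \h a).

Definition barr : functor_data B1 B1 :=
  @FunctorData B1 B1
    (fun f => f \c fob (binv B) f)
    (fun a => a \h far (binv B) a).

Record is_topological_bigroupoid : Prop := {
  bg_groupoid : is_topological_groupoid B1;
  bg_ST : is_functor ST;
  bg_C : is_functor (bcomp B);
  bg_C_over : functor_eq (fcomp ST (bcomp B)) outer_ends;
  bg_I : is_functor (bunit B);
  bg_I_over : functor_eq (fcomp ST (bunit B)) (disc_map (fun x : B0 => (x, x)));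
  bg_bar : is_functor (binv B);
  bg_bar_over : functor_eq (fcomp ST (binv B))
    (fcomp (disc_map (fun xy : B0 * B0 => (xy.2, xy.1))) ST);
  bg_a : is_natural_iso compl compr (@a_ B);
  bg_r : is_natural_iso unitr (fid B1) (@r_ B);
  bg_l : is_natural_iso unitl (fid B1) (@l_ B);
  bg_e : is_natural_iso barl (fcomp (bunit B) (Sfun ST)) (@e_ B);
  bg_i : is_natural_iso (fcomp (bunit B) (Tfun ST)) barr (@i_ B);
  bg_pentagon : forall k h g f : Ob B1, ob k -> ob h -> ob g -> ob f ->
    S0 k = T0 h -> S0 h = T0 g -> S0 g = T0 f ->
    assoc k h (g \c f) \v assoc (k \c h) g f =
    (gid k \h assoc h g f) \v assoc k (h \c g) f \v (assoc k h g \h gid f);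
  bg_triangle : forall g f : Ob B1, ob g -> ob f -> S0 g = T0 f ->
    (gid g \h l_ f) \v assoc g (fob (bunit B) (S0 g)) f = r_ g \h gid f;
  bg_inverse : forall f : Ob B1, ob f ->
    (gid f \h e_ f) \v assoc f (fob (binv B) f) f \v (i_ f \h gid f) =
    ginv (r_ f) \v l_ f }.

End BigroupoidAxioms.

Definition Pi1vert (R : realType) (Y Z : topologicalType)
    (BY : open_basis Y) (BZ : open_basis Z) (p : Y -> Z) : groupoid_data :=
  @GroupoidData Y (varrow R BY BZ p) setT setT
    (@vsrc R Y Z p) (@vtgt R Y Z p) (@idn_class R Y Z p) (@inv_class R Y Z p)
    (@comp_class R Y Z p).

Definition Pi1vert_base (R : realType) (Y Z : topologicalType)
    (BY : open_basis Y) (BZ : open_basis Z) (p : Y -> Z) :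
  functor_data (Pi1vert R BY BZ p) (disc Z) :=
  @FunctorData (Pi1vert R BY BZ p) (disc Z) p (fun a => p (vsrc a)).

(* the arrow map [f] |-> [u o f] induced by a square p' u = v p *)
Section InducedArrowMap.
Variables (R : realType) (Y Y' : topologicalType) (Z Z' : Type).
Variables (p : Y -> Z) (p' : Y' -> Z') (u : Y -> Y') (v : Z -> Z').
Hypotheses (cu : continuous u) (uv : forall y, p' (u y) = v (p y)).

Lemma vmap_subproof (f : vpath R p) : continuous (fun s => u (f s)).
Proof. by apply: comp_continuous cu; exact: path_continuous. Qed.

Lemma vmap_vertical (f : vpath R p) : vertical p' (mkpath (@vmap_subproof f)).
Proof. by move=> s t; rewrite /= !uv (vpathP f s t). Qed.

Definition vmap (f : vpath R p) : vpath R p' := mkvpath (@vmap_vertical f).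

Definition map_class (a : vclass R p) : vclass R p' := cls (vmap (rep a)).

Lemma map_classE f : map_class (cls f) = cls (vmap f).
Proof.
have [h [ch h0 h1 hv he]] := rep_cls f; apply/clsP.
exists (fun z => u (h z)); split.
- exact: comp_continuous ch cu.
- by move=> s; rewrite h0.
- by move=> s; rewrite h1.
- by move=> t s s'; rewrite !uv (hv _ _ s').
- by move=> t; have [-> ->] := he t.
Qed.

End InducedArrowMap.

Section Pi2.
Variables (R : realType) (X : topologicalType).
Local Notation I := (unitI R).
Local Notation i0 := (i0 R).
Local Notation i1 := (i1 R).
Local Notation PX := (pathspace R X).

Definition ends (f : PX) : X * X := (f i0, f i1).

Lemma pcat_ends (g f : PX) : g i0 = f i1 -> ends (pcat g f) = (f i0, g i1).
Proof.
move=> gf; rewrite /ends !pcatE // /cat_fun.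
by rewrite half_ge0 half_lt1 lft0 rgt1.
Qed.

Definition swap_pair (xy : X * X) : X * X := (xy.2, xy.1).

Lemma prev_ends (f : PX) : ends (prev f) = swap_pair (ends f).
Proof. by rewrite /ends !prevE flip0 flip1. Qed.

Lemma vpath_ends (b : vpath R ends) t : b t i0 = b i0 i0 /\ b t i1 = b i0 i1.
Proof. by have := vpathP b t i0; rewrite /ends => -[-> ->]. Qed.

Lemma hcat_subproof (b a : vpath R ends) : (forall t, b t i0 = a t i1) ->
  continuous (fun t => pcat (b t : PX) (a t : PX)).
Proof. by move=> ba; apply: pcat_continuous; try exact: path_continuous. Qed.

Lemma hcat_vertical (b a : vpath R ends) (ba : forall t, b t i0 = a t i1) :
  vertical ends (mkpath (hcat_subproof ba)).
Proof.
move=> s t; rewrite /= !pcat_ends //.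
by rewrite !(vpath_ends a s).1 !(vpath_ends b s).2 !(vpath_ends a t).1
           !(vpath_ends b t).2.
Qed.

(* concatenation applied at each time; meaningful when the paths of paths b and
   a are concatenable, the other value is junk *)
Definition hcat (b a : vpath R ends) : vpath R ends :=
  match pselect (forall t, b t i0 = a t i1) with
  | left ba => mkvpath (hcat_vertical ba)
  | right _ => a
  end.

Definition hcomp_class (b a : vclass R ends) : vclass R ends :=
  cls (hcat (rep b) (rep a)).

Lemma hcatE (b a : vpath R ends) t : b i0 i0 = a i0 i1 ->
  hcat b a t = pcat (b t : PX) (a t : PX).
Proof.
move=> ba; rewrite /hcat; case: pselect => // nba.
by exfalso; apply: nba => u; rewrite (vpath_ends b u).1 (vpath_ends a u).2.
Qed.

Lemma hcomp_classE (b a : vpath R ends) : b i0 i0 = a i0 i1 ->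
  hcomp_class (cls b) (cls a) = cls (hcat b a).
Proof.
move=> ba; have [k [ck k0 k1 kv ke]] := rep_cls b.
have [h [ch h0 h1 hv he]] := rep_cls a; apply/clsP.
have [eb0 eb1] := vhomotopic_ends (rep_cls b).
have [ea0 ea1] := vhomotopic_ends (rep_cls a).
have rba : rep (cls b) i0 i0 = rep (cls a) i0 i1 by rewrite eb0 ea0.
have hends z : ends (h z) = ends (a i0).
  by case: z => t s; rewrite (hv t s i0); have [-> _] := he t; rewrite ea0.
have kends z : ends (k z) = ends (b i0).
  by case: z => t s; rewrite (kv t s i0); have [-> _] := ke t; rewrite eb0.
have kh z : (k z : PX) i0 = (h z : PX) i1.
  by have := kends z; have := hends z; rewrite /ends => -[_ ->] [-> _].
exists (fun z => pcat (k z) (h z)); split.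
- exact: pcat_continuous.
- by move=> s; rewrite k0 h0 hcatE.
- by move=> s; rewrite k1 h1 hcatE.
- by move=> t s s'; rewrite !pcat_ends // /ends;
    have := hends (t, s); have := hends (t, s');
    have := kends (t, s); have := kends (t, s'); rewrite /ends
    => -[_ ->] [_ ->] [-> _] [-> _].
- move=> t; rewrite !hcatE //.
  by have [-> ->] := he t; have [-> ->] := ke t.
Qed.

(* The straight-line homotopy t |-> c o ((1 - t) u + t v) between the
   reparametrisations c o u and c o v of a path c. *)
Definition slide_fun (c : PX) (u v : R -> R) (z : I * I) : X :=
  c (clamp ((1 - ival z.1) * u (ival z.2) + ival z.1 * v (ival z.2))).

Lemma slide_fun_continuous (c : PX) (u v : R -> R) :
  continuous u -> continuous v -> continuous (slide_fun c u v).
Proof.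
move=> cu cv.
have c1 : continuous (fun z : I * I => ival z.1).
  by apply: comp_continuous; [exact: fst_continuous|exact: ival_continuous].
have c2 (w : R -> R) : continuous w -> continuous (fun z : I * I => w (ival z.2)).
  move=> cw; apply: comp_continuous cw.
  by apply: comp_continuous; [exact: snd_continuous|exact: ival_continuous].
apply: (@comp_continuous _ _ _ _ c); last exact: path_continuous.
apply: clamp_comp_continuous => z.
apply: (@continuousD R R (I * I)%type (fun z => (1 - ival z.1) * u (ival z.2))
         (fun z => ival z.1 * v (ival z.2))).
  apply: (@continuousM R (I * I)%type (fun z => 1 - ival z.1)
            (fun z => u (ival z.2))); last exact: c2.
  apply: (@continuousB R R (I * I)%type (cst 1) (fun z => ival z.1)).
    exact: cst_continuous.
  exact: c1.
apply: (@continuousM R (I * I)%type (fun z => ival z.1)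
          (fun z => v (ival z.2))); [exact: c1|exact: c2].
Qed.

Section Slide.
Variables (u v : R -> R) (cu : continuous u) (cv : continuous v).
Hypotheses (uv0 : u 0 = v 0) (uv1 : u 1 = v 1).

Definition slide_path (c : PX) : pathspace R PX :=
  mkpath (@curry_path_continuous R I X _ (@slide_fun_continuous c u v cu cv)).

Lemma slide_pathE (c : PX) t s :
  (slide_path c t : PX) s = slide_fun c u v (t, s).
Proof. by []. Qed.

Lemma slide_vertical (c : PX) : vertical ends (slide_path c).
Proof.
have H s x : (1 - ival (s : I)) * x + ival s * x = x by ring.
by move=> s t; rewrite /ends !slide_pathE /slide_fun /= ival0 ival1 uv0 uv1 !H.
Qed.

Definition slide (c : PX) : vpath R ends := mkvpath (@slide_vertical c).

End Slide.

(* h o (g o f) reparametrised by assoc_rep is (h o g) o f *)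
Definition assoc_rep (s : R) : R :=
  Num.max (s / 2) (Num.max (s - 4^-1) (2 * s - 1)).
(* f reparametrised by unitr_rep is f o I, by unitl_rep it is I o f *)
Definition unitr_rep (s : R) : R := Num.max 0 (2 * s - 1).
Definition unitl_rep (s : R) : R := Num.min 1 (2 * s).
(* f reparametrised by invl_rep is (bar f) o f, by invr_rep it is f o (bar f) *)
Definition invl_rep (s : R) : R := Num.min (2 * s) (2 - 2 * s).
Definition invr_rep (s : R) : R := Num.max (1 - 2 * s) (2 * s - 1).

Lemma affine_continuous (a b : R) (w : R -> R) :
  (forall s, w s = a * s + b) -> continuous w.
Proof.
move=> /funext -> s; apply: (@continuousD R R R (fun s => a * s) (cst b)).
  apply: (@continuousM R R (cst a) id); first exact: cst_continuous.
  exact: cvg_id.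
exact: cst_continuous.
Qed.

Lemma assoc_rep_continuous : continuous assoc_rep.
Proof.
apply: (@max_fun_continuous _ R R).
  by apply: (@affine_continuous 2^-1 0) => s; ring.
apply: (@max_fun_continuous _ R R).
  by apply: (@affine_continuous 1 (- 4^-1)) => s; ring.
by apply: (@affine_continuous 2 (- 1)) => s; ring.
Qed.

Lemma unitr_rep_continuous : continuous unitr_rep.
Proof.
apply: (@max_fun_continuous _ R R).
  by apply: (@affine_continuous 0 0) => s; ring.
by apply: (@affine_continuous 2 (- 1)) => s; ring.
Qed.

Lemma unitl_rep_continuous : continuous unitl_rep.
Proof.
apply: (@min_fun_continuous _ R R).
  by apply: (@affine_continuous 0 1) => s; ring.
by apply: (@affine_continuous 2 0) => s; ring.
Qed.

Lemma invl_rep_continuous : continuous invl_rep.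
Proof.
apply: (@min_fun_continuous _ R R).
  by apply: (@affine_continuous 2 0) => s; ring.
by apply: (@affine_continuous (- 2) 2) => s; ring.
Qed.

Lemma invr_rep_continuous : continuous invr_rep.
Proof.
apply: (@max_fun_continuous _ R R).
  by apply: (@affine_continuous (- 2) 1) => s; ring.
by apply: (@affine_continuous 2 (- 1)) => s; ring.
Qed.

Lemma id_continuous : continuous (id : R -> R).
Proof. by move=> x; exact: cvg_id. Qed.

Lemma cst_real_continuous (a : R) : continuous (fun _ : R => a).
Proof. exact: cst_continuous. Qed.

Lemma assoc_rep_id0 : assoc_rep 0 = 0.
Proof. by rewrite /assoc_rep !max_l; lra. Qed.

Lemma assoc_rep_id1 : assoc_rep 1 = 1.
Proof. by rewrite /assoc_rep; rewrite !max_r; lra. Qed.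

Lemma unitr_rep_id0 : unitr_rep 0 = 0.
Proof. by rewrite /unitr_rep max_l; lra. Qed.
Lemma unitr_rep_id1 : unitr_rep 1 = 1.
Proof. by rewrite /unitr_rep max_r; lra. Qed.
Lemma unitl_rep_id0 : unitl_rep 0 = 0.
Proof. by rewrite /unitl_rep min_r; lra. Qed.
Lemma unitl_rep_id1 : unitl_rep 1 = 1.
Proof. by rewrite /unitl_rep min_l; lra. Qed.
Lemma invl_rep_cst0 : invl_rep 0 = 0.
Proof. by rewrite /invl_rep min_l; lra. Qed.
Lemma invl_rep_cst1 : invl_rep 1 = 0.
Proof. by rewrite /invl_rep min_r; lra. Qed.
Lemma invr_rep_cst0 : 1 = invr_rep 0.
Proof. by rewrite /invr_rep max_l; lra. Qed.
Lemma invr_rep_cst1 : 1 = invr_rep 1.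
Proof. by rewrite /invr_rep max_r; lra. Qed.

Definition slide_a (h g f : PX) : vpath R ends :=
  slide assoc_rep_continuous id_continuous assoc_rep_id0 assoc_rep_id1
    (pcat h (pcat g f)).
Definition slide_r (f : PX) : vpath R ends :=
  slide unitr_rep_continuous id_continuous unitr_rep_id0 unitr_rep_id1 f.
Definition slide_l (f : PX) : vpath R ends :=
  slide unitl_rep_continuous id_continuous unitl_rep_id0 unitl_rep_id1 f.
Definition slide_e (f : PX) : vpath R ends :=
  slide invl_rep_continuous (@cst_real_continuous 0) invl_rep_cst0 invl_rep_cst1 f.
Definition slide_i (f : PX) : vpath R ends :=
  slide (@cst_real_continuous 1) invr_rep_continuous invr_rep_cst0 invr_rep_cst1 f.

Variables (BP : open_basis PX) (BXX : open_basis (X * X)%type).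

Definition Pi2_hom : groupoid_data := Pi1vert R BP BXX ends.

Definition Pi2_ST : functor_data Pi2_hom (disc (X * X)%type) :=
  Pi1vert_base R BP BXX ends.

(* composition order is function order: (g, f) |-> pcat g f, i.e. g o f, runs
   along f first; hcomp_class and map_class apply pcat and prev pointwise *)
Definition Pi2 : bigroupoid_data :=
  @BigroupoidData X Pi2_hom Pi2_ST
    (@FunctorData (pairs Pi2_ST) Pi2_hom
       (fun gf => pcat gf.1 gf.2) (fun ba => hcomp_class ba.1 ba.2))
    (@FunctorData (disc X) Pi2_hom
       (fun x => pcst R x) (fun x => idn_class R ends (pcst R x)))
    (@FunctorData Pi2_hom Pi2_hom
       (@prev R X) (map_class (v := swap_pair) (@prev_continuous R X) prev_ends))
    (fun hgf => cls (slide_a hgf.1.1 hgf.1.2 hgf.2))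
    (fun f => cls (slide_r f))
    (fun f => cls (slide_l f))
    (fun f => cls (slide_e f))
    (fun f => cls (slide_i f)).

End Pi2.

(* Main.v *)
(* The algebraic laws hold because every structure two-cell is a reparametrisation
   of a single path c : I -> X.  Thus both sides of the pentagon, triangle and
   inverse laws are images under c of parallel two-cells between paths in I, and
   those agree because I is convex; naturality is the commutativity of the
   boundary of a square.

   For continuity, cut a path c into finitely many pieces lying in 1-connected
   open sets U for which pi_2(U) -> pi_2(X) vanishes.  This gives c neighbourhoods
   V in the path space such that a path from c to any c' in V can be chosen inside
   V over prescribed paths of the endpoints, and such that a loop in V contracts
   over prescribed contractions of the loops of its endpoints.  Hence an arrow of
   a basic neighbourhood of [f] is determined by its source and target ("rigid"):
   the sphere swept out by the endpoints of the paths is null in X.  So every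
   nearby arrow is reached by a homotopy that is vertical at each time and follows
   any chosen paths of sources and targets; two such homotopies can be
   concatenated, vertically or horizontally, and this yields the continuity of
   composition.  Units and structure isomorphisms are continuous because the path
   space is locally path-connected. *)

Require Import Defs.
From mathcomp Require Import all_boot all_order all_algebra.
From mathcomp Require Import all_classical all_reals interval_inference.
From mathcomp Require Import topology normedtype sequences.
From mathcomp Require Import ring lra.
(* Defs.prev must shadow path.prev. *)
Import Defs.

Set Implicit Arguments.
Unset Strict Implicit.
Unset Printing Implicit Defensive.

Import Order.TTheory GRing.Theory Num.Theory numFieldNormedType.Exports.
Local Open Scope classical_set_scope.
Local Open Scope ring_scope.

(** * The vertical fundamental groupoid *)

(** The homotopies in a basic neighbourhood need not be vertical at intermediate times and move the
    end objects freely. Two homotopies that reach composable arrows may therefore disagree on the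
    object or points they share, and cannot be pasted. The remedy is to fix the paths of the shared
    points beforehand and to rebuild each homotopy over them. Hence the local lemmas are relative to
    prescribed motions of the endpoints, followed through one fixed time change [rho], so that lifts
    made separately fit at every time.

    Pushing the ends of a path c along q0 and q1 gives q1 (c q0), and for constant q0 and q1 this is
    [pad c], not c. Since [slide_p] is natural, padding can always be undone by conjugation.

    Vertical classes are also formed over maps into Prop, such as a subset U or [ends_in A0 A1]: a
    path that starts in the subset is vertical exactly when it stays there, which gives relative
    fundamental groupoids without passing to subspaces. *)

Lemma id_cts (T : topologicalType) : continuous (fun z : T => z).
Proof. by move=> z; exact: cvg_id. Qed.

Section Interpolation.
Variable R : realType.
Local Notation I := (unitI R).
Local Notation i0 := (i0 R).
Local Notation i1 := (i1 R).

Definition lerp (r a b : I) : I := clamp ((1 - ival r) * ival a + ival r * ival b).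

Lemma ival_lerp r a b : ival (lerp r a b) = (1 - ival r) * ival a + ival r * ival b.
Proof.
rewrite /lerp clampE //.
have /andP[r0 r1] := ivalP r; have /andP[a0 a1] := ivalP a.
have /andP[b0 b1] := ivalP b; apply/andP; split; nra.
Qed.

Lemma lerp0 a b : lerp i0 a b = a.
Proof. by apply: ival_inj; rewrite ival_lerp ival0; ring. Qed.

Lemma lerp1 a b : lerp i1 a b = b.
Proof. by apply: ival_inj; rewrite ival_lerp ival1; ring. Qed.

Lemma lerpxx r a : lerp r a a = a.
Proof. by apply: ival_inj; rewrite ival_lerp; ring. Qed.

Lemma lerp_i0i1 r : lerp r i0 i1 = r.
Proof. by apply: ival_inj; rewrite ival_lerp ival0 ival1; ring. Qed.

Lemma lerp_flip r a b : lerp (flip r) a b = lerp r b a.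
Proof.
apply: ival_inj; rewrite !ival_lerp /flip clampE; first by ring.
by have /andP[r0 r1] := ivalP r; apply/andP; split; lra.
Qed.

Lemma lerp_continuous (T : topologicalType) (r a b : T -> I) :
  continuous r -> continuous a -> continuous b ->
  continuous (fun z => lerp (r z) (a z) (b z)).
Proof.
move=> cr ca cb; apply: clamp_comp_continuous.
have civ (f : T -> I) : continuous f -> continuous (fun z => ival (f z)).
  by move=> cf; apply: comp_continuous cf _; exact: ival_continuous.
move=> z; apply: (@continuousD R R T (fun z => (1 - ival (r z)) * ival (a z))
         (fun z => ival (r z) * ival (b z))).
  apply: (@continuousM R T (fun z => 1 - ival (r z)) (fun z => ival (a z)));
    last exact: civ.
  apply: (@continuousB R R T (cst 1) (fun z => ival (r z))).
    exact: cst_continuous.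
  exact: civ.
by apply: (@continuousM R T (fun z => ival (r z)) (fun z => ival (b z))); exact: civ.
Qed.

Lemma eval_continuous (T Y : topologicalType) (F : T -> pathspace R Y) (s : T -> I) :
  continuous F -> continuous s -> continuous (fun z => F z (s z)).
Proof.
move=> cF cs; have := comp_continuous (pair_continuous (@id_cts T) cs)
  (uncurry_path_continuous cF).
exact.
Qed.

Lemma seg_subproof (Y : topologicalType) (P : pathspace R Y) (a b : I) :
  continuous (fun r => P (lerp r a b)).
Proof.
apply: eval_continuous; first exact: cst_continuous.
by apply: lerp_continuous; [exact: id_cts|exact: cst_continuous..].
Qed.

Definition seg (Y : topologicalType) (P : pathspace R Y) (a b : I) : pathspace R Y :=
  mkpath (@seg_subproof Y P a b).

Lemma segE (Y : topologicalType) (P : pathspace R Y) a b r :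
  seg P a b r = P (lerp r a b).
Proof. by []. Qed.

Lemma seg_continuous (T Y : topologicalType) (P : T -> pathspace R Y) (a b : T -> I) :
  continuous P -> continuous a -> continuous b ->
  continuous (fun t => seg (P t) (a t) (b t)).
Proof.
move=> cP ca cb; apply: path_valued_continuous.
have cfst (U : topologicalType) (f : T -> U) : continuous f ->
    continuous (fun z : T * I => f z.1).
  by move=> cf; apply: comp_continuous cf; exact: fst_continuous.
apply: (@eval_continuous _ _ (fun z => P z.1)
  (fun z : T * I => lerp z.2 (a z.1) (b z.1))); first exact: cfst.
by apply: lerp_continuous; [exact: snd_continuous|exact: cfst..].
Qed.

Lemma pcst_continuous (T Y : topologicalType) (f : T -> Y) :
  continuous f -> continuous (fun t => pcst R (f t)).
Proof.
move=> cf; apply: path_valued_continuous.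
by apply: (comp_continuous _ cf); exact: fst_continuous.
Qed.

Lemma prev_comp_continuous (T Y : topologicalType) (P : T -> pathspace R Y) :
  continuous P -> continuous (fun t => prev (P t)).
Proof. by move=> cP; apply: comp_continuous cP _; exact: prev_continuous. Qed.

End Interpolation.

(** Structural continuity, one case per construction on paths. For [pcat] the matching of the
    endpoints is left as a side goal. *)
Ltac cts_step :=
  match goal with
  | H : continuous ?f |- continuous ?f => exact H
  | |- continuous (fun z => z) => exact: id_cts
  | |- continuous (fun z => ?c) => exact: cst_continuous
  | |- continuous (fun z => (@?a z, @?b z)) => apply: (@pair_continuous _ _ _ a b)
  | |- continuous fst => exact: fst_continuous
  | |- continuous snd => exact: snd_continuous
  | |- continuous (@flip _) => exact: flip_continuous
  | |- continuous (@lft _) => exact: lft_continuous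
  | |- continuous (@rgt _) => exact: rgt_continuous
  | |- continuous (@ival _) => exact: ival_continuous
  | |- continuous (fun z => fst (@?a z)) =>
      apply: (@comp_continuous _ _ _ a fst); [|exact: fst_continuous]
  | |- continuous (fun z => snd (@?a z)) =>
      apply: (@comp_continuous _ _ _ a snd); [|exact: snd_continuous]
  | |- continuous (fun z => ival (@?a z)) =>
      apply: (@comp_continuous _ _ _ a (@ival _)); [|exact: ival_continuous]
  | |- continuous (fun z => lft (@?a z)) =>
      apply: (@comp_continuous _ _ _ a (@lft _)); [|exact: lft_continuous]
  | |- continuous (fun z => rgt (@?a z)) =>
      apply: (@comp_continuous _ _ _ a (@rgt _)); [|exact: rgt_continuous]
  | |- continuous (fun z => flip (@?a z)) =>
      apply: (@comp_continuous _ _ _ a (@flip _)); [|exact: flip_continuous]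
  | |- continuous (fun z => lerp (@?r z) (@?a z) (@?b z)) =>
      apply: (@lerp_continuous _ _ r a b)
  | |- continuous (fun z => seg (@?P z) (@?a z) (@?b z)) =>
      apply: (@seg_continuous _ _ _ P a b)
  | |- continuous (fun z => pcst _ (@?f z)) => apply: (@pcst_continuous _ _ _ f)
  | |- continuous (fun z => prev (@?f z)) => apply: (@prev_comp_continuous _ _ _ f)
  | |- continuous (fun z => pcat (@?g z) (@?f z)) => apply: (@pcat_continuous _ _ _ g f)
  | |- continuous (fun z => mkpath (@?c z)) => apply: path_valued_continuous => /=
  | H : continuous ?f |- continuous (fun z => ?f (@?a z)) =>
      apply: (@comp_continuous _ _ _ a f); [|exact: H]
  | |- continuous (Continuous.sort ?F) => exact: path_continuous
  | |- continuous (fun z => Continuous.sort ?F (@?s z)) =>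
      apply: (@comp_continuous _ _ _ s (Continuous.sort F)); [|exact: path_continuous]
  | |- continuous (fun z => Continuous.sort (@?F z) (@?s z)) =>
      apply: (@eval_continuous _ _ _ F s)
  end.
Ltac cts := repeat cts_step.

(** * Groupoid laws for vertical classes *)

Section VerticalGroupoid.
Variables (R : realType) (Y : topologicalType) (Z : Type) (p : Y -> Z).
Local Notation I := (unitI R).
Local Notation i0 := (i0 R).
Local Notation i1 := (i1 R).
Implicit Types (f g : vpath R p) (a b c : vclass R p).

Lemma cls_surj a : exists f, a = cls f.
Proof. by exists (rep a); rewrite repK. Qed.

(* Two paths in the square with the same endpoints are joined by the
   straight-line homotopy. *)
Lemma cls_square (H : I * I -> Y) (P Q : I -> I * I) f g :
  continuous H -> (forall z w, p (H z) = p (H w)) -> continuous P -> continuous Q ->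
  P i0 = Q i0 -> P i1 = Q i1 ->
  (forall s, f s = H (P s)) -> (forall s, g s = H (Q s)) -> cls f = cls g.
Proof.
move=> cH pH cP cQ PQ0 PQ1 fP gQ; apply/clsP.
exists (fun z => H (lerp z.1 (P z.2).1 (Q z.2).1, lerp z.1 (P z.2).2 (Q z.2).2)).
split=> /=.
- by cts.
- by move=> s; rewrite !lerp0 fP -surjective_pairing.
- by move=> s; rewrite !lerp1 gQ -surjective_pairing.
- by move=> *; exact: pH.
- by move=> t; rewrite PQ0 PQ1 !lerpxx !fP PQ0 PQ1 -!surjective_pairing.
Qed.

(** A path is a square that ignores its second coordinate. Associativity, unit and inverse laws all
    compare two reparametrisations of one path, so each reduces to a check at the endpoints. *)
Lemma cls_reparam (d : vpath R p) (P Q : I -> I) f g :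
  continuous P -> continuous Q -> P i0 = Q i0 -> P i1 = Q i1 ->
  (forall s, f s = d (P s)) -> (forall s, g s = d (Q s)) -> cls f = cls g.
Proof.
move=> cP cQ PQ0 PQ1 fP gQ.
apply: (@cls_square (fun z => d z.1) (fun s => (P s, i0)) (fun s => (Q s, i0))).
all: try by cts.
- by move=> z w; exact: vpathP.
- by rewrite PQ0.
- by rewrite PQ1.
Qed.

Lemma cls_ext f g : (forall s, f s = g s) -> cls f = cls g.
Proof.
by move=> fg; apply: (@cls_reparam g id id) => //; exact: id_cts.
Qed.

Lemma pcat0 (T : topologicalType) (g f : pathspace R T) : g i0 = f i1 -> pcat g f i0 = f i0.
Proof. by move=> gf; rewrite pcatE // /cat_fun half_ge0 lft0. Qed.

Lemma pcat1 (T : topologicalType) (g f : pathspace R T) : g i0 = f i1 -> pcat g f i1 = g i1.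
Proof. by move=> gf; rewrite pcatE // /cat_fun half_lt1 rgt1. Qed.

Lemma vcat0 g f : g i0 = f i1 -> vcat g f i0 = f i0.
Proof. exact: pcat0. Qed.

Lemma vcat1 g f : g i0 = f i1 -> vcat g f i1 = g i1.
Proof. exact: pcat1. Qed.

Lemma vsrc_comp b a : vsrc b = vtgt a -> vsrc (comp_class b a) = vsrc a.
Proof.
have [g ->] := cls_surj b; have [f ->] := cls_surj a.
by rewrite vsrcE vtgtE => gf; rewrite comp_classE // !vsrcE vcat0.
Qed.

Lemma vtgt_comp b a : vsrc b = vtgt a -> vtgt (comp_class b a) = vtgt b.
Proof.
have [g ->] := cls_surj b; have [f ->] := cls_surj a.
by rewrite vsrcE vtgtE => gf; rewrite comp_classE // !vtgtE vcat1.
Qed.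

Lemma vsrc_idn (y : Y) : vsrc (idn_class R p y) = y. Proof. exact: vsrcE. Qed.
Lemma vtgt_idn (y : Y) : vtgt (idn_class R p y) = y. Proof. exact: vtgtE. Qed.

Lemma vsrc_inv a : vsrc (inv_class a) = vtgt a.
Proof.
by have [f ->] := cls_surj a; rewrite inv_classE vsrcE vtgtE vrevE flip0.
Qed.

Lemma vtgt_inv a : vtgt (inv_class a) = vsrc a.
Proof.
by have [f ->] := cls_surj a; rewrite inv_classE vsrcE vtgtE vrevE flip1.
Qed.

Lemma p_vtgt a : p (vtgt a) = p (vsrc a).
Proof. by have [f ->] := cls_surj a; rewrite vsrcE vtgtE; exact: vpathP. Qed.


Definition ihalf : I := clamp 2^-1.

Lemma ival_half : ival ihalf = 2^-1.
Proof. by rewrite clampE //; apply/andP; split; lra. Qed.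

Definition pid : pathspace R I := mkpath (@id_cts I).

(** Concatenation is natural in the target space: a bracketing of subpaths of d is d after the same
    bracketing of subintervals of I. *)
Lemma pcat_comp (T T' : topologicalType) (d : T -> T') (g f : pathspace R T)
    (g' f' : pathspace R T') :
  (forall s, g' s = d (g s)) -> (forall s, f' s = d (f s)) -> g i0 = f i1 ->
  forall s, pcat g' f' s = d (pcat g f s).
Proof.
move=> eg ef gf s; rewrite !pcatE ?eg ?ef ?gf // /cat_fun.
by case: ifP; rewrite ?eg ?ef.
Qed.

Lemma seg_half1 (T : topologicalType) (g f : pathspace R T) : g i0 = f i1 ->
  seg (pcat g f) i0 ihalf = f.
Proof.
move=> gf; apply: path_ext => s; rewrite segE pcatE // /cat_fun.
have /andP[s0 s1] := ivalP s.
have e : ival (lerp s i0 ihalf) = 2^-1 * ival s.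
  by rewrite ival_lerp ival0 ival_half; ring.
rewrite e ifT; last by lra.
by congr (f _); apply: ival_inj; rewrite /lft e clampE; [field|apply/andP; split; lra].
Qed.

Lemma seg_half2 (T : topologicalType) (g f : pathspace R T) : g i0 = f i1 ->
  seg (pcat g f) ihalf i1 = g.
Proof.
move=> gf; apply: path_ext => s; rewrite segE pcatE // /cat_fun.
have /andP[s0 s1] := ivalP s.
have e : ival (lerp s ihalf i1) = 2^-1 + 2^-1 * ival s.
  by rewrite ival_lerp ival1 ival_half; field.
have er : rgt (lerp s ihalf i1) = s.
  by apply: ival_inj; rewrite /rgt e clampE; [field|apply/andP; split; lra].
rewrite e er; case: ifP => // h.
(* The midpoint belongs to the first half in [cat_fun]; this is where the endpoints of g and f must
   match. *)
have s_0 : s = i0 by apply: ival_inj; rewrite ival0; lra.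
suff -> : lft (lerp s ihalf i1) = i1 by rewrite -gf s_0.
by apply: ival_inj; rewrite /lft e s_0 ival0 clampE ?ival1; [field|apply/andP; split; lra].
Qed.

Lemma pcat_seg (T : topologicalType) (d : pathspace R T) :
  pcat (seg d ihalf i1) (seg d i0 ihalf) = d.
Proof.
apply: path_ext => s; rewrite pcatE ?segE ?lerp0 ?lerp1 // /cat_fun.
have /andP[s0 s1] := ivalP s.
case: leP => h; rewrite segE; congr (d _); apply: ival_inj.
  by rewrite ival_lerp ival0 ival_half /lft clampE; [field|apply/andP; split; lra].
by rewrite ival_lerp ival1 ival_half /rgt clampE; [field|apply/andP; split; lra].
Qed.

Lemma comp_classA c b a : vsrc c = vtgt b -> vsrc b = vtgt a ->
  comp_class c (comp_class b a) = comp_class (comp_class c b) a.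
Proof.
have [h ->] := cls_surj c; have [g ->] := cls_surj b; have [f ->] := cls_surj a.
rewrite !vsrcE !vtgtE => hg gf.
have hgf : h i0 = vcat g f i1 by rewrite vcat1.
have hgf' : vcat h g i0 = f i1 by rewrite vcat0.
rewrite !comp_classE //.
(* In d = (h g) f the paths f, g, h occupy [0,1/2], [1/2,3/4] and [3/4,1]; rebracketing these
   intervals in I gives h (g f). *)
pose s1 := seg pid i0 ihalf; pose s23 := seg pid ihalf i1.
pose s2 := seg s23 i0 ihalf; pose s3 := seg s23 ihalf i1.
have e32 : s3 i0 = s2 i1 by rewrite !segE !lerp0 lerp1.
have e21 : s2 i0 = s1 i1 by rewrite !segE !lerp0 !lerp1.
have e321 : s3 i0 = pcat s2 s1 i1 by rewrite pcat1.
set d := vcat (vcat h g) f.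
have df : f = seg (d : pathspace R Y) i0 ihalf :> pathspace R Y.
  by rewrite seg_half1.
have dhg : pcat (h : pathspace R Y) g = seg (d : pathspace R Y) ihalf i1.
  by rewrite seg_half2.
have dg : g = seg (seg (d : pathspace R Y) ihalf i1) i0 ihalf :> pathspace R Y.
  by rewrite -dhg seg_half1.
have dh : h = seg (seg (d : pathspace R Y) ihalf i1) ihalf i1 :> pathspace R Y.
  by rewrite -dhg seg_half2.
apply: (@cls_reparam d (pcat s3 (pcat s2 s1)) id).
- exact: path_continuous.
- exact: id_cts.
- by rewrite pcat0 // pcat0 // segE lerp0.
- by rewrite pcat1 // !segE !lerp1.
- move=> s; apply: (@pcat_comp I Y d) => // u; first by rewrite dh.
  by apply: (@pcat_comp I Y d) => // v; [rewrite dg|rewrite df].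
- by [].
Qed.

Lemma comp_idl a : comp_class (idn_class R p (vtgt a)) a = a.
Proof.
have [f ->] := cls_surj a; rewrite vtgtE /idn_class comp_classE //.
apply: (@cls_reparam f (pcat (pcst R i1) pid) id) => //.
- exact: path_continuous.
- exact: id_cts.
- by rewrite pcat0.
- by rewrite pcat1.
- by move=> s; apply: (@pcat_comp I Y f).
Qed.

Lemma comp_idr a : comp_class a (idn_class R p (vsrc a)) = a.
Proof.
have [f ->] := cls_surj a; rewrite vsrcE /idn_class comp_classE //.
apply: (@cls_reparam f (pcat pid (pcst R i0)) id) => //.
- exact: path_continuous.
- exact: id_cts.
- by rewrite pcat0.
- by rewrite pcat1.
- by move=> s; apply: (@pcat_comp I Y f).
Qed.

Lemma comp_invl a : comp_class (inv_class a) a = idn_class R p (vsrc a).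
Proof.
have [f ->] := cls_surj a; rewrite vsrcE inv_classE.
rewrite comp_classE ?vrevE ?flip0 //.
have e : prev pid i0 = pid i1 by rewrite prevE flip0.
apply: (@cls_reparam f (pcat (prev pid) pid) (fun=> i0)) => //.
- exact: path_continuous.
- exact: cst_continuous.
- by rewrite pcat0.
- by rewrite pcat1 // prevE flip1.
- by move=> s; apply: (@pcat_comp I Y f).
Qed.

Lemma comp_invr a : comp_class a (inv_class a) = idn_class R p (vtgt a).
Proof.
have [f ->] := cls_surj a; rewrite vtgtE inv_classE.
rewrite comp_classE ?vrevE ?flip1 //.
have e : pid i0 = prev pid i1 by rewrite prevE flip1.
apply: (@cls_reparam f (pcat pid (prev pid)) (fun=> i1)) => //.
- exact: path_continuous.
- exact: cst_continuous.
- by rewrite pcat0 // prevE flip0.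
- by rewrite pcat1.
- by move=> s; apply: (@pcat_comp I Y f).
Qed.

(** Both routes along the boundary of I * I lead from (0,0) to (1,1), hence are joined by the
    straight-line homotopy. *)
Lemma square_class (H : I * I -> Y) (l r b t : vpath R p) :
  continuous H -> (forall z w, p (H z) = p (H w)) ->
  (forall s, b s = H (i0, s)) -> (forall s, t s = H (i1, s)) ->
  (forall s, l s = H (s, i0)) -> (forall s, r s = H (s, i1)) ->
  comp_class (cls r) (cls b) = comp_class (cls t) (cls l).
Proof.
move=> cH pH Hb Ht Hl Hr.
rewrite !comp_classE ?Hb ?Hl ?Ht ?Hr //.
have c0 x : continuous (fun s : I => (x : I, s)) by cts.
have c1 x : continuous (fun s : I => (s, x : I)) by cts.
pose pb : pathspace R (I * I)%type := mkpath (@c0 i0).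
pose pt : pathspace R (I * I)%type := mkpath (@c0 i1).
pose pl : pathspace R (I * I)%type := mkpath (@c1 i0).
pose pr : pathspace R (I * I)%type := mkpath (@c1 i1).
apply: (@cls_square H (pcat pr pb) (pcat pt pl)) => //.
- exact: path_continuous.
- exact: path_continuous.
- by rewrite !pcat0.
- by rewrite !pcat1.
- by move=> s; apply: (@pcat_comp _ Y H).
- by move=> s; apply: (@pcat_comp _ Y H).
Qed.

Lemma comp_cancel_l c b a : vsrc c = vtgt b -> vtgt a = vtgt b -> 
  comp_class c b = comp_class c a -> b = a.
Proof.
move=> cb ab e; rewrite -(comp_idl b) -(comp_idl a) ab -cb -comp_invl.
by rewrite -!comp_classA ?vsrc_inv ?e // cb ab.
Qed.

Lemma comp_cancel_r c b a : vsrc b = vtgt c -> vsrc a = vsrc b -> 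
  comp_class b c = comp_class a c -> b = a.
Proof.
move=> cb ab e; rewrite -(comp_idr b) -(comp_idr a) ab cb -comp_invr.
by rewrite !comp_classA ?vtgt_inv ?e // ab.
Qed.

End VerticalGroupoid.

(** * Slides *)

Section Slides.
Variables (R : realType) (X : topologicalType).
Local Notation I := (unitI R).
Local Notation i0 := (i0 R).
Local Notation i1 := (i1 R).
Local Notation PX := (pathspace R X).

Lemma slideE (u v : R -> R) cu cv uv0 uv1 (c : PX) t s :
  (@slide R X u v cu cv uv0 uv1 c t : PX) s =
  c (clamp ((1 - ival t) * u (ival s) + ival t * v (ival s))).
Proof. by []. Qed.

Lemma slide0 (u v : R -> R) cu cv uv0 uv1 (c : PX) s :
  (@slide R X u v cu cv uv0 uv1 c i0 : PX) s = c (clamp (u (ival s))).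
Proof. by rewrite slideE ival0; congr (c (clamp _)); ring. Qed.

Lemma slide1 (u v : R -> R) cu cv uv0 uv1 (c : PX) s :
  (@slide R X u v cu cv uv0 uv1 c i1 : PX) s = c (clamp (v (ival s))).
Proof. by rewrite slideE ival1; congr (c (clamp _)); ring. Qed.

Lemma pcat_lo (Y : topologicalType) (g f : pathspace R Y) x :
  g i0 = f i1 -> 0 <= x -> x <= 2^-1 -> pcat g f (clamp x) = f (clamp (2 * x)).
Proof.
move=> gf x0 x1; have ix : ival (clamp x) = x by rewrite clampE //; apply/andP; split; lra.
by rewrite pcatE // /cat_fun ix x1 /lft ix.
Qed.

Lemma pcat_hi (Y : topologicalType) (g f : pathspace R Y) x :
  g i0 = f i1 -> 2^-1 <= x -> x <= 1 -> pcat g f (clamp x) = g (clamp (2 * x - 1)).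
Proof.
move=> gf x0 x1; have ix : ival (clamp x) = x by rewrite clampE //; apply/andP; split; lra.
rewrite pcatE // /cat_fun ix; case: ifP => x2; last by rewrite /rgt ix.
have x12 : x = 2^-1 by lra.
by rewrite lft_half ?ix // x12 divff ?pnatr_eq0 // subrr gf.
Qed.

Lemma clamp_ival (P : I -> Prop) :
  (forall x, 0 <= x -> x <= 1 -> P (clamp x)) -> forall s, P s.
Proof. by move=> H s; rewrite -(ivalK s); have /andP[] := ivalP s; exact: H. Qed.

Lemma clamp_ivalE (x : R) : 0 <= x -> x <= 1 -> ival (clamp x) = x.
Proof. by move=> x0 x1; rewrite clampE // x0. Qed.

(** [assoc_rep] is the maximum of affine maps of slopes 1/2, 1 and 2, which cross at 1/2 and 3/4,
    the times at which (h g) f changes path. *)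
Lemma slide_a0 (h g f : PX) : h i0 = g i1 -> g i0 = f i1 ->
  slide_a h g f i0 = pcat (pcat h g) f.
Proof.
move=> hg gf; have hgf := hg; have hgf' := gf.
rewrite -(pcat0 hg) in hgf'; rewrite -(pcat1 gf) in hgf.
apply: path_ext; apply: clamp_ival => x x0 x1; rewrite slide0 clamp_ivalE //.
have [x2|/ltW x2] := leP x 2^-1.
  have -> : assoc_rep x = x / 2.
    by rewrite /assoc_rep max_l // ge_max; apply/andP; split; lra.
  rewrite (pcat_lo hgf) ?(pcat_lo gf) ?(pcat_lo hgf') //;
    [by congr (f (clamp _)); lra|lra..].
have [x4|x4] := leP x (3 / 4).
  have -> : assoc_rep x = x - 4^-1.
    by rewrite /assoc_rep max_r; rewrite max_l //; lra.
  rewrite (pcat_lo hgf) ?(pcat_hi gf) ?(pcat_hi hgf') ?(pcat_lo hg) //;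
    [by congr (g (clamp _)); lra|lra..].
have -> : assoc_rep x = 2 * x - 1.
  by rewrite /assoc_rep max_r; rewrite max_r //; lra.
rewrite (pcat_hi hgf) ?(pcat_hi hgf') ?(pcat_hi hg) //; lra.
Qed.

Lemma slide_a1 (h g f : PX) : slide_a h g f i1 = pcat h (pcat g f).
Proof. by apply: path_ext => s; rewrite slide1 ivalK. Qed.

Lemma slide_r0 (f : PX) : slide_r f i0 = pcat f (pcst R (f i0)).
Proof.
apply: path_ext; apply: clamp_ival => x x0 x1; rewrite slide0 clamp_ivalE //.
have [x2|/ltW x2] := leP x 2^-1.
  by rewrite pcat_lo // /unitr_rep max_l //; lra.
by rewrite pcat_hi // /unitr_rep max_r //; lra.
Qed.

Lemma slide_r1 (f : PX) : slide_r f i1 = f.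
Proof. by apply: path_ext => s; rewrite slide1 ivalK. Qed.

Lemma slide_l0 (f : PX) : slide_l f i0 = pcat (pcst R (f i1)) f.
Proof.
apply: path_ext; apply: clamp_ival => x x0 x1; rewrite slide0 clamp_ivalE //.
have [x2|/ltW x2] := leP x 2^-1.
  by rewrite pcat_lo // /unitl_rep min_r //; lra.
by rewrite pcat_hi // /unitl_rep min_l //; lra.
Qed.

Lemma slide_l1 (f : PX) : slide_l f i1 = f.
Proof. by apply: path_ext => s; rewrite slide1 ivalK. Qed.

Lemma slide_e0 (f : PX) : slide_e f i0 = pcat (prev f) f.
Proof.
apply: path_ext; apply: clamp_ival => x x0 x1; rewrite slide0 clamp_ivalE //.
have e : prev f i0 = f i1 by rewrite prevE flip0.
have [x2|/ltW x2] := leP x 2^-1.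
  by rewrite pcat_lo // /invl_rep min_l //; lra.
rewrite pcat_hi // prevE /flip clamp_ivalE; [|lra..].
by rewrite /invl_rep min_r; [congr (f (clamp _))|]; lra.
Qed.

Lemma slide_e1 (f : PX) : slide_e f i1 = pcst R (f i0).
Proof. by apply: path_ext => s; rewrite slide1. Qed.

Lemma slide_i0 (f : PX) : slide_i f i0 = pcst R (f i1).
Proof. by apply: path_ext => s; rewrite slide0. Qed.

Lemma slide_i1 (f : PX) : slide_i f i1 = pcat f (prev f).
Proof.
apply: path_ext; apply: clamp_ival => x x0 x1; rewrite slide1 clamp_ivalE //.
have e : f i0 = prev f i1 by rewrite prevE flip1.
have [x2|/ltW x2] := leP x 2^-1.
  rewrite pcat_lo // prevE /flip clamp_ivalE; [|lra..].
  by rewrite /invr_rep max_l //; lra.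
by rewrite pcat_hi // /invr_rep max_r //; lra.
Qed.

Lemma slide_continuous (T : topologicalType) (u v : R -> R) cu cv uv0 uv1
    (c : T -> PX) (t : T -> I) : continuous c -> continuous t ->
  continuous (fun z => @slide R X u v cu cv uv0 uv1 (c z) (t z)).
Proof.
move=> cc ct; apply: path_valued_continuous.
pose w (q : T * I) := clamp ((1 - ival (t q.1)) * u (ival q.2) + ival (t q.1) * v (ival q.2)).
apply: (@eval_continuous R _ _ (fun q : T * I => c q.1) w); first by cts.
have c1 : continuous (fun q : T * I => ival (t q.1)) by cts.
have c2 (k : R -> R) : continuous k -> continuous (fun q : T * I => k (ival q.2)).
  by move=> ck; cts.
apply: clamp_comp_continuous => z.
apply: (@continuousD R R (T * I)%type (fun q => (1 - ival (t q.1)) * u (ival q.2))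
         (fun q => ival (t q.1) * v (ival q.2))).
  apply: (@continuousM R (T * I)%type (fun q => 1 - ival (t q.1))
            (fun q => u (ival q.2))); last exact: c2.
  apply: (@continuousB R R (T * I)%type (cst 1) (fun q => ival (t q.1))).
    exact: cst_continuous.
  exact: c1.
apply: (@continuousM R (T * I)%type (fun q => ival (t q.1))
          (fun q => v (ival q.2))); [exact: c1|exact: c2].
Qed.

(* The commuting square is (t, s) |-> slide (D s) t. *)
Lemma slide_natural (u v : R -> R) cu cv uv0 uv1 (D : I -> PX) (b t : vpath R (@ends R X)) :
  continuous D ->
  (forall s, b s = @slide R X u v cu cv uv0 uv1 (D s) i0) ->
  (forall s, t s = @slide R X u v cu cv uv0 uv1 (D s) i1) ->
  comp_class (cls (@slide R X u v cu cv uv0 uv1 (D i1))) (cls b) =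
  comp_class (cls t) (cls (@slide R X u v cu cv uv0 uv1 (D i0))).
Proof.
move=> cD eb et.
apply: (@square_class R PX _ (@ends R X) (fun z => slide cu cv uv0 uv1 (D z.2) z.1)) => //.
  by apply: slide_continuous; cts.
move=> z w.
have E y : ends (slide cu cv uv0 uv1 (D y.2) y.1) = ends (b i0).
  by rewrite (vpathP _ _ i0) -eb (vpathP b _ i0).
by rewrite !E.
Qed.

End Slides.

(** * Algebra of two-cells *)

Section TwoCells.
Variables (R : realType) (X : topologicalType).
Local Notation I := (unitI R).
Local Notation i0 := (i0 R).
Local Notation i1 := (i1 R).
Local Notation PX := (pathspace R X).
Local Notation E := (@ends R X).
Local Notation prev_class :=
  (map_class (v := @swap_pair X) (@prev_continuous R X) (@prev_ends R X)).
Implicit Types (a b : vclass R E) (f g : vpath R E) (c d : PX).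

Lemma prev_eq c : prev c i0 = c i1. Proof. by rewrite prevE flip0. Qed.
Lemma prev_eq1 c : prev c i1 = c i0. Proof. by rewrite prevE flip1. Qed.

Lemma ends_vtgt a : ends (vtgt a) = ends (vsrc a).
Proof. exact: p_vtgt. Qed.

Lemma hcomp_cls b a : vsrc b i0 = vsrc a i1 -> exists g f,
  [/\ b = cls g, a = cls f, g i0 i0 = f i0 i1 & hcomp_class b a = cls (hcat g f)].
Proof.
have [g ->] := cls_surj b; have [f ->] := cls_surj a.
move=> H; exists g, f; have gf : g i0 i0 = f i0 i1 by move: H; rewrite !vsrcE.
by rewrite hcomp_classE.
Qed.

Lemma vsrc_hcomp b a : vsrc b i0 = vsrc a i1 ->
  vsrc (hcomp_class b a) = pcat (vsrc b) (vsrc a).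
Proof.
move=> /hcomp_cls [g [f [-> -> gf ->]]].
by rewrite (vsrcE (hcat g f)) (vsrcE g) (vsrcE f) hcatE.
Qed.

Lemma vtgt_hcomp b a : vsrc b i0 = vsrc a i1 ->
  vtgt (hcomp_class b a) = pcat (vtgt b) (vtgt a).
Proof.
move=> /hcomp_cls [g [f [-> -> gf ->]]].
by rewrite (vtgtE (hcat g f)) (vtgtE g) (vtgtE f) hcatE.
Qed.

Lemma hcomp_idn c d : d i0 = c i1 ->
  hcomp_class (idn_class R E d) (idn_class R E c) = idn_class R E (pcat d c).
Proof. by move=> dc; rewrite hcomp_classE //; apply: cls_ext => s; rewrite hcatE. Qed.

(** Interchange already holds on representatives: [vcat] cuts the time of a two-cell while [hcat]
    acts at each time, so they commute pointwise. *)
Lemma hcomp_comp b' b a' a :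
  vsrc b' = vtgt b -> vsrc a' = vtgt a -> vsrc b i0 = vsrc a i1 ->
  hcomp_class (comp_class b' b) (comp_class a' a) =
  comp_class (hcomp_class b' a') (hcomp_class b a).
Proof.
have [g' ->] := cls_surj b'; have [f' ->] := cls_surj a'.
have [g ->] := cls_surj b; have [f ->] := cls_surj a.
rewrite !vsrcE !vtgtE => gg ff gf.
have gf' : g' i0 i0 = f' i0 i1.
  by rewrite gg ff (vpath_ends g i1).1 (vpath_ends f i1).2.
have gfs s : g s i0 = f s i1 by rewrite (vpath_ends g s).1 (vpath_ends f s).2.
have gfs' s : g' s i0 = f' s i1 by rewrite (vpath_ends g' s).1 (vpath_ends f' s).2.
have hgf : hcat g' f' i0 = hcat g f i1 by rewrite !hcatE // gg ff.
have vgf : vcat g' g i0 i0 = vcat f' f i0 i1 by rewrite !vcat0.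
rewrite (comp_classE gg) (comp_classE ff) (hcomp_classE gf) (hcomp_classE gf').
rewrite (comp_classE hgf) (hcomp_classE vgf).
apply: cls_ext => s; rewrite hcatE // !vcatE // /cat_fun.
by case: ifP => _; rewrite hcatE.
Qed.

Lemma map_prev_src a : vsrc (prev_class a) = prev (vsrc a).
Proof. by have [f ->] := cls_surj a; rewrite map_classE !vsrcE. Qed.

Lemma map_prev_tgt a : vtgt (prev_class a) = prev (vtgt a).
Proof. by have [f ->] := cls_surj a; rewrite map_classE !vtgtE. Qed.

Lemma map_prev_comp b a : vsrc b = vtgt a ->
  prev_class (comp_class b a) =
  comp_class (prev_class b) (prev_class a).
Proof.
have [g ->] := cls_surj b; have [f ->] := cls_surj a.
rewrite vsrcE vtgtE => gf; rewrite (comp_classE gf) !map_classE.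
have gf' := congr1 (@prev R X) gf; rewrite comp_classE //.
apply: cls_ext => s; rewrite [RHS]vcatE //.
rewrite [LHS](congr1 (@prev R X) (vcatE s gf)) /cat_fun.
by case: ifP.
Qed.

Lemma natural_a a b (a' : vclass R E) :
  vsrc a i0 = vsrc b i1 -> vsrc b i0 = vsrc a' i1 ->
  comp_class (cls (slide_a (vtgt a) (vtgt b) (vtgt a')))
    (hcomp_class (hcomp_class a b) a') =
  comp_class (hcomp_class a (hcomp_class b a'))
    (cls (slide_a (vsrc a) (vsrc b) (vsrc a'))).
Proof.
have [h ->] := cls_surj a; have [g ->] := cls_surj b; have [f ->] := cls_surj a'.
rewrite !vsrcE !vtgtE => hg gf.
have hgs s : h s i0 = g s i1 by rewrite (vpath_ends h s).1 (vpath_ends g s).2.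
have gfs s : g s i0 = f s i1 by rewrite (vpath_ends g s).1 (vpath_ends f s).2.
have hg_f : hcat h g i0 i0 = f i0 i1 by rewrite hcatE // pcat0.
have h_gf : h i0 i0 = hcat g f i0 i1 by rewrite hcatE // pcat1.
rewrite (hcomp_classE hg) (hcomp_classE gf) (hcomp_classE hg_f) (hcomp_classE h_gf).
apply: (@slide_natural R X _ _ _ _ _ _ (fun s => pcat (h s : PX) (pcat (g s : PX) (f s : PX)))).
- cts => //; first by move=> s; rewrite pcat1.
- by move=> s; rewrite (hcatE _ hg_f) (hcatE _ hg) [RHS]slide_a0.
- by move=> s; rewrite (hcatE _ h_gf) (hcatE _ gf) [RHS]slide_a1.
Qed.

Lemma natural_r a :
  comp_class (cls (slide_r (vtgt a))) (hcomp_class a (idn_class R E (pcst R (vsrc a i0)))) =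
  comp_class a (cls (slide_r (vsrc a))).
Proof.
have [f ->] := cls_surj a; rewrite !vsrcE vtgtE hcomp_classE //.
apply: (@slide_natural R X _ _ _ _ _ _ (fun s => f s)); first by cts.
- by move=> s; rewrite hcatE // [RHS]slide_r0 (vpath_ends f s).1.
- by move=> s; rewrite [RHS]slide_r1.
Qed.

Lemma natural_l a :
  comp_class (cls (slide_l (vtgt a))) (hcomp_class (idn_class R E (pcst R (vsrc a i1))) a) =
  comp_class a (cls (slide_l (vsrc a))).
Proof.
have [f ->] := cls_surj a; rewrite !vsrcE vtgtE hcomp_classE //.
apply: (@slide_natural R X _ _ _ _ _ _ (fun s => f s)); first by cts.
- by move=> s; rewrite hcatE // [RHS]slide_l0 (vpath_ends f s).2.
- by move=> s; rewrite [RHS]slide_l1.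
Qed.

Lemma natural_e a :
  comp_class (cls (slide_e (vtgt a)))
    (hcomp_class (prev_class a) a) =
  comp_class (idn_class R E (pcst R (vsrc a i0))) (cls (slide_e (vsrc a))).
Proof.
have [f ->] := cls_surj a; rewrite map_classE !vsrcE vtgtE hcomp_classE ?prev_eq //=.
apply: (@slide_natural R X _ _ _ _ _ _ (fun s => f s)); first by cts.
- by move=> s; rewrite hcatE ?prev_eq //= [RHS]slide_e0.
- by move=> s; rewrite [RHS]slide_e1 (vpath_ends f s).1.
Qed.

Lemma natural_i a :
  comp_class (cls (slide_i (vtgt a))) (idn_class R E (pcst R (vsrc a i1))) =
  comp_class (hcomp_class a (prev_class a))
    (cls (slide_i (vsrc a))).
Proof.
have [f ->] := cls_surj a; rewrite map_classE !vsrcE vtgtE hcomp_classE ?prev_eq1 //=.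
apply: (@slide_natural R X _ _ _ _ _ _ (fun s => f s)); first by cts.
- by move=> s; rewrite [RHS]slide_i0 (vpath_ends f s).2.
- by move=> s; rewrite hcatE ?prev_eq1 //= [RHS]slide_i1.
Qed.

(* [a] is the image under [c] of a two-cell from [p] to [q] between paths in I.
   All such two-cells with the same source and target coincide, since I is
   convex; this gives the coherence laws. *)
Definition over c a (p q : pathspace R I) := exists (phi : vpath R (@ends R I)) f,
  [/\ phi i0 = p, phi i1 = q, a = cls f & forall s u, (f s : PX) u = c ((phi s : pathspace R I) u)].

Lemma over_uniq c a b p q : over c a p q -> over c b p q -> a = b.
Proof.
move=> [phi [f [phi0 phi1 -> fE]]] [psi [g [psi0 psi1 -> gE]]]; apply/clsP.
(* Both two-cells in I are vertical with source p, so their endpoints agree at all times, and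
   interpolating between them stays vertical. *)
have pp s : (phi s i0 = psi s i0) /\ (phi s i1 = psi s i1).
  by have [-> ->] := vpath_ends phi s; have [-> ->] := vpath_ends psi s; rewrite phi0 psi0.
have cG : continuous (fun w : (I * I) * I => c (lerp w.1.1 (phi w.1.2 w.2) (psi w.1.2 w.2))).
  by cts.
have HE t s u : curry_path cG (t, s) u = c (lerp t (phi s u) (psi s u)) by [].
exists (curry_path cG); split.
- exact: curry_path_continuous.
- by move=> s; apply: path_ext => u; rewrite [LHS]HE lerp0 fE.
- by move=> s; apply: path_ext => u; rewrite [LHS]HE lerp1 gE.
- move=> t s s'; rewrite /ends !HE.
  have [<- <-] := pp s; have [<- <-] := pp s'.
  by have [-> ->] := vpath_ends phi s; have [-> ->] := vpath_ends phi s'; rewrite !lerpxx.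
- move=> t; split; apply: path_ext => u; rewrite [LHS]HE.
    by rewrite phi0 psi0 lerpxx fE phi0.
  by rewrite phi1 psi1 lerpxx fE phi1.
Qed.

Lemma over_comp c b a p q r : over c b q r -> over c a p q -> over c (comp_class b a) p r.
Proof.
move=> [psi [g [psi0 psi1 -> gE]]] [phi [f [phi0 phi1 -> fE]]].
have pq : psi i0 = phi i1 by rewrite psi0.
have gf : g i0 = f i1 by apply: path_ext => u; rewrite gE fE pq.
exists (vcat psi phi), (vcat g f); split.
- by rewrite vcat0.
- by rewrite vcat1.
- by rewrite comp_classE.
- by move=> s u; rewrite !vcatE // /cat_fun; case: ifP => _.
Qed.

Lemma over_inv c a p q : over c a p q -> over c (inv_class a) q p.
Proof.
move=> [phi [f [phi0 phi1 -> fE]]]; exists (vrev phi), (vrev f); split.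
- by rewrite vrevE flip0.
- by rewrite vrevE flip1.
- by rewrite inv_classE.
- by move=> s u; rewrite !vrevE.
Qed.

Lemma over_idn c d (p : pathspace R I) : (forall u, d u = c (p u)) -> over c (idn_class R E d) p p.
Proof. by move=> dp; exists (vcst R _ p), (vcst R _ d); split. Qed.

Lemma over_hcomp c b a (p q p' q' : pathspace R I) :
  p i0 = p' i1 -> over c b p q -> over c a p' q' ->
  over c (hcomp_class b a) (pcat p p') (pcat q q').
Proof.
move=> pp [psi [g [psi0 psi1 -> gE]]] [phi [f [phi0 phi1 -> fE]]].
have pq : psi i0 i0 = phi i0 i1 by rewrite psi0 phi0.
have pqs s : psi s i0 = phi s i1 by rewrite (vpath_ends psi s).1 (vpath_ends phi s).2.
have gf : g i0 i0 = f i0 i1 by rewrite gE fE pq.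
exists (hcat psi phi), (hcat g f); split.
- by rewrite hcatE // psi0 phi0.
- by rewrite hcatE // psi1 phi1.
- by rewrite hcomp_classE.
- by move=> s u; rewrite !hcatE //; exact: pcat_comp.
Qed.

Lemma over_slide c (u v : R -> R) cu cv uv0 uv1 d (p : pathspace R I) :
  (forall u, d u = c (p u)) ->
  over c (cls (@slide R X u v cu cv uv0 uv1 d))
    (@slide R I u v cu cv uv0 uv1 p i0) (@slide R I u v cu cv uv0 uv1 p i1).
Proof.
move=> dp; exists (slide cu cv uv0 uv1 p), (slide cu cv uv0 uv1 d); split => // s w.
by rewrite !slideE dp.
Qed.

Lemma over_a c (h g f : PX) (p q r : pathspace R I) :
  (forall u, h u = c (p u)) -> (forall u, g u = c (q u)) -> (forall u, f u = c (r u)) ->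
  p i0 = q i1 -> q i0 = r i1 ->
  over c (cls (slide_a h g f)) (pcat (pcat p q) r) (pcat p (pcat q r)).
Proof.
move=> hp gq fr pq qr; rewrite -(slide_a0 pq qr) -(slide_a1 p q r).
by apply: over_slide; apply: pcat_comp => //; [exact: pcat_comp|rewrite pcat1].
Qed.

Lemma over_r c (f : PX) (p : pathspace R I) : (forall u, f u = c (p u)) ->
  over c (cls (slide_r f)) (pcat p (pcst R (p i0))) p.
Proof. by move=> fp; rewrite -slide_r0 -{2}(slide_r1 p); exact: over_slide. Qed.

Lemma over_l c (f : PX) (p : pathspace R I) : (forall u, f u = c (p u)) ->
  over c (cls (slide_l f)) (pcat (pcst R (p i1)) p) p.
Proof. by move=> fp; rewrite -slide_l0 -{2}(slide_l1 p); exact: over_slide. Qed.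

Lemma over_e c (f : PX) (p : pathspace R I) : (forall u, f u = c (p u)) ->
  over c (cls (slide_e f)) (pcat (prev p) p) (pcst R (p i0)).
Proof. by move=> fp; rewrite -slide_e0 -slide_e1; exact: over_slide. Qed.

Lemma over_i c (f : PX) (p : pathspace R I) : (forall u, f u = c (p u)) ->
  over c (cls (slide_i f)) (pcst R (p i1)) (pcat p (prev p)).
Proof. by move=> fp; rewrite -slide_i0 -slide_i1; exact: over_slide. Qed.

Lemma pentagon (k h g f : PX) : k i0 = h i1 -> h i0 = g i1 -> g i0 = f i1 ->
  comp_class (cls (slide_a k h (pcat g f))) (cls (slide_a (pcat k h) g f)) =
  comp_class (comp_class (hcomp_class (idn_class R E k) (cls (slide_a h g f)))
      (cls (slide_a k (pcat h g) f)))
    (hcomp_class (cls (slide_a k h g)) (idn_class R E f)).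
Proof.
move=> kh hg gf.
have hgf : h i0 = pcat g f i1 by rewrite pcat1.
have khgf : k i0 = pcat h (pcat g f) i1 by rewrite pcat1.
(* In c = k (h (g f)) the paths k, h, g, f occupy [1/2,1], [1/4,1/2], [1/8,1/4] and [0,1/8]. *)
pose c := pcat k (pcat h (pcat g f)).
pose pk := seg (pid R) (ihalf R) i1; pose p1 := seg (pid R) i0 (ihalf R).
pose ph := seg p1 (ihalf R) i1; pose p2 := seg p1 i0 (ihalf R).
pose pg := seg p2 (ihalf R) i1; pose pf := seg p2 i0 (ihalf R).
have ek u : k u = c (pk u) by rewrite -{1}(seg_half2 khgf).
have e1 u : pcat h (pcat g f) u = c (p1 u) by rewrite -{1}(seg_half1 khgf).
have eh u : h u = c (ph u) by rewrite -{1}(seg_half2 hgf) !segE e1.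
have e2 u : pcat g f u = c (p2 u) by rewrite -{1}(seg_half1 hgf) !segE e1.
have eg u : g u = c (pg u) by rewrite -{1}(seg_half2 gf) !segE e2.
have ef u : f u = c (pf u) by rewrite -{1}(seg_half1 gf) !segE e2.
have pkh : pk i0 = ph i1 by rewrite !segE !lerp0 !lerp1.
have phg : ph i0 = pg i1 by rewrite !segE !lerp0 !lerp1.
have pgf : pg i0 = pf i1 by rewrite !segE !lerp0 !lerp1.
have egf : forall u, pcat g f u = c (pcat pg pf u) by exact: pcat_comp.
have ekh : forall u, pcat k h u = c (pcat pk ph u) by exact: pcat_comp.
have ehg : forall u, pcat h g u = c (pcat ph pg u) by exact: pcat_comp.
apply: (@over_uniq c _ _ (pcat (pcat (pcat pk ph) pg) pf) (pcat pk (pcat ph (pcat pg pf)))).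
  by apply: over_comp; apply: over_a => //; rewrite ?pcat1 ?pcat0.
apply: over_comp; last first.
  apply: over_hcomp; first by rewrite !pcat0.
    exact: over_a.
  exact: over_idn.
apply: over_comp; last by apply: over_a => //; rewrite ?pcat1 ?pcat0.
apply: over_hcomp; first by rewrite !pcat1 ?pcat0 ?pcat1.
  exact: over_idn.
exact: over_a.
Qed.

Lemma triangle (g f : PX) : g i0 = f i1 ->
  comp_class (hcomp_class (idn_class R E g) (cls (slide_l f)))
    (cls (slide_a g (pcst R (g i0)) f)) =
  hcomp_class (cls (slide_r g)) (idn_class R E f).
Proof.
move=> gf; pose c := pcat g f.
pose pg := seg (pid R) (ihalf R) i1; pose pf := seg (pid R) i0 (ihalf R).
have eg u : g u = c (pg u) by rewrite -{1}(seg_half2 gf).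
have ef u : f u = c (pf u) by rewrite -{1}(seg_half1 gf).
have pgf : pg i0 = pf i1 by rewrite !segE !lerp0 !lerp1.
apply: (@over_uniq c _ _ (pcat (pcat pg (pcst R (pg i0))) pf) (pcat pg pf)).
  apply: (@over_comp _ _ _ _ (pcat pg (pcat (pcst R (pg i0)) pf))).
    apply: over_hcomp; [by rewrite pcat1|exact: over_idn|].
    by rewrite pgf; exact: over_l.
  by apply: over_a => // u; exact: eg.
apply: over_hcomp; [by rewrite pcat0|exact: over_r|exact: over_idn].
Qed.

Lemma inverse_law (f : PX) :
  comp_class (comp_class (hcomp_class (idn_class R E f) (cls (slide_e f)))
    (cls (slide_a f (prev f) f))) (hcomp_class (cls (slide_i f)) (idn_class R E f)) =
  comp_class (inv_class (cls (slide_r f))) (cls (slide_l f)).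
Proof.
(* Every path in this law runs to and fro along f, so f itself is the common path and p is the
   identity of I. *)
pose p := pid R; have ef u : f u = f (p u) by [].
apply: (@over_uniq f _ _ (pcat (pcst R (p i1)) p) (pcat p (pcst R (p i0)))).
  apply: (@over_comp _ _ _ _ (pcat (pcat p (prev p)) p)); last first.
    by apply: over_hcomp => //; [exact: over_i|exact: over_idn].
  apply: (@over_comp _ _ _ _ (pcat p (pcat (prev p) p))); last first.
    by apply: over_a => //; rewrite ?prevE ?flip0 ?flip1.
  by apply: over_hcomp; [rewrite pcat1 ?prevE ?flip0 ?flip1|exact: over_idn|exact: over_e].
by apply: over_comp; [apply: over_inv; exact: over_r|exact: over_l].
Qed.

End TwoCells.

(** * Null two-cells *)

Section Fillers.
Variables (R : realType) (X : topologicalType).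
Local Notation I := (unitI R).
Local Notation i0 := (i0 R).
Local Notation i1 := (i1 R).
Local Notation PX := (pathspace R X).
Local Notation E := (@ends R X).

(** No matching of endpoints is required, because otherwise [pcat] returns its second argument. *)
Lemma pcat_ind (Y : topologicalType) (Q : Y -> Prop) (g f : pathspace R Y) :
  (forall s, Q (g s)) -> (forall s, Q (f s)) -> forall s, Q (pcat g f s).
Proof.
move=> Qg Qf s; have [gf|gf] := pselect (g i0 = f i1).
  by rewrite pcatE // /cat_fun; case: ifP.
by rewrite /pcat; case: pselect.
Qed.

Lemma seg_xx (Y : topologicalType) (P : pathspace R Y) a : seg P a a = pcst R (P a).
Proof. by apply: path_ext => s; rewrite segE lerpxx. Qed.

(** The argument runs in the groupoid of classes vertical over U : X -> Prop, the fundamental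
    groupoid of U for paths inside U. There the loop g^-1 f is null, and cancelling g^-1 gives f =
    g. *)
Lemma simply_connected_paths (U : set X) (f g : PX) : simply_connected R U ->
  (forall s, U (f s)) -> (forall s, U (g s)) -> f i0 = g i0 -> f i1 = g i1 ->
  exists P : pathspace R PX, [/\ P i0 = f, P i1 = g, forall t u, U (P t u)
    & forall t, P t i0 = f i0 /\ P t i1 = f i1].
Proof.
move=> sU fU gU fg0 fg1.
have vU (k : PX) : (forall s, U (k s)) -> vertical U k.
  by move=> kU s t; apply/propext; split=> _; exact: kU.
pose f' := mkvpath (vU _ fU); pose g' := mkvpath (vU _ gU).
have gf : vrev g' i0 = f' i1 by rewrite vrevE flip0.
have loopU s : U (vcat (vrev g') f' s).
  by apply: pcat_ind => u; [rewrite vrevE; exact: gU|exact: fU].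
have [|||h [ch hU h0 h1 hb]] := sU (f i0) (vcat (vrev g') f') (fU i0).
- exact: path_continuous.
- by [].
- move=> s [->|->]; first by rewrite vcat0.
  by rewrite vcat1 // vrevE flip1 fg0.
have hU' z w : U (h z) = U (h w) by apply/propext; split => _; exact: hU.
have null : cls (vcat (vrev g') f') = idn_class R U (f i0).
  apply/clsP; exists h; split => //.
    by move=> t; rewrite vcat0 // vcat1 // vrevE flip1 /= !hb -?fg0; try by [right|left].
have : cls f' = cls g'.
  apply: (@comp_cancel_l _ _ _ _ (inv_class (cls g'))).
  - by rewrite vsrc_inv !vtgtE.
  - by rewrite !vtgtE.
  - rewrite comp_invl inv_classE comp_classE // null vsrcE.
    by congr idn_class.
move=> /clsP [k [ck k0 k1 kv ke]].
have kU z : U (k z).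
  by case: z => t s; rewrite (kv t s i0); have [-> _] := ke t; exact: fU.
exists (mkpath (@curry_path_continuous R I X _ ck)); split => //.
- by apply: path_ext => s; exact: k0.
- by apply: path_ext => s; exact: k1.
- by move=> t u; exact: kU.
Qed.

(* The next three lemmas reduce a two-cell inside U to a sphere in U: first at a
   constant path, then at a loop by whiskering with the inverse path. *)
Lemma null_at_constant (U : set X) x (f : vpath R E) :
  zero_on_pi R (@boundary2 R) U setT -> (forall s u, U (f s u)) ->
  f i0 = pcst R x -> f i1 = pcst R x -> cls f = idn_class R E (pcst R x).
Proof.
move=> zU fU f0 f1.
have cf : continuous (fun z : I * I => (f z.1 : PX) z.2) by cts.
have Ux : U x by rewrite -[x]/(pcst R x i0) -f0.
have [||h [ch _ h0 h1 hb]] := zU x _ Ux cf.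
- by move=> z; exact: fU.
- move=> [s u] [[|]|[|]] /= ->; rewrite ?f0 ?f1 //.
    by rewrite (vpath_ends f s).1 f0.
  by rewrite (vpath_ends f s).2 f0.
have ch' : continuous (fun w : (I * I) * I => h (w.1.1, (w.1.2, w.2))) by cts.
have HE t s u : curry_path ch' (t, s) u = h (t, (s, u)) by [].
apply/clsP; exists (curry_path ch'); split.
- exact: curry_path_continuous.
- by move=> s; apply: path_ext => u; rewrite [LHS]HE h0.
- by move=> s; apply: path_ext => u; rewrite [LHS]HE h1.
- by move=> t s s'; rewrite /ends !HE !hb //; right; by [left|right].
- move=> t; split; apply: path_ext => u; rewrite [LHS]HE hb ?f0 ?f1 //; left; by [left|right].
Qed.

Lemma whisker_faithful (c : PX) (a : vclass R E) :
  vsrc a = c -> vtgt a = c ->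
  hcomp_class (idn_class R E (prev c)) a = idn_class R E (pcat (prev c) c) ->
  a = idn_class R E c.
Proof.
move=> sa ta e; have cp := prev_eq c; have pc := esym (prev_eq1 c).
have c_pc : c i0 = pcat (prev c) c i1 by rewrite pcat1.
have cp_c : pcat c (prev c) i0 = c i1 by rewrite pcat0.
have na := natural_a (a := idn_class R E c) (b := idn_class R E (prev c)) (a' := a).
rewrite vsrc_idn !vtgt_idn vsrc_idn sa ta e in na.
move: na => /(_ pc cp); rewrite (hcomp_idn pc) (hcomp_idn c_pc) => na.
have sla : vsrc (cls (slide_a c (prev c) c)) = pcat (pcat c (prev c)) c.
  by rewrite vsrcE slide_a0.
have tla : vtgt (cls (slide_a c (prev c) c)) = pcat c (pcat (prev c) c).
  by rewrite vtgtE slide_a1.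
rewrite -tla comp_idl in na.
(* Whiskering the hypothesis by c gives c (prev c a) = id, and the associator moves this to (c prev
   c) a = id. *)
have e1 : hcomp_class (idn_class R E (pcat c (prev c))) a =
          idn_class R E (pcat (pcat c (prev c)) c).
  apply: (@comp_cancel_l _ _ _ _ (cls (slide_a c (prev c) c))).
  - by rewrite sla vtgt_hcomp ?vsrc_idn ?sa // vtgt_idn ta.
  - by rewrite vtgt_idn vtgt_hcomp ?vsrc_idn ?sa // vtgt_idn ta.
  - by rewrite na -sla comp_idr.
pose i := cls (slide_i c).
have si : vsrc i = pcst R (c i1) by rewrite vsrcE slide_i0.
have ti : vtgt i = pcat c (prev c) by rewrite vtgtE slide_i1.
(* Interchange, with the horizontal composite of i and a split as whiskering by i followed by
   whiskering a with c prev c. *)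
have hi : hcomp_class i a = hcomp_class i (idn_class R E c).
  have := hcomp_comp (b' := idn_class R E (pcat c (prev c))) (b := i) (a' := a)
    (a := idn_class R E c).
  rewrite vsrc_idn ti sa vtgt_idn si vsrc_idn e1 => /(_ erefl erefl erefl).
  rewrite -ti comp_idl -sa comp_idr => ->.
  have {1}-> : pcat (vtgt i) (vsrc a) = vtgt (hcomp_class i (idn_class R E (vsrc a))).
    by rewrite vtgt_hcomp ?vtgt_idn // si vsrc_idn sa.
  by rewrite comp_idl.
(* The same composite split in the other order; cancelling the whiskered i leaves a whiskered with a
   constant path. *)
have e2 : hcomp_class (idn_class R E (pcst R (c i1))) a =
          idn_class R E (pcat (pcst R (c i1)) c).
  have := hcomp_comp (b' := i) (b := idn_class R E (pcst R (c i1)))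
    (a' := idn_class R E c) (a := a).
  rewrite si vsrc_idn !vtgt_idn vsrc_idn ta sa => /(_ erefl erefl erefl).
  rewrite -{1}si comp_idr -{1}ta comp_idl hi => ee.
  apply: (@comp_cancel_l _ _ _ _ (hcomp_class i (idn_class R E c))).
  - by rewrite vsrc_hcomp ?vtgt_hcomp ?si ?vsrc_idn ?sa ?vtgt_idn ?ta.
  - by rewrite vtgt_idn vtgt_hcomp ?vsrc_idn ?sa ?vtgt_idn ?ta.
  - rewrite -ee.
    have -> : pcat (pcst R (c i1)) c = vsrc (hcomp_class i (idn_class R E c)).
      by rewrite vsrc_hcomp ?si ?vsrc_idn.
    by rewrite comp_idr.
(* Naturality of the left unitor removes the constant path. *)
have := natural_l a; rewrite sa ta e2.
have -> : pcat (pcst R (c i1)) c = vsrc (cls (slide_l c)) by rewrite vsrcE slide_l0.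
rewrite comp_idr => el.
apply: (@comp_cancel_r _ _ _ _ (cls (slide_l c))).
- by rewrite sa vtgtE slide_l1.
- by rewrite vsrc_idn sa.
- rewrite -el.
  have {2}-> : c = vtgt (cls (slide_l c)) by rewrite vtgtE slide_l1.
  by rewrite comp_idl.
Qed.

Lemma null_loop (U : set X) c (f : vpath R E) :
  zero_on_pi R (@boundary2 R) U setT -> (forall s u, U (f s u)) ->
  f i0 = c -> f i1 = c -> cls f = idn_class R E c.
Proof.
move=> zU fU f0 f1; apply: whisker_faithful; rewrite ?vsrcE ?vtgtE //.
have cU u : U (c u) by rewrite -f0.
have cf : vcst R E (prev c) i0 i0 = f i0 i1 by rewrite f0 -prev_eq.
pose g := hcat (vcst R E (prev c)) f.
have g0 : g i0 = pcat (prev c) c by rewrite hcatE // f0.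
have g1 : g i1 = pcat (prev c) c by rewrite hcatE // f1.
pose e := slide_e c.
have e0 : e i0 = pcat (prev c) c by rewrite slide_e0.
have e1 : e i1 = pcst R (c i0) by rewrite slide_e1.
have ge : g i0 = vrev e i1 by rewrite vrevE flip1 e0.
have eg : e i0 = vcat g (vrev e) i1 by rewrite vcat1 // e0.
pose n := vcat e (vcat g (vrev e)).
have n0 : n i0 = pcst R (c i0) by rewrite !vcat0 // vrevE flip0 e1.
have n1 : n i1 = pcst R (c i0) by rewrite vcat1.
have eU s u : U (e s u) by rewrite slideE.
have nU s : forall u, U (n s u).
  apply: (@pcat_ind PX (fun d => forall u, U (d u))) => [//|{}s].
  apply: (@pcat_ind PX (fun d => forall u, U (d u))) => {}s u.
    rewrite [g s](hcatE _ cf); apply: pcat_ind => v; first exact: cU.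
    exact: fU.
  by rewrite vrevE.
have nn : cls n = idn_class R E (pcst R (c i0)) by exact: null_at_constant nU n0 n1.
rewrite [LHS](hcomp_classE cf) -/g.
have se : vsrc (cls e) = pcat (prev c) c by rewrite vsrcE.
have te : vtgt (cls e) = pcst R (c i0) by rewrite vtgtE.
apply: (@comp_cancel_r _ _ _ _ (inv_class (cls e))).
- by rewrite vtgt_inv se vsrcE.
- by rewrite vsrc_idn vsrcE.
apply: (@comp_cancel_l _ _ _ _ (cls e)).
- by rewrite inv_classE comp_classE // se vtgtE vcat1.
- have H : vsrc (idn_class R E (pcat (prev c) c)) = vtgt (inv_class (cls e)).
    by rewrite vsrc_idn vtgt_inv se.
  by rewrite (vtgt_comp H) vtgt_idn inv_classE (comp_classE ge) vtgtE vcat1 // g1.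
- rewrite -se -(vtgt_inv (cls e)) comp_idl comp_invr te -nn inv_classE.
  by rewrite (comp_classE ge) (comp_classE eg).
Qed.

(** The value of q1 (c q0) at constant q0 and q1, bracketed exactly as in the constructions that
    move endpoints. *)
Definition pad (c : PX) : PX := pcat (pcst R (c i1)) (pcat c (pcst R (c i0))).

Lemma pad_eq (c : PX) : pcst R (c i1) i0 = pcat c (pcst R (c i0)) i1.
Proof. by rewrite pcat1. Qed.

Lemma pad_i0 (c : PX) : pad c i0 = c i0.
Proof. by rewrite pcat0 ?pad_eq // pcat0. Qed.

Lemma pad_i1 (c : PX) : pad c i1 = c i1.
Proof. by rewrite pcat1 ?pad_eq. Qed.

Lemma pad_continuous (T : topologicalType) (c : T -> PX) :
  continuous c -> continuous (fun t => pad (c t)).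
Proof. by move=> cc; rewrite /pad; cts => // t; rewrite pcat1. Qed.

(** In [pad c] the path c is run on [1/4,1/2], where 4 s - 1 goes from 0 to 1. *)
Definition pad_rep (s : R) : R := Num.max 0 (Num.min 1 (4 * s - 1)).

Lemma pad_rep_continuous : continuous pad_rep.
Proof.
apply: (@max_fun_continuous _ R R); first by apply: (@affine_continuous R 0 0) => s; ring.
apply: (@min_fun_continuous _ R R).
  by apply: (@affine_continuous R 0 1) => s; ring.
by apply: (@affine_continuous R 4 (- 1)) => s; ring.
Qed.

Lemma pad_rep_id0 : pad_rep 0 = 0.
Proof. by rewrite /pad_rep max_l // ge_min; apply/orP; right; lra. Qed.

Lemma pad_rep_id1 : pad_rep 1 = 1.
Proof. by rewrite /pad_rep min_l ?max_r; lra. Qed.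

Definition slide_p (c : PX) : vpath R E :=
  slide pad_rep_continuous (@id_continuous R) pad_rep_id0 pad_rep_id1 c.

Lemma slide_p0 (c : PX) : slide_p c i0 = pad c.
Proof.
apply: path_ext; apply: clamp_ival => x x0 x1; rewrite slide0 clamp_ivalE // /pad.
have [x2|/ltW x2] := leP x 2^-1; last first.
  rewrite pcat_hi ?pad_eq // /pad_rep min_l ?max_r //; lra.
rewrite pcat_lo ?pad_eq //.
have [x4|/ltW x4] := leP x 4^-1.
  rewrite pcat_lo //; [|lra..].
  by rewrite /pad_rep max_l // ge_min; apply/orP; right; lra.
rewrite pcat_hi //; [|lra..].
by rewrite /pad_rep min_r ?max_r; [congr (c (clamp _))|..]; lra.
Qed.

Lemma slide_p1 (c : PX) : slide_p c i1 = c.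
Proof. by apply: path_ext => s; rewrite slide1 ivalK. Qed.

Lemma natural_p (f F : vpath R E) : (forall s, F s = pad (f s)) ->
  comp_class (cls (slide_p (f i1))) (cls F) = comp_class (cls f) (cls (slide_p (f i0))).
Proof.
move=> Ff; apply: (@slide_natural R X _ _ _ _ _ _ (fun s => f s)); first by cts.
- by move=> s; rewrite Ff -slide_p0.
- by move=> s; rewrite [RHS]slide_p1.
Qed.

(** The slides [slide_p] conjugate F to f and G to g. As f and g share their ends, the conjugating
    arrows are the same and cancel. *)
Lemma pad_faithful (f g F G : vpath R E) :
  (forall s, F s = pad (f s)) -> (forall s, G s = pad (g s)) ->
  f i0 = g i0 -> f i1 = g i1 -> cls F = cls G -> cls f = cls g.
Proof.
move=> Ff Gg fg0 fg1 FG; apply: (@comp_cancel_r _ _ _ _ (cls (slide_p (f i0)))).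
- by rewrite vsrcE vtgtE slide_p1.
- by rewrite !vsrcE.
- by rewrite -(natural_p Ff) FG fg1 (natural_p Gg) fg0.
Qed.

End Fillers.

(** * Local structure of the path space *)

Section LocalStructure.
Variables (R : realType) (X : topologicalType).
Local Notation I := (unitI R).
Local Notation i0 := (i0 R).
Local Notation i1 := (i1 R).
Local Notation PX := (pathspace R X).
Local Notation E := (@ends R X).
Local Notation ihalf := (ihalf R).

(* The four-phase time change underlying paste1 (paste1 _ _) (paste1 _ _): a path
   of X run during the second phase only. *)
Definition rho (t : I) : I :=
  if ival t <= 2^-1 then (if ival (lft t) <= 2^-1 then i0 else rgt (lft t)) else i1.

(** Since [rho] depends on no data, lifts over the two halves of a path, or lifts of several paths
    with common endpoints, keep meeting at every time. *)
Definition lifts_paths (c : PX) (V : set PX) (A0 A1 : set X) : Prop :=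
  forall c' g d : PX, V c' -> (forall u, A0 (g u)) -> (forall u, A1 (d u)) ->
    g i0 = c i0 -> g i1 = c' i0 -> d i0 = c i1 -> d i1 = c' i1 ->
  exists P : pathspace R PX, [/\ P i0 = c, P i1 = c', forall t, V (P t)
    & forall t, P t i0 = g (rho t) /\ P t i1 = d (rho t)].

Definition contracts (A : set X) (f : I -> X) (K : I * I -> X) : Prop :=
  [/\ continuous K, forall z, A (K z), forall t, K (i0, t) = f t,
      forall t, K (i1, t) = f i0 & forall r, K (r, i0) = f i0 /\ K (r, i1) = f i0].

(** The base object may move, since padding moves it; only the two sides of K have to coincide, and
    [loops_null_cls] cancels them. K itself may leave V, because spheres in a basic set are null
    only in X. *)
Definition contracts_loops (V : set PX) (A0 A1 : set X) : Prop :=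
  forall (l : pathspace R PX) K0 K1, (forall t, V (l t)) -> l i0 = l i1 ->
    contracts A0 (fun t => l t i0) K0 -> contracts A1 (fun t => l t i1) K1 ->
  exists K : I * I -> PX, [/\ continuous K, forall t, K (i0, t) = l t,
    forall t, K (i1, t) = l i0, forall r, K (r, i0) = K (r, i1)
    & forall r t, K (r, t) i0 = K0 (rho r, t) /\ K (r, t) i1 = K1 (rho r, t)].

Lemma slide_p_continuous (T : topologicalType) (c : T -> PX) (t : T -> I) :
  continuous c -> continuous t -> continuous (fun z => slide_p (c z) (t z)).
Proof. by move=> cc ct; exact: (@slide_continuous R X T _ _ _ _ _ _ c t cc ct). Qed.

Lemma slide_p_ends (c : PX) t : slide_p c t i0 = c i0 /\ slide_p c t i1 = c i1.
Proof.
by rewrite (vpath_ends _ t).1 (vpath_ends _ t).2 slide_p0 pad_i0 pad_i1.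
Qed.

(** Four phases: c is padded; its ends are pushed along g and d, which yields d (c g^-1); this is
    deformed to c' with fixed ends by simple connectedness of U; finally the path rests at c'. The
    endpoints move only in the second phase, as [rho] prescribes. *)
Lemma lifts_paths_within (U : set X) (c : PX) : simply_connected R U ->
  (forall u, U (c u)) -> lifts_paths c [set d | forall u, U (d u)] U U.
Proof.
move=> sU cU c' g d c'U gU dU g0 g1 d0 d1.
have cg : c i0 = prev g i1 by rewrite prev_eq1.
have dcg : d i0 = pcat c (prev g) i1 by rewrite pcat1.
pose w := pcat d (pcat c (prev g)).
have wU u : U (w u) by apply: pcat_ind => v //; apply: pcat_ind => // x; rewrite prevE.
have w0 : w i0 = c' i0 by rewrite !pcat0 // prevE flip0.
have w1 : w i1 = c' i1 by rewrite pcat1.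
have [P3 [P3_0 P3_1 P3U P3e]] := simply_connected_paths sU wU c'U w0 w1.
have segc t : c i0 = seg g t i0 i1 by rewrite segE lerp1.
have segd t : seg d i0 t i0 = pcat c (seg g t i0) i1 by rewrite pcat1 // segE lerp0.
have cP1 : continuous (fun t => slide_p c (flip t)).
  by apply: (@slide_p_continuous _ (fun=> c)); cts.
pose P1 : pathspace R PX := mkpath cP1.
have cP2 : continuous (fun t => pcat (seg d i0 t) (pcat c (seg g t i0))) by cts.
pose P2 : pathspace R PX := mkpath cP2.
pose P4 : pathspace R PX := pcst R c'.
have P1E t : P1 t = slide_p c (flip t) by [].
have P2E t : P2 t = pcat (seg d i0 t) (pcat c (seg g t i0)) by [].
have e21 : P2 i0 = P1 i1 by rewrite P1E P2E flip1 slide_p0 !seg_xx g0 d0.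
have e43 : P4 i0 = P3 i1 by rewrite P3_1.
have segd1 : seg d i0 i1 = d by apply: path_ext => s; rewrite segE lerp_i0i1.
have segg1 : seg g i1 i0 = prev g.
  by apply: path_ext => s; rewrite segE prevE -{1}(lerp_i0i1 (flip s)) lerp_flip.
have e32 : pcat P4 P3 i0 = pcat P2 P1 i1.
  by rewrite pcat0 // pcat1 // P3_0 P2E segd1 segg1.
exists (pcat (pcat P4 P3) (pcat P2 P1)); split.
- by rewrite (pcat0 e32) (pcat0 e21) P1E flip0 slide_p1.
- by rewrite (pcat1 e32) (pcat1 e43).
- apply: (@pcat_ind _ PX (fun e => forall u, U (e u))).
    by apply: (@pcat_ind _ PX (fun e => forall u, U (e u))) => t u //; exact: P3U.
  apply: (@pcat_ind _ PX (fun e => forall u, U (e u))) => t u.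
    rewrite P2E; apply: pcat_ind => v; first by rewrite segE.
    by apply: pcat_ind => x //; rewrite segE.
  by rewrite P1E slideE.
- move=> t; rewrite (pcatE _ e32) /cat_fun /rho; case: ifP => _.
    rewrite (pcatE _ e21) /cat_fun; case: ifP => _.
      by rewrite P1E g0 d0; exact: slide_p_ends.
    by rewrite P2E pcat0 // pcat0 // pcat1 // !segE lerp0 lerp1.
  rewrite (pcatE _ e43) /cat_fun; case: ifP => _; first by rewrite !(P3e _).1 !(P3e _).2 w0 w1.
  by rewrite g1 d1.
Qed.

(** Four phases: the loop is padded; its ends are pushed along K0 and K1 until they are constant;
    the resulting vertical loop in U is null by [null_loop]; the padding is removed. *)
Lemma contracts_loops_within (U : set X) : zero_on_pi R (@boundary2 R) U setT ->
  contracts_loops [set d | forall u, U (d u)] U U.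
Proof.
move=> zU l K0 K1 lU l01 [cK0 K0U K00 K01 K0e] [cK1 K1U K10 K11 K1e].
have cq0 : continuous (fun z : I * I => K0 (z.2, z.1)) by cts.
have cq1 : continuous (fun z : I * I => K1 (z.2, z.1)) by cts.
pose q0 := curry_path cq0; pose q1 := curry_path cq1.
have cq0' : continuous q0 by exact: curry_path_continuous.
have cq1' : continuous q1 by exact: curry_path_continuous.
have q0E t r : q0 t r = K0 (r, t) by [].
have q1E t r : q1 t r = K1 (r, t) by [].
pose c := l i0; pose c2 := pad c.
pose P1 (z : I * I) : PX := slide_p (l z.2) (flip z.1).
have lq r t : l t i0 = seg (q0 t) r i0 i1 by rewrite segE lerp1 q0E K00.
have ql r t : seg (q1 t) i0 r i0 = pcat (l t) (seg (q0 t) r i0) i1.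
  by rewrite pcat1 // segE lerp0 q1E K10.
pose P2 (z : I * I) : PX := pcat (seg (q1 z.2) i0 z.1) (pcat (l z.2) (seg (q0 z.2) z.1 i0)).
have cP1 : continuous P1.
  by apply: (@slide_p_continuous _ (fun z => l z.2) (fun z => flip z.1)); cts.
have cP2 : continuous P2 by rewrite /P2; cts => z.
have P2e r t : P2 (r, t) i0 = K0 (r, t) /\ P2 (r, t) i1 = K1 (r, t).
  by rewrite /P2 pcat0 // pcat0 // pcat1 // !segE lerp0 lerp1.
have q0b : (forall s, q0 i0 s = c i0) /\ (forall s, q0 i1 s = c i0).
  by split=> s; rewrite q0E; have [] := K0e s.
have q1b : (forall s, q1 i0 s = c i1) /\ (forall s, q1 i1 s = c i1).
  by split=> s; rewrite q1E; have [] := K1e s.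
have P2b r : P2 (r, i0) = c2 /\ P2 (r, i1) = c2.
  have s0 t : (forall s, q0 t s = c i0) -> seg (q0 t) r i0 = pcst R (c i0).
    by move=> H; apply: path_ext => s; rewrite segE H.
  have s1 t : (forall s, q1 t s = c i1) -> seg (q1 t) i0 r = pcst R (c i1).
    by move=> H; apply: path_ext => s; rewrite segE H.
  have [a0 a1] := q0b; have [b0 b1] := q1b.
  by rewrite /P2 /= !s0 // !s1 // -l01.
have c1 : continuous (fun t => P2 (i1, t)) by cts.
have vl : vertical E (mkpath c1).
  move=> s t; rewrite /ends /=.
  have [-> ->] := P2e i1 s; have [-> ->] := P2e i1 t.
  by rewrite !K01 !K11.
pose w := mkvpath vl.
have wE t : w t = P2 (i1, t) by [].
have P2U r t u : U (P2 (r, t) u).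
  rewrite /P2; apply: pcat_ind => v; first by rewrite segE q1E.
  by apply: pcat_ind => x; [exact: lU|rewrite segE q0E].
have w0 : w i0 = c2 by rewrite wE (P2b i1).1.
have w1 : w i1 = c2 by rewrite wE (P2b i1).2.
have : cls w = idn_class R E c2.
  by apply: null_loop zU _ w0 w1 => s u; rewrite wE.
move=> /clsP [P3 [cP3 P30 P31 P3v P3e]].
pose P4 (z : I * I) : PX := slide_p c z.1.
have cP4 : continuous P4 by apply: (@slide_p_continuous _ (fun=> c) fst); cts.
have c12 : continuous (paste1 P1 P2).
  apply: paste1_continuous => // t; rewrite /P1 /P2 /= flip1 slide_p0 !seg_xx.
  by rewrite q0E q1E K00 K10.
have c34 : continuous (paste1 P3 P4).
  by apply: paste1_continuous => // t; rewrite P31 /P4 /= slide_p0.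
exists (paste1 (paste1 P1 P2) (paste1 P3 P4)); split.
- by apply: paste1_continuous => // t; rewrite paste1_1 paste1_0 P30.
- by move=> t; rewrite !paste1_0 /P1 /= flip0 slide_p1.
- by move=> t; rewrite !paste1_1 /P4 /= slide_p1.
- move=> r; rewrite /paste1 /=; case: ifP => _.
    case: ifP => _; first by rewrite /P1 /= l01.
    by rewrite (P2b _).1 (P2b _).2.
  case: ifP => _; last by [].
  by have [-> ->] := P3e (lft (rgt r)); rewrite w0 w1.
- move=> r t; rewrite /paste1 /rho /=; case: ifP => _.
    case: ifP => _; last exact: P2e.
    by rewrite K00 K10; exact: slide_p_ends.
  rewrite K01 K11 -/c; case: ifP => _; last exact: slide_p_ends.
  have := P3v (lft (rgt r)) t i0; rewrite /ends.
  by have [-> _] := P3e (lft (rgt r)); rewrite w0 pad_i0 pad_i1 => -[-> ->].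
Qed.

End LocalStructure.

(** * Neighbourhoods of a path given by dyadic chains of basic sets *)

Section FineNeighbourhoods.
Variables (R : realType) (X : topologicalType) (BX : open_basis X).
Hypothesis BXP : forall U, BX U -> one_connected R U /\ zero_on_pi R (@boundary2 R) U setT.
Local Notation I := (unitI R).
Local Notation i0 := (i0 R).
Local Notation i1 := (i1 R).
Local Notation PX := (pathspace R X).
Local Notation E := (@ends R X).
Local Notation ihalf := (ihalf R).

Definition half1 (c : PX) : PX := seg c i0 ihalf.
Definition half2 (c : PX) : PX := seg c ihalf i1.

(** The sets A0 and A1 control the two ends. At a cut, M is a basic set inside both adjacent end
    sets, so paths and contractions of the midpoint chosen in M are admissible for either half. *)
Inductive fine : PX -> set PX -> set X -> set X -> Prop :=
| fine_within (c : PX) (U : set X) : BX U -> (forall u, U (c u)) ->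
    fine c [set d | forall u, U (d u)] U U
| fine_split (c : PX) V1 V2 A0 A1 A1' A2 (M : set X) :
    fine (half1 c) V1 A0 A1 -> fine (half2 c) V2 A1' A2 ->
    BX M -> M (c ihalf) -> M `<=` A1 -> M `<=` A1' ->
    fine c [set d | [/\ V1 (half1 d), V2 (half2 d) & M (d ihalf)]] A0 A2.

Lemma half1_0 c : half1 c i0 = c i0. Proof. by rewrite segE lerp0. Qed.
Lemma half1_1 c : half1 c i1 = c ihalf. Proof. by rewrite segE lerp1. Qed.
Lemma half2_0 c : half2 c i0 = c ihalf. Proof. by rewrite segE lerp0. Qed.
Lemma half2_1 c : half2 c i1 = c i1. Proof. by rewrite segE lerp1. Qed.

Lemma fine_start c V A0 A1 : fine c V A0 A1 -> BX A0 /\ A0 (c i0).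
Proof.
by elim=> {c V A0 A1} [c U BU cU|c V1 V2 A0 A1 A1' A2 M _ [] BA Ac _ _ _ _ _ _] //;
  split=> //; rewrite -half1_0.
Qed.

Lemma fine_stop c V A0 A1 : fine c V A0 A1 -> BX A1 /\ A1 (c i1).
Proof.
by elim=> {c V A0 A1} [c U BU cU|c V1 V2 A0 A1 A1' A2 M _ _ _ [] BA Ac _ _ _ _] //;
  split=> //; rewrite -half2_1.
Qed.

Lemma within_open (U : set X) : open U -> open [set d : PX | forall u, U (d u)].
Proof.
move=> oU; have := @compact_open_open I X setT U (@unitI_compact R) oU => oS.
exists [set g : {compact-open, I -> X} | g @` setT `<=` U]; first exact: oS.
apply/seteqP; split=> [d /= dU u|d /= dU _ [u _ <-]]; last exact: dU.
by apply: dU; exists u.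
Qed.

Lemma fine_nbhs c V A0 A1 : fine c V A0 A1 -> nbhs c V.
Proof.
elim=> {c V A0 A1} [c U BU cU|c V1 V2 A0 A1 A1' A2 M _ n1 _ n2 BM Mc _ _].
  by apply: open_nbhs_nbhs; split => //; apply: within_open; exact: (basis_setsP BX).1.
have ch1 : continuous half1 by apply: (@seg_continuous R PX X id); cts.
have ch2 : continuous half2 by apply: (@seg_continuous R PX X id); cts.
have chm : continuous (fun d : PX => d ihalf) by cts.
have nM : nbhs (c ihalf) M by exact: open_basis_open_nbhs BM Mc.
near=> d; split; near: d; [exact: ch1 n1|exact: ch2 n2|exact: chm nM].
Unshelve. all: by end_near. Qed.

(** At a cut, a path m in M joins the two midpoints. Both halves are lifted over m through the same
    [rho], so they can be concatenated at each time. *)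
Lemma fine_lifts c V A0 A1 : fine c V A0 A1 -> lifts_paths c V A0 A1.
Proof.
elim=> {c V A0 A1} [c U BU cU|c V1 V2 A0 A1 A1' A2 M _ IH1 _ IH2 BM Mc MA MA'].
  by apply: lifts_paths_within => //; exact: (BXP BU).1.2.
move=> c' g d [V1c V2c Mc'] gA dA g0 g1 d0 d1.
have [m' [cm mM m0 m1]] := (BXP BM).1.1 _ _ Mc Mc'.
pose m : PX := mkpath cm.
have [|||||P1 [P10 P11 P1V P1e]] := IH1 (half1 c') g m V1c gA.
- by move=> u; exact/MA/mM.
- by rewrite half1_0.
- by rewrite half1_0.
- by rewrite half1_1.
- by rewrite half1_1.
have [|||||P2 [P20 P21 P2V P2e]] := IH2 (half2 c') m d V2c _ dA.
- by move=> u; exact/MA'/mM.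
- by rewrite half2_0.
- by rewrite half2_0.
- by rewrite half2_1.
- by rewrite half2_1.
have e21 t : P2 t i0 = P1 t i1 by rewrite (P1e t).2 (P2e t).1.
have cP : continuous (fun t => pcat (P2 t) (P1 t)) by cts.
have PE t : mkpath cP t = pcat (P2 t) (P1 t) by [].
exists (mkpath cP); split.
- by rewrite PE P10 P20; exact: pcat_seg.
- by rewrite PE P11 P21; exact: pcat_seg.
- move=> t; rewrite PE /=.
  have h1 : half1 (pcat (P2 t) (P1 t)) = P1 t by exact: seg_half1.
  have h2 : half2 (pcat (P2 t) (P1 t)) = P2 t by exact: seg_half2.
  by split; rewrite ?h1 ?h2 // -half1_1 h1 (P1e t).2; exact: mM.
- move=> t; split; first by rewrite [LHS](pcat0 (e21 t)); exact: (P1e t).1.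
  by rewrite [LHS](pcat1 (e21 t)); exact: (P2e t).2.
Qed.

Lemma contracts_eq (A A' : set X) (f f' : I -> X) K : A `<=` A' ->
  (forall t, f t = f' t) -> contracts A f K -> contracts A' f' K.
Proof.
move=> AA /funext <- [cK KA K0 K1 Ke]; split=> // z; exact: AA.
Qed.

Lemma simply_connected_contracts (A : set X) (f : I -> X) : simply_connected R A ->
  continuous f -> (forall t, A (f t)) -> f i0 = f i1 -> exists K, contracts A f K.
Proof.
move=> sA cf fA f01; have [|h [ch hA h0 h1 hb]] := sA (f i0) f (fA i0) cf fA.
  by move=> z [->|->].
by exists h; split => // r; rewrite !hb //; [right|left].
Qed.

(** At a cut, the loop of midpoints contracts in M because M is simply connected; the contractions
    of both halves are taken over that single contraction. *)
Lemma fine_contracts c V A0 A1 : fine c V A0 A1 -> contracts_loops V A0 A1.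
Proof.
elim=> {c V A0 A1} [c U BU cU|c V1 V2 A0 A1 A1' A2 M _ IH1 _ IH2 BM Mc MA MA'].
  by apply: contracts_loops_within; exact: (BXP BU).2.
move=> l K0 K1 lV l01 cK0 cK1.
have cl1 : continuous (fun t => half1 (l t)) by rewrite /half1; cts.
have cl2 : continuous (fun t => half2 (l t)) by rewrite /half2; cts.
pose l1 : pathspace R PX := mkpath cl1; pose l2 : pathspace R PX := mkpath cl2.
have [|||Km cKm] := @simply_connected_contracts M (fun t => l t ihalf) (BXP BM).1.2.
- by cts.
- by move=> t; have [] := lV t.
- by rewrite l01.
have [||||L1 [cL1 L10 L11 L1e L1h]] := IH1 l1 K0 Km.
- by move=> t; have [] := lV t.
- exact: (congr1 half1 l01).
- by apply: contracts_eq cK0 => // t; rewrite [RHS]half1_0.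
- by apply: contracts_eq cKm => // t; rewrite [RHS]half1_1.
have [||||L2 [cL2 L20 L21 L2e L2h]] := IH2 l2 Km K1.
- by move=> t; have [] := lV t.
- exact: (congr1 half2 l01).
- by apply: contracts_eq cKm => // t; rewrite [RHS]half2_0.
- by apply: contracts_eq cK1 => // t; rewrite [RHS]half2_1.
have e21 z : L2 z i0 = L1 z i1.
  by case: z => r t; rewrite (L1h r t).2 (L2h r t).1.
exists (fun z => pcat (L2 z) (L1 z)); split.
- by cts.
- by move=> t; rewrite L10 L20; exact: pcat_seg.
- by move=> t; rewrite L11 L21; exact: pcat_seg.
- by move=> r; rewrite L1e L2e.
- by move=> r t; rewrite pcat0 // pcat1 // (L1h r t).1 (L2h r t).2.
Qed.

Lemma unitI_hausdorff : hausdorff_space I.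
Proof.
move=> x y xy; apply: ival_inj; apply: (@norm_hausdorff _ R) => A B nA nB.
have [|z [Az Bz]] := xy (@ival R @^-1` A) (@ival R @^-1` B) (@ival_continuous R x _ nA).
  exact: (@ival_continuous R y).
by exists (ival z).
Qed.

(** Sets with such pointwise control form a filter, so it suffices to treat the subbasic condition K
    into O: use O with J s = I for s in K, and no condition with J s the complement of K otherwise.
    A point u of K is then covered only by some s in K. *)
Lemma nbhs_path_cover (c : PX) (V : set PX) : nbhs c V ->
  exists (N : I -> set X) (J : I -> set I), [/\ forall s, nbhs (c s) (N s),
    forall s, nbhs s (J s) &
    forall d : PX, (forall u, exists s, J s u /\ N s (d u)) -> V d].
Proof.
move=> [_ [[W oW <-] /= Wc WV]].
pose F : set_system {compact-open, I -> X} := [set W | exists (N : I -> set X) (J : I -> set I),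
    [/\ forall s, nbhs (c s) (N s), forall s, nbhs s (J s) &
    forall d : I -> X, (forall u, exists s, J s u /\ N s (d u)) -> W d]].
have FF : Filter F.
  split.
  - by exists (fun=> setT), (fun=> setT); split => // s; exact: filterT.
  - move=> P Q [N [J [nN nJ NJ]]] [N' [J' [nN' nJ' NJ']]].
    exists (fun s => N s `&` N' s), (fun s => J s `&` J' s); split => [s|s|d dNJ].
    + exact: filterI.
    + exact: filterI.
    + by split; [apply: NJ|apply: NJ'] => u; have [s [[? ?] [? ?]]] := dNJ u; exists s.
  - move=> P Q PQ [N [J [nN nJ NJ]]]; exists N, J; split => // d /NJ; exact: PQ.
have Fc : F --> (c : {compact-open, I -> X}).
  apply/compact_open_cvgP => K O cK oO cKO.
  have clK : closed K.
    by apply: compact_closed => //; exact: unitI_hausdorff.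
  exists (fun s => if s \in K then O else setT), (fun s => if s \in K then setT else ~` K).
  split=> [s|s|d dNJ].
  - case: ifPn => [/set_mem Ks|_]; last exact: filterT.
    by apply: open_nbhs_nbhs; split => //; apply: cKO; exists s.
  - case: ifPn => [_|/negP nKs]; first exact: filterT.
    by apply: open_nbhs_nbhs; split; [exact: closed_openC|move=> Ks; apply: nKs; exact/mem_set].
  - move=> _ [u Ku <-]; have [s []] := dNJ u.
    by case: ifPn.
have [|N [J [nN nJ NJ]]] := Fc W; first exact: open_nbhs_nbhs.
by exists N, J; split => // d /NJ; exact: WV.
Qed.

End FineNeighbourhoods.

(** * Subdivision of a path by compactness of I *)

Section Subdivision.
Variables (R : realType) (X : topologicalType) (BX : open_basis X).
Local Notation I := (unitI R).
Local Notation i0 := (i0 R).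
Local Notation i1 := (i1 R).
Local Notation PX := (pathspace R X).
Local Notation ihalf := (ihalf R).

Lemma nbhs_unitI (x : I) (A : set I) : nbhs x A ->
  exists2 e : R, 0 < e & forall y, `|ival y - ival x| < e -> A y.
Proof.
move=> [_ [[W oW <-] /= Wx WA]].
have /nbhs_ballP [e /= e0 eW] : nbhs (ival x) W by exact: open_nbhs_nbhs.
exists e => // y yx; apply: WA; apply: eW.
by rewrite /ball /= distrC.
Qed.

(** By near-covering compactness a local bound suffices: if J x contains the e-ball at x, then s = x
    serves every point within e/2 of x and every n with 1/(n+1) < e/2. *)
Lemma lebesgue_number (J : I -> set I) : (forall s, nbhs s (J s)) ->
  exists n : nat, forall x, exists s, forall y,
    `|ival y - ival x| <= n.+1%:R^-1 -> J s y.
Proof.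
move=> nJ.
have /compact_near_coveringP cI := @unitI_compact R.
pose P (n : nat) (x : I) := exists s, forall y, `|ival y - ival x| <= n.+1%:R^-1 -> J s y.
have [|n _ nP] := cI nat \oo P _; last first.
  by exists n => x; exact: (nP n (leqnn n)).
move=> x _; have [e e0 eJ] := nbhs_unitI (nJ x).
have e20 : 0 < e / 2 by rewrite divr_gt0.
exists ([set x' | `|ival x' - ival x| < e / 2], [set n : nat | n.+1%:R^-1 < e / 2]).
  split => /=; last exact: (near_infty_natSinv_lt (PosNum e20)).
  have := @ival_continuous R x; move=> /cvgrPdist_lt /(_ _ e20).
  by apply: filterS => y; rewrite distrC.
move=> [x' n] [/= xx' ne]; exists x => y yx'; apply: eJ.
rewrite (_ : _ - _ = (ival y - ival x') + (ival x' - ival x)); last by ring.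
rewrite (le_lt_trans (ler_normD _ _)) // [e]splitr.
by apply: ler_ltD xx'; exact: le_trans yx' (ltW ne).
Qed.

Lemma half1_seg (c : PX) a b : half1 (seg c a b) = seg c a (lerp ihalf a b).
Proof.
apply: path_ext => s; rewrite !segE; congr (c _); apply: ival_inj.
by rewrite !ival_lerp ival0 ival_half; field.
Qed.

Lemma half2_seg (c : PX) a b : half2 (seg c a b) = seg c (lerp ihalf a b) b.
Proof.
apply: path_ext => s; rewrite !segE; congr (c _); apply: ival_inj.
by rewrite !ival_lerp ival1 ival_half; field.
Qed.

(** Bisecting m times brings the length below 1/(n+1), where a single set N s contains the piece.
    The pointwise control of d is carried through the affine parametrisation of each half. *)
Lemma fine_seg (c : PX) (N : I -> set X) (J : I -> set I) (n : nat) :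
  (forall s, BX (N s)) -> (forall s u, J s u -> N s (c u)) ->
  (forall x, exists s, forall y, `|ival y - ival x| <= n.+1%:R^-1 -> J s y) ->
  forall m a b, ival a <= ival b -> ival b - ival a <= n.+1%:R^-1 * 2 ^+ m ->
  exists V A0 A1, fine BX (seg c a b) V A0 A1 /\
    forall d : PX, V d -> forall u, exists s, J s (lerp u a b) /\ N s (d u).
Proof.
move=> BN JN Jn; elim=> [|m IHm] a b ab mab.
  have [s sJ] := Jn a.
  have sJ' u : J s (lerp u a b).
    apply: sJ; have /andP[u0 u1] := ivalP u; rewrite ival_lerp.
    rewrite (_ : _ - _ = ival u * (ival b - ival a)); last by ring.
    rewrite ger0_norm; last by rewrite mulr_ge0 // subr_ge0.
    rewrite expr0 mulr1 in mab; apply: le_trans mab.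
    by rewrite ler_piMl // subr_ge0.
  exists [set d : PX | forall u, N s (d u)], (N s), (N s); split.
    by apply: fine_within => // u; exact: JN (sJ' u).
  by move=> d dN u; exists s.
pose mid := lerp ihalf a b.
have imid : ival mid = (ival a + ival b) / 2.
  by rewrite ival_lerp ival_half; field.
have mab' : (ival b - ival a) / 2 <= n.+1%:R^-1 * 2 ^+ m.
  by rewrite ler_pdivrMr // -mulrA -exprSr.
have l1 : ival mid - ival a = (ival b - ival a) / 2 by rewrite imid; field.
have l2 : ival b - ival mid = (ival b - ival a) / 2 by rewrite imid; field.
have [||V1 [A0 [A1 [f1 J1]]]] := IHm a mid; [by rewrite imid; lra|by rewrite l1|].
have [||V2 [A1' [A2 [f2 J2]]]] := IHm mid b; [by rewrite imid; lra|by rewrite l2|].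
have [BA1] := fine_stop f1; rewrite segE lerp1 => A1c.
have [BA1'] := fine_start f2; rewrite segE lerp0 => A1'c.
have [M [BM Mc MA MA']] := open_basis_refine BA1 A1c BA1' A1'c.
exists [set d : PX | [/\ V1 (half1 d), V2 (half2 d) & M (d ihalf)]], A0, A2; split.
  by apply: fine_split MA MA' => //; rewrite ?half1_seg ?half2_seg.
move=> d [V1d V2d _] u; have /andP[u0 u1] := ivalP u.
have [uh|/ltW uh] := leP (ival u) 2^-1.
  have e : u = lerp (lft u) i0 ihalf.
    apply: ival_inj; rewrite ival_lerp ival0 ival_half /lft clampE; first by field.
    by apply/andP; split; lra.
  have [s [Js Ns]] := J1 _ V1d (lft u); exists s; split.
    suff -> : lerp u a b = lerp (lft u) a mid by [].
    by apply: ival_inj; rewrite [in LHS]e !ival_lerp ival0 ival_half; field.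
  by rewrite [in d _]e.
have e : u = lerp (rgt u) ihalf i1.
  by apply: ival_inj; rewrite ival_lerp ival1 ival_half /rgt clampE; [field|apply/andP; split; lra].
have [s [Js Ns]] := J2 _ V2d (rgt u); exists s; split.
  suff -> : lerp u a b = lerp (rgt u) mid b by [].
  by apply: ival_inj; rewrite [in LHS]e !ival_lerp ival1 ival_half; field.
by rewrite [in d _]e.
Qed.

Lemma fine_exists (c : PX) (V : set PX) : nbhs c V ->
  exists V' A0 A1, fine BX c V' A0 A1 /\ V' `<=` V.
Proof.
move=> /nbhs_path_cover [N [J [nN nJ NJ]]].
(* N s is shrunk to a basic set and J s to times that c sends into it, so that the pieces of c
   themselves lie in basic sets. *)
have /choice [N' N'P] : forall s, exists N' : set X, [/\ BX N', N' (c s) & N' `<=` N s].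
  by move=> s; exact: open_basis_nbhs.
pose J' s := J s `&` (c @^-1` N' s).
have nJ' s : nbhs s (J' s).
  apply: filterI => //; apply: (@path_continuous R X c s).
  by have [BN Nc _] := N'P s; exact: open_basis_open_nbhs BN Nc.
have [n nP] := lebesgue_number nJ'.
(* Here n+1 bisections are enough, since n+1 <= 2^(n+1). *)
have [||||V' [A0 [A1 [fV V'J]]]] := @fine_seg c N' J' n _ _ nP n.+1 i0 i1.
- by move=> s; have [] := N'P s.
- by move=> s u [].
- by rewrite ival0 ival1 ler01.
- rewrite ival0 ival1 subr0 mulrC ler_pdivlMr ?ltr0n // mul1r -natrX ler_nat.
  by rewrite ltnW // ltn_expl.
exists V', A0, A1; split.
  by have -> : c = seg c i0 i1 by apply: path_ext => s; rewrite segE lerp_i0i1.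
move=> d V'd; apply: NJ => u; have [s [[Js _] N's]] := V'J _ V'd u.
rewrite lerp_i0i1 in Js; exists s; split => //.
by have [_ _] := N'P s; exact.
Qed.

End Subdivision.

(** * Rigidity and fillers *)

Section Rigidity.
Variables (R : realType) (X : topologicalType).
Local Notation I := (unitI R).
Local Notation i0 := (i0 R).
Local Notation i1 := (i1 R).
Local Notation PX := (pathspace R X).
Local Notation E := (@ends R X).
Local Notation ihalf := (ihalf R).

Definition ends_in (A0 A1 : set X) (c : PX) : Prop := A0 (c i0) /\ A1 (c i1).

Definition loops_null (V : set PX) (A0 A1 : set X) : Prop :=
  forall l : pathspace R PX, (forall t, V (l t)) -> (forall t, ends_in A0 A1 (l t)) ->
    l i0 = l i1 ->
  exists K : I * I -> PX, [/\ continuous K, forall t, K (i0, t) = l t,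
    forall t, K (i1, t) = l i0, forall r, K (r, i0) = K (r, i1)
    & forall z, ends_in A0 A1 (K z)].

Lemma ends_in_eq (A0 A1 : set X) (c d : PX) :
  ends_in A0 A1 c -> ends_in A0 A1 d -> ends_in A0 A1 c = ends_in A0 A1 d.
Proof. by move=> hc hd; apply/propext; split. Qed.

(** Both sides of the contraction K are the same path k, so its boundary reads k l = k in the
    groupoid of paths with ends in A0 and A1, and k cancels. *)
Lemma loops_null_cls (V : set PX) (A0 A1 : set X) (l : vpath R (ends_in A0 A1)) :
  loops_null V A0 A1 -> (forall t, V (l t)) -> (forall t, ends_in A0 A1 (l t)) ->
  l i0 = l i1 -> cls l = idn_class R (ends_in A0 A1) (l i0).
Proof.
move=> nV lV lA l01; have [K [cK K0 K1 Ke KA]] := nV l lV lA l01.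
have ck : continuous (fun r => K (r, i0)) by cts.
have vk : vertical (ends_in A0 A1) (mkpath ck).
  by move=> s t; exact: (ends_in_eq (KA (s, i0)) (KA (t, i0))).
pose k := mkvpath vk.
apply: (@comp_cancel_l _ _ _ _ (cls k)).
- by rewrite vsrcE vtgtE -l01; exact: K0.
- by rewrite vtgt_idn vtgtE.
have -> : comp_class (cls k) (idn_class R (ends_in A0 A1) (l i0)) = cls k.
  have -> : l i0 = vsrc (cls k) by rewrite vsrcE; exact/esym/K0.
  exact: comp_idr.
rewrite -[RHS]comp_idl vtgtE.
apply: (@square_class _ _ _ _ K) => //.
- by move=> z w; exact: ends_in_eq.
- by move=> s; rewrite K1; exact: K1.
Qed.

(* A homotopy whose side loops lie in V0 and V1 can be made relative to the
   endpoints, after which the spheres swept out by the endpoints of the paths are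
   null in X and are absorbed by padding. *)
Lemma rigid (V0 V1 : set PX) (A0 A1 : set X) (f g : vpath R E) (G : I * I -> PX) :
  loops_null V0 A0 A1 -> loops_null V1 A0 A1 ->
  zero_on_pi R (@boundary2 R) A0 setT -> zero_on_pi R (@boundary2 R) A1 setT ->
  continuous G -> (forall s, G (i0, s) = f s) -> (forall s, G (i1, s) = g s) ->
  f i0 = g i0 -> f i1 = g i1 -> (forall t, V0 (G (t, i0))) -> (forall t, V1 (G (t, i1))) ->
  (forall z, ends_in A0 A1 (G z)) -> cls f = cls g.
Proof.
move=> n0 n1 z0 z1 cG G0 G1 fg0 fg1 GV0 GV1 GA.
have vG (P : pathspace R PX) : (forall s, ends_in A0 A1 (P s)) -> vertical (ends_in A0 A1) P.
  by move=> PA s t; exact: ends_in_eq.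
have cl0 : continuous (fun t => G (t, i0)) by cts.
have cl1 : continuous (fun t => G (t, i1)) by cts.
have fA s : ends_in A0 A1 (f s) by rewrite -G0.
have gA s : ends_in A0 A1 (g s) by rewrite -G1.
pose f' := mkvpath (vG f fA); pose g' := mkvpath (vG g gA).
pose l0 := mkvpath (vG (mkpath cl0) (fun s => GA (s, i0))).
pose l1 := mkvpath (vG (mkpath cl1) (fun s => GA (s, i1))).
have l0E t : l0 t = G (t, i0) by [].
have l1E t : l1 t = G (t, i1) by [].
have e0 : cls l0 = idn_class R (ends_in A0 A1) (l0 i0).
  apply: loops_null_cls n0 _ _ _; [exact: GV0|by move=> t; exact: GA|].
  by rewrite !l0E G0 G1.
have e1 : cls l1 = idn_class R (ends_in A0 A1) (l1 i0).
  apply: loops_null_cls n1 _ _ _; [exact: GV1|by move=> t; exact: GA|].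
  by rewrite !l1E G0 G1.
(* The sides of the square G are trivial, so f and g agree in the groupoid where endpoints may move
   inside A0 and A1. *)
have : cls f' = cls g'.
  have := @square_class R PX Prop (ends_in A0 A1) G l0 l1 f' g' cG.
  have -> : comp_class (cls l1) (cls f') = cls f'.
    by rewrite e1 l1E G0; have := comp_idl (cls f'); rewrite vtgtE.
  have -> : comp_class (cls g') (cls l0) = cls g'.
    by rewrite e0 l0E G0 fg0; have := comp_idr (cls g'); rewrite vsrcE.
  by apply => // z w; exact: ends_in_eq.
move=> /clsP [h [ch h0 h1 hv he]].
have hA z : ends_in A0 A1 (h z).
  by case: z => t s; rewrite (hv t s i0); have [-> _] := he t.
have ce0 : continuous (fun z => h z i0) by cts.
have ce1 : continuous (fun z => h z i1) by cts.
have hb z : boundary2 z -> h z i0 = f i0 i0 /\ h z i1 = f i0 i1.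
  case: z => t s [[|]|[|]] /= ->.
  - by rewrite h0; exact: (vpath_ends f s).
  - by rewrite h1 fg0; exact: (vpath_ends g s).
  - by have [-> _] := he t.
  - by have [_ ->] := he t; exact: (vpath_ends f i1).
(* On the boundary of the square the endpoints of h are constant, so they sweep out spheres in A0
   and A1; the contractions N0 and N1 run in X. *)
have [||N0 [cN0 _ N00 N01 N0b]] := z0 (f i0 i0) _ (fA i0).1 ce0.
- by move=> z; exact: (hA z).1.
- by move=> z /hb[].
have [||N1 [cN1 _ N10 N11 N1b]] := z1 (f i0 i1) _ (fA i0).2 ce1.
- by move=> z; exact: (hA z).2.
- by move=> z /hb[].
have cn0 : continuous (fun w : (I * I) * I => N0 (w.2, w.1)) by cts.
have cn1 : continuous (fun w : (I * I) * I => N1 (w.2, w.1)) by cts.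
pose q0 := curry_path cn0; pose q1 := curry_path cn1.
have cq0 : continuous q0 by exact: curry_path_continuous.
have cq1 : continuous q1 by exact: curry_path_continuous.
have q0E z r : q0 z r = N0 (r, z) by [].
have q1E z r : q1 z r = N1 (r, z) by [].
have j0 z : h z i0 = prev (q0 z) i1 by rewrite prevE flip1 q0E N00.
have j1 z : q1 z i0 = pcat (h z) (prev (q0 z)) i1 by rewrite pcat1 // q1E N10.
(* Pushing the ends of h along these contractions makes them constant. On the boundary the
   contractions are constant and M is the padding of h. *)
pose M z : PX := pcat (q1 z) (pcat (h z) (prev (q0 z))).
have cM : continuous M by rewrite /M; cts.
have Mends z : ends (M z) = ends (f i0).
  by rewrite /ends /M pcat0 // pcat0 // pcat1 // prevE flip0 q0E q1E N01 N11.
have Mb z : boundary2 z -> M z = pad (h z).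
  move=> bz; rewrite /M /pad; have [-> ->] := hb z bz.
  have -> : q1 z = pcst R (f i0 i1) by apply: path_ext => s; rewrite q1E N1b.
  have -> // : prev (q0 z) = pcst R (f i0 i0).
  by apply: path_ext => s; rewrite prevE q0E N0b.
have cF (k : vpath R E) : continuous (fun s => pad (k s)) by apply: pad_continuous; cts.
have vF (k : vpath R E) : vertical E (mkpath (cF k)).
  by move=> s t; rewrite /ends /= !pad_i0 !pad_i1; exact: (vpathP k s t).
apply: (@pad_faithful R X f g (mkvpath (vF f)) (mkvpath (vF g))) => //.
apply/clsP; exists M; split => //.
- by move=> s; rewrite Mb ?h0 //; left; left.
- by move=> s; rewrite Mb ?h1 //; left; right.
- by move=> t s s'; rewrite !Mends.
- by move=> t; have [H0 H1] := he t; rewrite !Mb ?H0 ?H1 //; right; [right|left].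
Qed.

Lemma pcat_rel (Y Y' : topologicalType) (Q : Y -> Y' -> Prop) (g f : pathspace R Y)
    (g' f' : pathspace R Y') : g i0 = f i1 -> g' i0 = f' i1 ->
  (forall s, Q (g s) (g' s)) -> (forall s, Q (f s) (f' s)) ->
  forall s, Q (pcat g f s) (pcat g' f' s).
Proof. by move=> gf gf' Qg Qf s; rewrite !pcatE // /cat_fun; case: ifP. Qed.

Lemma comp_slide_p_inv (f F : vpath R E) : (forall s, F s = pad (f s)) ->
  comp_class (cls (slide_p (f i1))) (comp_class (cls F) (inv_class (cls (slide_p (f i0))))) = cls f.
Proof.
move=> Ff.
have a1 : vsrc (cls (slide_p (f i1))) = vtgt (cls F) by rewrite vsrcE vtgtE Ff slide_p0.
have a2 : vsrc (cls F) = vtgt (inv_class (cls (slide_p (f i0)))).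
  by rewrite vtgt_inv !vsrcE Ff slide_p0.
have a3 : vsrc (cls f) = vtgt (cls (slide_p (f i0))) by rewrite vsrcE vtgtE slide_p1.
rewrite (comp_classA a1 a2) (natural_p Ff) -comp_classA ?vtgt_inv //.
by rewrite comp_invr -a3 comp_idr.
Qed.

(* The boundary is transported along P0 and P1 by conjugation, the endpoints are
   pushed back over those of P0 and P1, and the sides are corrected by slides. *)
Lemma box_filler (f : vpath R E) (P0 P1 : pathspace R PX) :
  P0 i0 = f i0 -> P1 i0 = f i1 -> (forall t, ends (P1 t) = ends (P0 t)) ->
  exists (H : I -> pathspace R PX) (f0 : vpath R E), [/\ continuous H, cls f0 = cls f,
    forall s, H i0 s = f0 s, forall t, H t i0 = P0 t /\ H t i1 = P1 t
    & forall t s, ends (H t s) = ends (P0 t)].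
Proof.
move=> P00 P10 Pe.
(* [th t] runs from t to 0, rests there and returns to t. It mirrors g below, so that the ends of g
   t s are those of P0 at time [th t s]. *)
pose th (t : I) : pathspace R I := pcat (seg (pid R) i0 t) (pcat (pcst R i0) (seg (pid R) t i0)).
have th1 t : pcst R i0 i0 = seg (pid R) t i0 i1 by rewrite segE lerp1.
have th2 t : seg (pid R) i0 t i0 = pcat (pcst R i0) (seg (pid R) t i0) i1.
  by rewrite pcat1 // segE lerp0.
have tht0 t : th t i0 = t by rewrite /th pcat0 // pcat0 // segE lerp0.
have tht1 t : th t i1 = t by rewrite /th pcat1 // segE lerp1.
have cth : continuous th by rewrite /th; cts.
have th0 s : th i0 s = i0.
  by apply: (@pcat_ind _ I (fun x => x = i0)) => u;
    [rewrite segE lerpxx|apply: (@pcat_ind _ I (fun x => x = i0)) => v; rewrite ?segE ?lerpxx].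
pose g (t : I) : pathspace R PX := pcat (seg P1 i0 t) (pcat f (seg P0 t i0)).
have g1 t : f i0 = seg P0 t i0 i1 by rewrite segE lerp1.
have g2 t : seg P1 i0 t i0 = pcat f (seg P0 t i0) i1 by rewrite pcat1 // segE lerp0.
have cg : continuous g by rewrite /g; cts.
have gt0 t : g t i0 = P0 t by rewrite /g pcat0 // pcat0 // segE lerp0.
have gt1 t : g t i1 = P1 t by rewrite /g pcat1 // segE lerp1.
have g_th t s : ends (g t s) = ends (P0 (th t s)).
  apply: (@pcat_rel PX I (fun c u => ends c = ends (P0 u))) => // {}s.
    by rewrite !segE Pe.
  apply: (@pcat_rel PX I (fun c u => ends c = ends (P0 u))) => // {}s.
  by rewrite /= P00; exact: (vpathP f s i0).
have cp0 : continuous (fun t => P0 t i0) by cts.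
have cp1 : continuous (fun t => P0 t i1) by cts.
pose p0 : PX := mkpath cp0; pose p1 : PX := mkpath cp1.
have p0E t : p0 t = P0 t i0 by [].
have p1E t : p1 t = P0 t i1 by [].
have k1 t s : g t s i0 = seg p0 t (th t s) i1.
  by rewrite segE lerp1 p0E; have [] := g_th t s.
have k2 t s : seg p1 (th t s) t i0 = pcat (g t s) (seg p0 t (th t s)) i1.
  by rewrite pcat1 // segE lerp0 p1E; have [] := g_th t s.
(* The ends of g t s are moved from time [th t s] to time t, which makes k t vertical with the ends
   of P0 t. *)
have ck : continuous (fun z : I * I => pcat (seg p1 (th z.1 z.2) z.1)
    (pcat (g z.1 z.2) (seg p0 z.1 (th z.1 z.2)))) by cts.
pose k := curry_path ck.
have kE t s : k t s = pcat (seg p1 (th t s) t) (pcat (g t s) (seg p0 t (th t s))) by [].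
have kc : continuous k by exact: curry_path_continuous.
have kends t s : ends (k t s) = ends (P0 t).
  by rewrite /ends kE pcat0 // pcat0 // pcat1 // !segE lerp0 lerp1.
have kt0 t : k t i0 = pad (P0 t) by rewrite kE tht0 gt0 !seg_xx.
have kt1 t : k t i1 = pad (P1 t).
  rewrite kE tht1 gt1 !seg_xx /pad p0E p1E.
  by have [-> ->] := Pe t.
(* The objects at the two ends of k t are now padded; these slides restore P0 t and P1 t. *)
have cs1 : continuous (fun z : I * I => slide_p (P1 z.1) z.2).
  by apply: (@slide_p_continuous R X _ (fun z => P1 z.1) snd); cts.
have cs0 : continuous (fun z : I * I => slide_p (P0 z.1) (flip z.2)).
  by apply: (@slide_p_continuous R X _ (fun z => P0 z.1) (fun z => flip z.2)); cts.
pose s1 := curry_path cs1; pose s0 := curry_path cs0.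
have s1E t s : s1 t s = slide_p (P1 t) s by [].
have s0E t s : s0 t s = slide_p (P0 t) (flip s) by [].
have s1c : continuous s1 by exact: curry_path_continuous.
have s0c : continuous s0 by exact: curry_path_continuous.
have h1 t : k t i0 = s0 t i1 by rewrite s0E flip1 slide_p0 kt0.
have h2 t : s1 t i0 = pcat (k t) (s0 t) i1 by rewrite pcat1 // s1E slide_p0 kt1.
pose H t := pcat (s1 t) (pcat (k t) (s0 t)).
have k0 s : k i0 s = pad (g i0 s).
  rewrite kE th0 !seg_xx /pad; have := g_th i0 s; rewrite th0 /ends p0E p1E.
  by move=> -[-> ->].
(* At t = 0 all transports are constant, and k is the padding of f composed with units; conjugation
   by the slides recovers the class of f. *)
pose kv := vcat (vcst R E (f i1)) (vcat f (vcst R E (f i0))).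
have kvE s : kv s = g i0 s by rewrite /g !seg_xx P00 P10.
have ckv : continuous (fun s => pad (kv s)) by apply: pad_continuous; cts.
have vkv : vertical E (mkpath ckv).
  by move=> s t; rewrite /ends /= !pad_i0 !pad_i1; exact: (vpathP kv s t).
pose Kv := mkvpath vkv.
have KvE s : Kv s = pad (kv s) by [].
have e1 : vcst R E (f i1) i0 = vcat f (vcst R E (f i0)) i1 by rewrite vcat1.
have kv0 : kv i0 = f i0 by rewrite (vcat0 e1) vcat0.
have kv1 : kv i1 = f i1 by rewrite (vcat1 e1).
have j1 : Kv i0 = vrev (slide_p (f i0)) i1 by rewrite KvE kv0 vrevE flip1 slide_p0.
have j2 : slide_p (f i1) i0 = vcat Kv (vrev (slide_p (f i0))) i1.
  by rewrite vcat1 // KvE kv1 slide_p0.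
exists H, (vcat (slide_p (f i1)) (vcat Kv (vrev (slide_p (f i0))))); split.
- by rewrite /H; cts.
- rewrite -(comp_classE j2) -(comp_classE j1) -inv_classE.
  rewrite -{1}kv1 -{1}kv0 (comp_slide_p_inv KvE).
  rewrite -(comp_classE e1) -comp_classE //.
  have := comp_idr (cls f); rewrite vsrcE => ->.
  by have := comp_idl (cls f); rewrite vtgtE.
- apply: (@pcat_rel PX PX eq) => // [s|]; first by rewrite s1E P10.
  apply: (@pcat_rel PX PX eq) => // [s|s].
    by rewrite k0 -kvE.
  by rewrite s0E P00 vrevE.
- move=> t; split; first by rewrite /H pcat0 // pcat0 // s0E flip0 slide_p1.
  by rewrite /H pcat1 // s1E slide_p1.
- move=> t; apply: (@pcat_ind _ PX (fun c => ends c = ends (P0 t))) => s.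
    by rewrite s1E /ends (slide_p_ends _ s).1 (slide_p_ends _ s).2 -/(ends _) Pe.
  move: s; apply: (@pcat_ind _ PX (fun c => ends c = ends (P0 t))) => s //.
  by rewrite s0E /ends (slide_p_ends _ _).1 (slide_p_ends _ _).2.
Qed.

End Rigidity.

(** * Continuity *)

Section ArrowSpace.
Variables (R : realType) (Y Z : topologicalType).
Variables (BY : open_basis Y) (BZ : open_basis Z) (p : Y -> Z).
Local Notation I := (unitI R).
Local Notation i0 := (i0 R).
Local Notation i1 := (i1 R).
Local Notation arrow := (varrow R BY BZ p).

Lemma basic_nbhd_ends (f g : vpath R p) U V0 V1 : basic_nbhd f U V0 V1 (cls g) ->
  [/\ U (p (g i0)), V0 (g i0) & V1 (g i1)].
Proof.
move=> [k [/clsP /vhomotopic_ends [-> ->] [h [_ hU _ h1 hV]]]].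
by rewrite -!h1; have [? ?] := hV i1; split.
Qed.

Lemma nbhs_cls (f : vpath R p) (W : set arrow) : nbhs (cls f : arrow) W ->
  exists U V0 V1, [/\ nbhs (p (f i0)) U, nbhs (f i0) V0, nbhs (f i1) V1
    & basic_nbhd f U V0 V1 `<=` W].
Proof.
move=> nW; rewrite nbhsE in nW; have [W' [/varrow_openP oW W'f] W'W] := nW.
have [_ [[g [U [V0 [V1 [[BU _] [B0 _] [B1 _] ->]]]]] Nf NW]] := oW _ W'f.
have [Uf V0f V1f] := basic_nbhd_ends Nf.
exists U, V0, V1; split.
- exact: open_basis_open_nbhs BU Uf.
- exact: open_basis_open_nbhs B0 V0f.
- exact: open_basis_open_nbhs B1 V1f.
- by move=> a Na; apply/W'W/NW; exact: (@basic_nbhd_sub _ _ _ _ g f U V0 V1 U V0 V1).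
Qed.

Lemma nbhs_basic (f : vpath R p) U V0 V1 :
  nbhs (p (f i0)) U -> nbhs (f i0) V0 -> nbhs (f i1) V1 ->
  nbhs (cls f : arrow) (basic_nbhd f U V0 V1).
Proof.
move=> nU nV0 nV1.
have [U' [BU U'f UU]] := open_basis_nbhs BZ nU.
have [W0 [B0 W0f VW0]] := open_basis_nbhs BY nV0.
have [W1 [B1 W1f VW1]] := open_basis_nbhs BY nV1.
rewrite nbhsE; exists (basic_nbhd f U' W0 W1); last first.
  by apply: basic_nbhd_sub => //; apply: basic_nbhd_refl; [exact: UU|exact: VW0|exact: VW1].
split; last exact: basic_nbhd_refl.
by apply/varrow_openP => a Na; exists (basic_nbhd f U' W0 W1); split => //; exists f, U', W0, W1.
Qed.

(** A basic neighbourhood depends on f only through its class; this matters because [box_filler]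
    starts at another representative f0. *)
Lemma basic_nbhd_homotopy (f f0 g : vpath R p) (H : I * I -> Y) U V0 V1 :
  continuous H -> cls f0 = cls f -> (forall s, H (i0, s) = f0 s) ->
  (forall s, H (i1, s) = g s) -> (forall z, U (p (H z))) ->
  (forall t, V0 (H (t, i0)) /\ V1 (H (t, i1))) -> basic_nbhd f U V0 V1 (cls g).
Proof.
move=> cH ff H0 H1 HU HV.
have Uf : U (p (f0 i0)) by rewrite -H0.
have [V0f V1f] := HV i0; rewrite !H0 in V0f V1f.
apply: (@basic_nbhd_sub _ _ _ _ f f0 U V0 V1 U V0 V1) => //; last first.
  by exists g; split=> //; exists H; split.
have [e0 e1] := vhomotopic_ends ((clsP _ _).1 ff).
by rewrite ff; apply: basic_nbhd_refl; rewrite -?e0 -?e1.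
Qed.

Lemma arrow_continuous (T : topologicalType) (F : arrow -> T) :
  (forall f V, nbhs (F (cls f)) V -> exists U V0 V1,
    [/\ nbhs (p (f i0)) U, nbhs (f i0) V0, nbhs (f i1) V1
      & forall g, basic_nbhd f U V0 V1 (cls g) -> V (F (cls g))]) ->
  continuous F.
Proof.
move=> HF a V; have [f ->] := cls_surj a.
move=> /HF [U [V0 [V1 [nU n0 n1 UV]]]].
apply: (filterS _ (nbhs_basic nU n0 n1)) => b; have [g ->] := cls_surj b; exact: UV.
Qed.

Lemma vsrc_continuous : continuous (@vsrc R Y Z p : arrow -> Y).
Proof.
apply: arrow_continuous => f V; rewrite vsrcE => nV.
exists setT, V, setT; split=> [|//||g /basic_nbhd_ends[]]; try exact: filterT.
by rewrite vsrcE.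
Qed.

Lemma vtgt_continuous : continuous (@vtgt R Y Z p : arrow -> Y).
Proof.
apply: arrow_continuous => f V; rewrite vtgtE => nV.
exists setT, setT, V; split=> [||//|g /basic_nbhd_ends[]]; try exact: filterT.
by rewrite vtgtE.
Qed.

Lemma inv_class_continuous : continuous (@inv_class R Y Z p : arrow -> arrow).
Proof.
apply: arrow_continuous => f W; rewrite inv_classE.
move=> /nbhs_cls [U [V0 [V1 [nU n0 n1 UW]]]].
rewrite vrevE flip0 in nU n0; rewrite vrevE flip1 in n1.
rewrite (vpathP f i1 i0) in nU.
exists U, V1, V0; split => // _ [g [-> [h [ch hU h0 h1 hV]]]].
rewrite inv_classE; apply: UW.
apply: (@basic_nbhd_homotopy _ (vrev f) _ (fun z => h (z.1, flip z.2))) => //.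
- by cts.
- by move=> t /=; rewrite flip0 flip1; have [] := hV t.
Qed.

Definition locally_path_connected (T : topologicalType) : Prop :=
  forall (x : T) (V : set T), nbhs x V -> exists2 N : set T, nbhs x N &
    forall y, N y -> exists P : pathspace R T, [/\ P i0 = x, P i1 = y & forall t, V (P t)].

(** A path P from x to a nearby y gives the homotopy n (P t) from n x to n y, and its ends stay in
    the prescribed sets as long as P stays near x. *)
Lemma cls_family_continuous (T : topologicalType) (n : T -> vpath R p) :
  locally_path_connected T -> continuous p ->
  continuous (fun z : T * I => n z.1 z.2) ->
  continuous (fun x => cls (n x) : arrow).
Proof.
move=> lT cp cn x W /nbhs_cls [U [V0 [V1 [nU n0 n1 UW]]]].
have c0 : continuous (fun x => n x i0).
  by apply: (@comp_continuous _ _ _ (fun x : T => (x, i0)) _ _ cn); cts.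
have c1 : continuous (fun x => n x i1).
  by apply: (@comp_continuous _ _ _ (fun x : T => (x, i1)) _ _ cn); cts.
have cpn : continuous (fun x => p (n x i0)) by cts.
have nV : nbhs x [set y | [/\ U (p (n y i0)), V0 (n y i0) & V1 (n y i1)]].
  by near=> y; split; near: y; [exact: cpn nU|exact: c0 n0|exact: c1 n1].
have [N nN NP] := lT x _ nV; apply: filterS nN => y /NP [P [P0 P1 PV]] /=.
apply: UW; apply: (@basic_nbhd_homotopy _ (n x) _ (fun z => n (P z.1) z.2)) => //.
- by apply: (@comp_continuous _ _ _ (fun z : I * I => (P z.1, z.2)) _ _ cn); cts.
- by move=> s; rewrite P0.
- by move=> s; rewrite P1.
- by move=> z; rewrite (vpathP _ z.2 i0); have [] := PV z.1.
- by move=> t; have [] := PV t.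
Unshelve. all: by end_near. Qed.

End ArrowSpace.

(** * Tame neighbourhoods with adjustable end sets *)

Section LocalTameness.
Variables (R : realType) (X : topologicalType) (BX : open_basis X).
Hypothesis BXP : forall U, BX U -> one_connected R U /\ zero_on_pi R (@boundary2 R) U setT.
Local Notation I := (unitI R).
Local Notation i0 := (i0 R).
Local Notation i1 := (i1 R).
Local Notation PX := (pathspace R X).
Local Notation E := (@ends R X).

Lemma ends_continuous : continuous E.
Proof. by rewrite /ends; cts. Qed.

Definition tame (c : PX) (V : set PX) (A0 A1 : set X) : Prop :=
  [/\ nbhs c V, lifts_paths c V A0 A1 & loops_null V A0 A1].

(** V' is chosen before A0 and A1, so the end sets can be shrunk afterwards to suit several paths
    with common endpoints. Loops of endpoints contract within A0 and A1 because these are simply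
    connected. *)
Lemma tame_exists (c : PX) V : nbhs c V -> exists V' D0 D1,
  [/\ V' `<=` V, nbhs (c i0) D0, nbhs (c i1) D1 & forall A0 A1, BX A0 -> BX A1 ->
    A0 `<=` D0 -> A1 `<=` D1 -> tame c V' A0 A1].
Proof.
move=> nV; have [V' [D0 [D1 [fV VV]]]] := fine_exists BX nV.
have [B0 D0c] := fine_start fV; have [B1 D1c] := fine_stop fV.
exists V', D0, D1; split => //.
- exact: open_basis_open_nbhs B0 D0c.
- exact: open_basis_open_nbhs B1 D1c.
move=> A0 A1 BA0 BA1 AD0 AD1; split; first exact: fine_nbhs fV.
  move=> c' g d V'c gA dA; apply: (fine_lifts BXP fV) => // u; first exact/AD0/gA.
  exact/AD1/dA.
move=> l lV lA l01.
have [|||K0 cK0] := @simply_connected_contracts R X A0 (fun t => l t i0) (BXP BA0).1.2.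
- by cts.
- by move=> t; exact: (lA t).1.
- by rewrite l01.
have [|||K1 cK1] := @simply_connected_contracts R X A1 (fun t => l t i1) (BXP BA1).1.2.
- by cts.
- by move=> t; exact: (lA t).2.
- by rewrite l01.
have [||K [cK Kl Kc Ke Kh]] := fine_contracts BXP fV lV l01 (K0 := K0) (K1 := K1).
- exact: contracts_eq AD0 _ cK0.
- exact: contracts_eq AD1 _ cK1.
exists K; split => // -[r t]; have [e0 e1] := Kh r t.
by split; [rewrite e0; have [_ + _ _ _] := cK0; exact|rewrite e1; have [_ + _ _ _] := cK1; exact].
Qed.

Lemma basis_path (A : set X) x y : BX A -> A x -> A y ->
  exists P : PX, [/\ P i0 = x, P i1 = y & forall t, A (P t)].
Proof.
move=> /BXP [[pA _] _] Ax Ay; have [f [cf fA f0 f1]] := pA _ _ Ax Ay.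
by exists (mkpath cf).
Qed.

(* By rigidity, the filler of the box on f, P0 and P1 ends in the class of f'. *)
Lemma tame_homotopy (V0 V1 : set PX) (A0 A1 : set X) (f f' : vpath R E) (h : I * I -> PX)
    (P0 P1 : pathspace R PX) :
  loops_null V0 A0 A1 -> loops_null V1 A0 A1 -> BX A0 -> BX A1 ->
  continuous h -> (forall s, h (i0, s) = f s) -> (forall s, h (i1, s) = f' s) ->
  (forall t, V0 (h (t, i0)) /\ V1 (h (t, i1))) -> (forall z, ends_in A0 A1 (h z)) ->
  P0 i0 = f i0 -> P0 i1 = f' i0 -> P1 i0 = f i1 -> P1 i1 = f' i1 ->
  (forall t, V0 (P0 t)) -> (forall t, V1 (P1 t)) -> (forall t, ends (P1 t) = ends (P0 t)) ->
  (forall t, ends_in A0 A1 (P0 t)) ->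
  exists (H : I -> pathspace R PX) (f0 f1 : vpath R E),
    [/\ continuous H, cls f0 = cls f, cls f1 = cls f', forall s, H i0 s = f0 s
      & forall s, H i1 s = f1 s] /\
    [/\ forall t, H t i0 = P0 t, forall t, H t i1 = P1 t & forall t s, ends (H t s) = ends (P0 t)].
Proof.
move=> n0 n1 BA0 BA1 ch h0 h1 hV hA P00 P01 P10 P11 PV0 PV1 Pe PA.
have [H [f0 [cH ff0 H0 He Hends]]] := box_filler P00 P10 Pe.
have vH : vertical E (H i1) by move=> s t; rewrite !Hends.
pose f1 := mkvpath vH.
exists H, f0, f1; split; last first.
  by split=> // t; have [] := He t.
split=> //.
have cf1 s : f1 s = H i1 s by [].
have [k [ck k0 k1 kv ke]] : vhomotopic f f0 by apply/clsP.
have cH' : continuous (fun z : I * I => H z.1 z.2) by cts.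
have chf : continuous (fun z : I * I => h (flip z.1, z.2)) by cts.
have ends_A c d : ends c = ends d -> ends_in A0 A1 d -> ends_in A0 A1 c.
  by rewrite /ends /ends_in => -[-> ->].
have fA s : ends_in A0 A1 (f s) by rewrite -h0.
have kA z : ends_in A0 A1 (k z).
  case: z => t s; apply: ends_A (fA i0); rewrite (kv t s i0).
  by have [-> _] := ke t.
(* The homotopy from f' to f1 is the reverse of h, then k from f to its representative f0, then
   H. *)
apply/esym; apply: (@rigid R X V0 V1 A0 A1 f' f1
  (paste1 (paste1 (fun z => h (flip z.1, z.2)) k) (fun z => H z.1 z.2))) => //.
- exact: (BXP BA0).2.
- exact: (BXP BA1).2.
- apply: paste1_continuous => //.
    by apply: paste1_continuous => // s; rewrite /= flip1 h0 k0.
  by move=> s; rewrite paste1_1 k1 H0.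
- by move=> s; rewrite !paste1_0 /= flip0 h1.
- by move=> s; rewrite paste1_1.
- by rewrite cf1 -P01; have [-> _] := He i1.
- by rewrite cf1 -P11; have [_ ->] := He i1.
- move=> t; rewrite /paste1 /=; case: ifP => _; last by have [-> _] := He (rgt t).
  case: ifP => _; first by have [] := hV (flip (lft (lft t))).
  by have [-> _] := ke (rgt (lft t)); rewrite -P00.
- move=> t; rewrite /paste1 /=; case: ifP => _; last by have [_ ->] := He (rgt t).
  case: ifP => _; first by have [] := hV (flip (lft (lft t))).
  by have [_ ->] := ke (rgt (lft t)); rewrite -P10.
- move=> z; rewrite /paste1 /=; case: ifP => _; first by case: ifP.
  exact: ends_A (Hends _ _) (PA _).
Qed.

Lemma pathspace_locally_path_connected : locally_path_connected R PX.
Proof.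
move=> c V nV; have [V' [D0 [D1 [VV nD0 nD1 tm]]]] := tame_exists nV.
have [A0 [BA0 A0c AD0]] := open_basis_nbhs BX nD0.
have [A1 [BA1 A1c AD1]] := open_basis_nbhs BX nD1.
have [nV' lV _] := tm A0 A1 BA0 BA1 AD0 AD1.
exists [set d | V' d /\ ends_in A0 A1 d].
  have ce0 : continuous (fun d : PX => d i0) by cts.
  have ce1 : continuous (fun d : PX => d i1) by cts.
  near=> d; split; first by near: d.
  split; near: d; first by apply: ce0; exact: open_basis_open_nbhs BA0 A0c.
  by apply: ce1; exact: open_basis_open_nbhs BA1 A1c.
move=> d [V'd [dA0 dA1]].
have [g [g0 g1 gA]] := basis_path BA0 A0c dA0.
have [e [e0 e1 eA]] := basis_path BA1 A1c dA1.
have [P [P0 P1 PV _]] := lV d g e V'd gA eA g0 g1 e0 e1.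
by exists P; split => // t; exact/VV/PV.
Unshelve. all: by end_near. Qed.

End LocalTameness.

Lemma within_continuousP (T U : topologicalType) (A : set T) (f : T -> U) :
  (forall x, A x -> forall W, nbhs (f x) W ->
    exists2 N : set T, nbhs x N & forall y, N y -> A y -> W (f y)) ->
  {within A, continuous f}.
Proof.
move=> H; apply/subspace_continuousP => x Ax W /(H x Ax) [N nN NW].
by apply: filterS nN => y Ny Ay; exact: NW.
Qed.

(** * Continuity of vertical and horizontal composition *)

Section Pi2Continuity.
Variables (R : realType) (X : topologicalType) (BX : open_basis X).
Hypothesis BXP : forall U, BX U -> one_connected R U /\ zero_on_pi R (@boundary2 R) U setT.
Variables (BP : open_basis (pathspace R X)) (BXX : open_basis (X * X)%type).
Local Notation I := (unitI R).
Local Notation i0 := (i0 R).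
Local Notation i1 := (i1 R).
Local Notation PX := (pathspace R X).
Local Notation E := (@ends R X).
Local Notation arrow := (varrow R BP BXX E).

Lemma idn_class_continuous : continuous (@idn_class R PX _ E : PX -> arrow).
Proof.
apply: (@cls_family_continuous R PX _ BP BXX E PX (vcst R E)).
- exact: pathspace_locally_path_connected BXP.
- exact: ends_continuous.
- exact: fst_continuous.
Qed.

Lemma slide_cls_continuous (T : topologicalType) (u v : R -> R) cu cv uv0 uv1 (c : T -> PX) :
  locally_path_connected R T -> continuous c ->
  continuous (fun x => cls (@slide R X u v cu cv uv0 uv1 (c x)) : arrow).
Proof.
move=> lT cc.
apply: (@cls_family_continuous R PX _ BP BXX E T (fun x => slide cu cv uv0 uv1 (c x))) => //.
  exact: ends_continuous.
by apply: (@slide_continuous R X _ _ _ _ _ _ _ (fun z => c z.1) snd); cts.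
Qed.

Lemma nbhs_ends (c : PX) (U : set (X * X)) : nbhs (ends c) U ->
  exists W0 W1, [/\ nbhs (c i0) W0, nbhs (c i1) W1 & forall d : PX, ends_in W0 W1 d -> U (ends d)].
Proof.
move=> [[W0 W1] /= [n0 n1] WU]; exists W0, W1; split => // d [d0 d1].
exact: (WU (d i0, d i1)).
Qed.

Lemma nbhs_box (A0 A1 : set X) (c : PX) : BX A0 -> BX A1 -> A0 (c i0) -> A1 (c i1) ->
  nbhs (ends c) (A0 `*` A1).
Proof.
by move=> B0 B1 c0 c1; exists (A0, A1) => //=; split;
  [exact: open_basis_open_nbhs B0 c0|exact: open_basis_open_nbhs B1 c1].
Qed.

(** The given homotopies from g and from f move the shared object f i1 = g i0 in different ways. A
    single path P1 of middle objects is chosen, and [tame_homotopy] rebuilds both homotopies with P1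
    as common side. *)
Lemma comp_class_nbhs (b a : arrow) (W : set arrow) : vsrc b = vtgt a ->
  nbhs (comp_class b a : arrow) W ->
  exists N M : set arrow, [/\ nbhs b N, nbhs a M &
    forall b' a', N b' -> M a' -> vsrc b' = vtgt a' -> W (comp_class b' a')].
Proof.
have [g ->] := cls_surj b; have [f ->] := cls_surj a.
rewrite vsrcE vtgtE => gf; rewrite (comp_classE gf) => /nbhs_cls [U [O0 [O2 [nU n0 n2 UW]]]].
rewrite (vcat0 gf) in nU n0; rewrite (vcat1 gf) in n2.
have [W0 [W1 [nW0 nW1 WU]]] := nbhs_ends nU.
have [V0 [D00 [D01 [VO0 nD00 nD01 t0]]]] := tame_exists BXP n0.
(* The shared object carries no condition from W; its neighbourhood only has to be tame. *)
have [V1 [D10 [D11 [_ nD10 nD11 t1]]]] := tame_exists BXP (filterT : nbhs (f i1) setT).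
have [V2 [D20 [D21 [VO2 nD20 nD21 t2]]]] := tame_exists BXP n2.
have f_0 := (vpath_ends f i1).1; have f_1 := (vpath_ends f i1).2.
have g_0 := (vpath_ends g i1).1; have g_1 := (vpath_ends g i1).2.
rewrite gf f_0 in g_0; rewrite gf f_1 in g_1.
rewrite f_0 in nD10; rewrite f_1 in nD11; rewrite g_0 in nD20; rewrite g_1 in nD21.
(* The three objects f i0, f i1 and g i1 have the same endpoints in X, so one pair of end sets
   serves all of them. *)
have [A0 [BA0 A0x AD0]] :=
  open_basis_nbhs BX (filterI (filterI nW0 nD00) (filterI nD10 nD20)).
have [A1 [BA1 A1x AD1]] :=
  open_basis_nbhs BX (filterI (filterI nW1 nD01) (filterI nD11 nD21)).
have [nV0 lV0 L0] : tame (f i0) V0 A0 A1.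
  by apply: t0 => // x; [move=> /AD0 [[]]|move=> /AD1 [[]]].
have [nV1 lV1 L1] : tame (f i1) V1 A0 A1.
  by apply: t1 => // x; [move=> /AD0 [_ []]|move=> /AD1 [_ []]].
have [nV2 lV2 L2] : tame (g i1) V2 A0 A1.
  by apply: t2 => // x; [move=> /AD0 [_ []]|move=> /AD1 [_ []]].
exists (basic_nbhd g (A0 `*` A1) V1 V2), (basic_nbhd f (A0 `*` A1) V0 V1); split.
- by apply: nbhs_basic; rewrite ?gf //; apply: nbhs_box; rewrite ?f_0 ?f_1.
- by apply: nbhs_basic => //; exact: nbhs_box.
move=> _ _ [g' [-> [k [ck kA k0 k1 kV]]]] [f' [-> [h [ch hA h0 h1 hV]]]].
rewrite vsrcE vtgtE => gf'; rewrite (comp_classE gf'); apply: UW.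
have f'A : ends_in A0 A1 (f' i0) by rewrite -h1; exact: hA.
have [p0 [p00 p01 p0A]] := basis_path BXP BA0 A0x f'A.1.
have [p1 [p10 p11 p1A]] := basis_path BXP BA1 A1x f'A.2.
have f'_0 := (vpath_ends f' i1).1; have f'_1 := (vpath_ends f' i1).2.
have g'_0 := (vpath_ends g' i1).1; have g'_1 := (vpath_ends g' i1).2.
have V0f' : V0 (f' i0) by rewrite -h1; have [] := hV i1.
have V1f' : V1 (f' i1) by rewrite -h1; have [] := hV i1.
have V2g' : V2 (g' i1) by rewrite -k1; have [] := kV i1.
rewrite gf' f'_0 in g'_0; rewrite gf' f'_1 in g'_1.
have [P0 [P00 P01 P0V P0e]] := lV0 _ p0 p1 V0f' p0A p1A p00 p01 p10 p11.
have [|||| P1 [P10 P11 P1V P1e]] := lV1 _ p0 p1 V1f' p0A p1A.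
- by rewrite f_0.
- by rewrite f'_0.
- by rewrite f_1.
- by rewrite f'_1.
have [|||| P2 [P20 P21 P2V P2e]] := lV2 _ p0 p1 V2g' p0A p1A.
- by rewrite g_0.
- by rewrite g'_0.
- by rewrite g_1.
- by rewrite g'_1.
have e10 t : ends (P1 t) = ends (P0 t).
  by rewrite /ends; have [-> ->] := P0e t; have [-> ->] := P1e t.
have e21 t : ends (P2 t) = ends (P1 t).
  by rewrite /ends; have [-> ->] := P1e t; have [-> ->] := P2e t.
have P0A t : ends_in A0 A1 (P0 t) by rewrite /ends_in (P0e t).1 (P0e t).2.
have P1A t : ends_in A0 A1 (P1 t) by rewrite /ends_in (P1e t).1 (P1e t).2.
have [H [f0 [f1 [[cH ff0 ff1 H0 H1] [Hs Ht He]]]]] :=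
  tame_homotopy BXP L0 L1 BA0 BA1 ch h0 h1 hV hA P00 P01 P10 P11 P0V P1V e10 P0A.
have P10' : P1 i0 = g i0 by rewrite P10 gf.
have P11' : P1 i1 = g' i0 by rewrite P11 gf'.
have [K [g0 [g1 [[cK gg0 gg1 K0 K1] [Ks Kt Ke]]]]] :=
  tame_homotopy BXP L1 L2 BA0 BA1 ck k0 k1 kV kA P10' P11' P20 P21 P1V P2V e21 P1A.
have KH t : K t i0 = H t i1 by rewrite Ks Ht.
have gf0 : g0 i0 = f0 i1 by rewrite -K0 -H0.
have gf1 : g1 i0 = f1 i1 by rewrite -K1 -H1.
have -> : cls (vcat g' f') = cls (vcat g1 f1).
  by rewrite -(comp_classE gf') -(comp_classE gf1) gg1 ff1.
apply: (@basic_nbhd_homotopy _ _ _ _ _ (vcat g0 f0) _ (fun z => pcat (K z.1) (H z.1) z.2)).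
- by cts.
- by rewrite -(comp_classE gf) -(comp_classE gf0) gg0 ff0.
- by move=> s; apply: (@pcat_rel R PX PX eq).
- by move=> s; apply: (@pcat_rel R PX PX eq).
- case=> t s; apply: WU => /=; move: s.
  have A_W c : ends c = ends (P0 t) -> ends_in W0 W1 c.
    rewrite /ends => -[e0 e1]; have [a0 a1] := P0A t.
    by split; rewrite ?e0 ?e1; [have /AD0 [[]] := a0|have /AD1 [[]] := a1].
  apply: (@pcat_ind R PX (ends_in W0 W1)) => s; apply: A_W => //.
  by rewrite Ke.
- by move=> t; rewrite /= pcat0 // pcat1 // Hs Kt; split; [exact: VO0|exact: VO2].
Qed.

Lemma pcat_within_continuous :
  {within [set gf : PX * PX | gf.1 i0 = gf.2 i1], continuous (fun gf => pcat gf.1 gf.2)}.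
Proof.
apply/subspace_sigL_continuousP.
have cv : continuous (@set_val _ [set gf : PX * PX | gf.1 i0 = gf.2 i1]).
  exact: initial_continuous.
rewrite /sigL /=.
apply: (@pcat_continuous R _ X (fun z => (set_val z).1) (fun z => (set_val z).2)).
- by cts.
- by cts.
- by move=> t; exact: (set_valP t).
Qed.

(** Here the two-cells share a point of X at every time. Both homotopies are rebuilt over the same
    path p1 of that point, so they can be concatenated at each (t, s). *)
Lemma hcomp_class_nbhs (b a : arrow) (W : set arrow) : vsrc b i0 = vsrc a i1 ->
  nbhs (hcomp_class b a : arrow) W ->
  exists N M : set arrow, [/\ nbhs b N, nbhs a M &
    forall b' a', N b' -> M a' -> vsrc b' i0 = vsrc a' i1 -> W (hcomp_class b' a')].
Proof.
have [g ->] := cls_surj b; have [f ->] := cls_surj a.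
rewrite !vsrcE => gf; rewrite (hcomp_classE gf) => /nbhs_cls [U [O0 [O1 [nU n0 n1 UW]]]].
have f_0 := (vpath_ends f i1).1; have f_1 := (vpath_ends f i1).2.
have g_0 := (vpath_ends g i1).1; have g_1 := (vpath_ends g i1).2.
have gf1 : g i1 i0 = f i1 i1 by rewrite g_0 f_1.
rewrite (hcatE _ gf) in nU n0; rewrite (hcatE _ gf) in n1.
(* Neighbourhoods of a concatenation are pulled back to its factors through continuity of [pcat] on
   composable pairs. *)
have pn (c d : PX) O : d i0 = c i1 -> nbhs (pcat d c) O -> exists O' O'',
    [/\ nbhs d O', nbhs c O'' & forall d' c', O' d' -> O'' c' -> d' i0 = c' i1 -> O (pcat d' c')].
  move=> dc nO.
  have /subspace_continuousP /(_ (d, c) dc O nO) := pcat_within_continuous.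
  move=> [[O' O''] /= [nO' nO''] OO].
  by exists O', O''; split=> // d' c' Od Oc; exact: (OO (d', c')).
have [Q0 [O0' [nQ0 nO0' QO0]]] := pn _ _ _ gf n0.
have [Q1 [O1' [nQ1 nO1' QO1]]] := pn _ _ _ gf1 n1.
have [W0 [W2 [nW0 nW2 WU]]] := nbhs_ends nU.
rewrite pcat0 // in nW0; rewrite pcat1 // in nW2.
have [V0 [D00 [D01 [VO0 nD00 nD01 t0]]]] := tame_exists BXP nO0'.
have [V1 [D10 [D11 [VO1 nD10 nD11 t1]]]] := tame_exists BXP nO1'.
have [V2 [D20 [D21 [VO2 nD20 nD21 t2]]]] := tame_exists BXP nQ0.
have [V3 [D30 [D31 [VO3 nD30 nD31 t3]]]] := tame_exists BXP nQ1.
rewrite f_0 in nD10; rewrite f_1 in nD11; rewrite g_0 gf in nD30; rewrite g_1 in nD31.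
rewrite gf in nD20.
have [A0 [BA0 A0x AD0]] := open_basis_nbhs BX (filterI nW0 (filterI nD00 nD10)).
have [A1 [BA1 A1x AD1]] :=
  open_basis_nbhs BX (filterI (filterI nD01 nD11) (filterI nD20 nD30)).
have [A2 [BA2 A2x AD2]] := open_basis_nbhs BX (filterI nW2 (filterI nD21 nD31)).
have [nV0 lV0 L0] : tame (f i0) V0 A0 A1.
  by apply: t0 => // x; [move=> /AD0 [_ []]|move=> /AD1 [[]]].
have [nV1 lV1 L1] : tame (f i1) V1 A0 A1.
  by apply: t1 => // x; [move=> /AD0 [_ []]|move=> /AD1 [[]]].
have [nV2 lV2 L2] : tame (g i0) V2 A1 A2.
  by apply: t2 => // x; [move=> /AD1 [_ []]|move=> /AD2 [_ []]].
have [nV3 lV3 L3] : tame (g i1) V3 A1 A2.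
  by apply: t3 => // x; [move=> /AD1 [_ []]|move=> /AD2 [_ []]].
exists (basic_nbhd g (A1 `*` A2) V2 V3), (basic_nbhd f (A0 `*` A1) V0 V1); split.
- by apply: nbhs_basic => //; apply: nbhs_box; rewrite ?gf.
- by apply: nbhs_basic => //; exact: nbhs_box.
move=> _ _ [g' [-> [k [ck kA k0 k1 kV]]]] [f' [-> [h [ch hA h0 h1 hV]]]].
rewrite !vsrcE => gf'; rewrite (hcomp_classE gf'); apply: UW.
have f'A : ends_in A0 A1 (f' i0) by rewrite -h1; exact: hA.
have g'A : ends_in A1 A2 (g' i0) by rewrite -k1; exact: kA.
have [p0 [p00 p01 p0A]] := basis_path BXP BA0 A0x f'A.1.
have [p1 [p10 p11 p1A]] := basis_path BXP BA1 A1x f'A.2.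
have [p2 [p20 p21 p2A]] := basis_path BXP BA2 A2x g'A.2.
have f'_0 := (vpath_ends f' i1).1; have f'_1 := (vpath_ends f' i1).2.
have g'_0 := (vpath_ends g' i1).1; have g'_1 := (vpath_ends g' i1).2.
have V0f' : V0 (f' i0) by rewrite -h1; have [] := hV i1.
have V1f' : V1 (f' i1) by rewrite -h1; have [] := hV i1.
have V2g' : V2 (g' i0) by rewrite -k1; have [] := kV i1.
have V3g' : V3 (g' i1) by rewrite -k1; have [] := kV i1.
have [P0 [P00 P01 P0V P0e]] := lV0 _ p0 p1 V0f' p0A p1A p00 p01 p10 p11.
have [|||| P1 [P10 P11 P1V P1e]] := lV1 _ p0 p1 V1f' p0A p1A.
- by rewrite f_0.
- by rewrite f'_0.
- by rewrite f_1.
- by rewrite f'_1.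
have [|||| P2 [P20 P21 P2V P2e]] := lV2 _ p1 p2 V2g' p1A p2A.
- by rewrite gf.
- by rewrite gf'.
- by [].
- by [].
have [|||| P3 [P30 P31 P3V P3e]] := lV3 _ p1 p2 V3g' p1A p2A.
- by rewrite g_0 gf.
- by rewrite g'_0 gf'.
- by rewrite g_1.
- by rewrite g'_1.
have e10 t : ends (P1 t) = ends (P0 t).
  by rewrite /ends; have [-> ->] := P0e t; have [-> ->] := P1e t.
have e32 t : ends (P3 t) = ends (P2 t).
  by rewrite /ends; have [-> ->] := P3e t; have [-> ->] := P2e t.
have P0A t : ends_in A0 A1 (P0 t) by rewrite /ends_in (P0e t).1 (P0e t).2.
have P2A t : ends_in A1 A2 (P2 t) by rewrite /ends_in (P2e t).1 (P2e t).2.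
have [H [f0 [f1 [[cH ff0 ff1 H0 H1] [Hs Ht He]]]]] :=
  tame_homotopy BXP L0 L1 BA0 BA1 ch h0 h1 hV hA P00 P01 P10 P11 P0V P1V e10 P0A.
have [K [g0 [g1 [[cK gg0 gg1 K0 K1] [Ks Kt Ke]]]]] :=
  tame_homotopy BXP L2 L3 BA1 BA2 ck k0 k1 kV kA P20 P21 P30 P31 P2V P3V e32 P2A.
have KH t s : K t s i0 = H t s i1.
  by have [-> _] := Ke t s; have [_ ->] := He t s; rewrite (P2e t).1 (P0e t).2.
have gf_0 : g0 i0 i0 = f0 i0 i1 by rewrite -K0 -H0.
have gf_1 : g1 i0 i0 = f1 i0 i1 by rewrite -K1 -H1.
have -> : cls (hcat g' f') = cls (hcat g1 f1).
  by rewrite -(hcomp_classE gf') -(hcomp_classE gf_1) gg1 ff1.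
apply: (@basic_nbhd_homotopy _ _ _ _ _ (hcat g0 f0) _ (fun z => pcat (K z.1 z.2) (H z.1 z.2))).
- by cts => z.
- by rewrite -(hcomp_classE gf) -(hcomp_classE gf_0) gg0 ff0.
- by move=> s; rewrite hcatE // K0 H0.
- by move=> s; rewrite hcatE // K1 H1.
- case=> t s; apply: WU => /=; split.
    rewrite pcat0 //; have [-> _] := He t s; have [a0 _] := P0A t.
    by have [] := AD0 _ a0.
  rewrite pcat1 //; have [_ ->] := Ke t s; have [_ a2] := P2A t.
  by have [] := AD2 _ a2.
- move=> t /=; rewrite Hs Ks Ht Kt; split.
    by apply: QO0; [exact: VO2|exact: VO0|rewrite (P2e t).1 (P0e t).2].
  by apply: QO1; [exact: VO3|exact: VO1|rewrite (P3e t).1 (P1e t).2].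
Qed.

End Pi2Continuity.

(** * The topological bigroupoid *)

Section Assembly.
Variables (R : realType) (X : topologicalType) (BX : open_basis X).
Hypothesis BXP : forall U, BX U -> one_connected R U /\ zero_on_pi R (@boundary2 R) U setT.
Variables (BP : open_basis (pathspace R X)) (BXX : open_basis (X * X)%type).
Local Notation I := (unitI R).
Local Notation i0 := (i0 R).
Local Notation i1 := (i1 R).
Local Notation PX := (pathspace R X).
Local Notation E := (@ends R X).
Local Notation arrow := (varrow R BP BXX E).

Lemma Pi2_hom_groupoid : is_topological_groupoid (Pi2_hom BP BXX).
Proof.
split => //=.
- by move=> x _; exact: vsrc_idn.
- by move=> x _; exact: vtgt_idn.
- by move=> a _; exact: vsrc_inv.
- by move=> a _; exact: vtgt_inv.
- by move=> b a [_ _]; exact: vsrc_comp.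
- by move=> b a [_ _]; exact: vtgt_comp.
- by move=> c b a [_ _ cb] [_ _ ba]; exact: comp_classA.
- by move=> a _; exact: comp_idl.
- by move=> a _; exact: comp_idr.
- by move=> a _; exact: comp_invl.
- by move=> a _; exact: comp_invr.
- apply: continuous_subspaceT; exact: vsrc_continuous.
- apply: continuous_subspaceT; exact: vtgt_continuous.
- apply: continuous_subspaceT; exact: idn_class_continuous BXP BP BXX.
- apply: continuous_subspaceT; exact: inv_class_continuous.
- apply: within_continuousP => -[b a] [_ _ ba] W nW.
  have [N [M [nN nM NM]]] := comp_class_nbhs BXP ba nW.
  exists (N `*` M); first by exists (N, M).
  by move=> [b' a'] [Nb Ma] [_ _ ba']; exact: NM.
Qed.

Lemma Pi2_ST_functor : is_functor (Pi2_ST BP BXX).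
Proof.
split => //=.
- by move=> a _; rewrite ends_vtgt.
- by move=> x _; rewrite vsrc_idn.
- by move=> b a [_ _ ba]; rewrite vsrc_comp.
- by apply: continuous_subspaceT; exact: ends_continuous.
- apply: continuous_subspaceT.
  apply: (@comp_continuous arrow PX _ _ E); last exact: ends_continuous.
  exact: vsrc_continuous.
Qed.

Lemma Pi2_comp_functor : is_functor (bcomp (Pi2 BP BXX)).
Proof.
split => //=.
- by move=> [b a] [_ _ /= ba]; exact: vsrc_hcomp.
- by move=> [b a] [_ _ /= ba]; exact: vtgt_hcomp.
- by move=> [d c] [_ _ /= dc]; exact: hcomp_idn.
- by move=> [b' a'] [b a] [_ [_ _ /= ba] /= [bb aa]]; exact: (hcomp_comp bb aa ba).
- by apply: (continuous_subspaceW _ (@pcat_within_continuous R X)) => gf [].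
- apply: within_continuousP => -[b a] [_ _ /= ba] W nW.
  have [N [M [nN nM NM]]] := hcomp_class_nbhs BXP ba nW.
  exists (N `*` M); first by exists (N, M).
  by move=> [b' a'] [Nb Ma] [_ _ /= ba']; exact: NM.
Qed.

Lemma Pi2_unit_functor : is_functor (bunit (Pi2 BP BXX)).
Proof.
have cpc : continuous (@pcst R X) by apply: (@pcst_continuous R X X id); cts.
split => //=.
- by move=> a _; exact: vsrc_idn.
- by move=> a _; exact: vtgt_idn.
- move=> b a [_ _ /= ->].
  by have := comp_idl (idn_class R E (pcst R a)); rewrite vtgt_idn => ->.
- exact: continuous_subspaceT.
- apply: continuous_subspaceT.
  apply: (@comp_continuous X PX arrow _ (@idn_class R PX _ E)) => //.
  exact: idn_class_continuous BXP BP BXX.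
Qed.

Lemma map_prev_continuous : continuous (map_class (v := @swap_pair X) (@prev_continuous R X)
  (@prev_ends R X) : arrow -> arrow).
Proof.
apply: arrow_continuous => f W; rewrite map_classE.
move=> /nbhs_cls [U [V0 [V1 [nU n0 n1 UW]]]].
have cs : continuous (@swap_pair X) by rewrite /swap_pair; cts.
exists (@swap_pair X @^-1` U), (@prev R X @^-1` V0), (@prev R X @^-1` V1); split.
- by apply: cs; move: nU; rewrite -prev_ends.
- exact: (@prev_continuous R X).
- exact: (@prev_continuous R X).
move=> _ [g [-> [h [ch hU h0 h1 hV]]]]; rewrite map_classE; apply: UW.
eexists; split; first by reflexivity.
exists (fun z => prev (h z)); split.
- by cts.
- by move=> z; rewrite prev_ends; exact: hU.
- by move=> s; rewrite h0.
- by move=> s; rewrite h1.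
- by move=> t; exact: hV.
Qed.

Lemma Pi2_inv_functor : is_functor (binv (Pi2 BP BXX)).
Proof.
split => //=.
- by move=> a _; exact: map_prev_src.
- by move=> a _; exact: map_prev_tgt.
- by move=> c _; rewrite map_classE; apply: cls_ext.
- by move=> b a [_ _ ba]; exact: map_prev_comp.
- by apply: continuous_subspaceT; exact: prev_continuous.
- by apply: continuous_subspaceT; exact: map_prev_continuous.
Qed.

Definition composable_triples : set ((PX * PX) * PX) :=
  [set t : (PX * PX) * PX | t.1.1 i0 = t.1.2 i1 /\ t.1.2 i0 = t.2 i1].

(** The paths from h, g, f to h', g', f' are lifted over common paths p1 and p2 of the two junction
    points, so the triple remains composable all along. *)
Lemma composable_triples_locally_path_connected :
  locally_path_connected R (set_type composable_triples).
Proof.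
move=> t V [_ [[W oW <-] /= Wt WV]].
have [hg gf] := set_valP t.
set h := (set_val t).1.1 in hg; set g := (set_val t).1.2 in hg gf; set f := (set_val t).2 in gf.
have : nbhs (h, g, f) W by rewrite -!surjective_pairing; exact: open_nbhs_nbhs.
move=> [[Whg Wf] /= [[[Wh Wg] /= [nWh nWg] Whg'] nWf] WW].
have [Vh [Dh0 [Dh1 [VWh nDh0 nDh1 th]]]] := tame_exists BXP nWh.
have [Vg [Dg0 [Dg1 [VWg nDg0 nDg1 tg]]]] := tame_exists BXP nWg.
have [Vf [Df0 [Df1 [VWf nDf0 nDf1 tf]]]] := tame_exists BXP nWf.
rewrite hg in nDh0; rewrite gf in nDg0.
have [A3 [BA3 A3x AD3]] := open_basis_nbhs BX nDh1.
have [A2 [BA2 A2x AD2]] := open_basis_nbhs BX (filterI nDh0 nDg1).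
have [A1 [BA1 A1x AD1]] := open_basis_nbhs BX (filterI nDg0 nDf1).
have [A0 [BA0 A0x AD0]] := open_basis_nbhs BX nDf0.
have [nVh lVh _] : tame h Vh A2 A3 by apply: th => // x /AD2[].
have [nVg lVg _] : tame g Vg A1 A2 by apply: tg => // x; [move=> /AD1[]|move=> /AD2[]].
have [nVf lVf _] : tame f Vf A0 A1 by apply: tf => // x /AD1[].
have cv : continuous (@set_val _ composable_triples) by exact: initial_continuous.
have ch : continuous (fun s => (@set_val _ composable_triples s).1.1) by cts.
have cg : continuous (fun s => (@set_val _ composable_triples s).1.2) by cts.
have cf : continuous (fun s => (@set_val _ composable_triples s).2) by cts.
have cf0 : continuous (fun s => (@set_val _ composable_triples s).2 i0) by cts.
have cf1 : continuous (fun s => (@set_val _ composable_triples s).2 i1) by cts.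
have ch0 : continuous (fun s => (@set_val _ composable_triples s).1.1 i0) by cts.
have ch1 : continuous (fun s => (@set_val _ composable_triples s).1.1 i1) by cts.
exists [set s | [/\ Vh (set_val s).1.1, Vg (set_val s).1.2 & Vf (set_val s).2] /\
  [/\ A0 ((set_val s).2 i0), A1 ((set_val s).2 i1), A2 ((set_val s).1.1 i0)
    & A3 ((set_val s).1.1 i1)]].
  apply: filterI.
    by near=> s; split; near: s; [exact: (ch t _ nVh)|exact: (cg t _ nVg)|exact: (cf t _ nVf)].
  near=> s; split; near: s.
  - by apply: (cf0 t); exact: open_basis_open_nbhs BA0 A0x.
  - by apply: (cf1 t); exact: open_basis_open_nbhs BA1 A1x.
  - by apply: (ch0 t); rewrite -/h hg; exact: open_basis_open_nbhs BA2 A2x.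
  - by apply: (ch1 t); exact: open_basis_open_nbhs BA3 A3x.
move=> s; have [hg' gf'] := set_valP s.
set h' := (set_val s).1.1 in hg' *; set g' := (set_val s).1.2 in hg' gf' *.
set f' := (set_val s).2 in gf' *.
move=> [[Vh' Vg' Vf'] [A0f A1f A2h A3h]].
have [p0 [p00 p01 p0A]] := basis_path BXP BA0 A0x A0f.
have [p1 [p10 p11 p1A]] := basis_path BXP BA1 A1x A1f.
have [p2 [p20 p21 p2A]] := basis_path BXP BA2 A2x A2h.
have [p3 [p30 p31 p3A]] := basis_path BXP BA3 A3x A3h.
have [||||Ph [Ph0 Ph1 PhV Phe]] := lVh h' p2 p3 Vh' p2A p3A => //; first by rewrite hg.
have [||||Pg [Pg0 Pg1 PgV Pge]] := lVg g' p1 p2 Vg' p1A p2A => //.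
- by rewrite gf.
- by rewrite gf'.
- by rewrite -hg'.
have [||||Pf [Pf0 Pf1 PfV Pfe]] := lVf f' p0 p1 Vf' p0A p1A => //.
have Pt r : composable_triples (Ph r, Pg r, Pf r).
  by split=> /=; rewrite ?(Phe r).1 ?(Pge r).2 ?(Pge r).1 ?(Pfe r).2.
pose P r : set_type composable_triples := SigSub (mem_set (Pt r)).
have cP : continuous P.
  apply: (@continuous_comp_initial (set_type composable_triples) I _ set_val).
  by rewrite (_ : _ \o _ = fun r => (Ph r, Pg r, Pf r)) //; cts.
exists (mkpath cP); split.
- by apply: val_inj; rewrite /= Ph0 Pg0 Pf0 -!surjective_pairing.
- by apply: val_inj; rewrite /= Ph1 Pg1 Pf1 -!surjective_pairing.
- move=> r; apply: WV; apply: (WW (Ph r, Pg r, Pf r)) => /=; split.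
    by apply: (Whg' (Ph r, Pg r)); split; [exact: (VWh _ (PhV r))|exact: (VWg _ (PgV r))].
  exact: (VWf _ (PfV r)).
Unshelve. all: by end_near. Qed.

Lemma Pi2_a_natural : is_natural_iso (compl (Pi2 BP BXX)) (compr (Pi2 BP BXX)) (@a_ (Pi2 BP BXX)).
Proof.
split => //=.
- by move=> [[h g] f] [[_ _ /= hg] _ /= gf]; rewrite vsrcE slide_a0.
- by move=> [[h g] f] _; rewrite vtgtE slide_a1.
- by move=> [[c b] a] [[_ _ /= cb] _ /= ba]; exact: natural_a.
- apply/subspace_sigL_continuousP.
  have H : continuous (fun t : set_type composable_triples =>
      cls (slide_a (set_val t).1.1 (set_val t).1.2 (set_val t).2) : arrow).
    apply: (@slide_cls_continuous R X BP BXX _ _ _ _ _ _ _ (fun t : set_type composable_triples =>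
       pcat (set_val t).1.1 (pcat (set_val t).1.2 (set_val t).2))).
      exact: composable_triples_locally_path_connected.
    have cv : continuous (@set_val _ composable_triples) by exact: initial_continuous.
    cts => t; first by have [_ ->] := set_valP t.
    by have [-> e] := set_valP t; rewrite pcat1.
  (* The object set of [triples] is the same subset of PX * PX * PX, which transfers continuity from
     the subtype. *)
  have e : [set x : Ob (triples (Pi2_ST BP BXX)) | ob x] = composable_triples.
    by apply/seteqP; split=> [x [[_ _ ?] _ ?]|x [? ?]].
  by move: H; rewrite -e.
Qed.

Lemma Pi2_r_natural : is_natural_iso (unitr (Pi2 BP BXX)) (fid (Pi2_hom BP BXX)) (@r_ (Pi2 BP BXX)).
Proof.
split => //=.
- by move=> f _; rewrite vsrcE slide_r0.
- by move=> f _; rewrite vtgtE slide_r1.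
- by move=> a _; exact: natural_r.
- apply: continuous_subspaceT.
  apply: (@slide_cls_continuous R X BP BXX PX _ _ _ _ _ _ id); last exact: id_cts.
  exact: pathspace_locally_path_connected BXP.
Qed.

Lemma Pi2_l_natural : is_natural_iso (unitl (Pi2 BP BXX)) (fid (Pi2_hom BP BXX)) (@l_ (Pi2 BP BXX)).
Proof.
split => //=.
- by move=> f _; rewrite vsrcE slide_l0.
- by move=> f _; rewrite vtgtE slide_l1.
- by move=> a _; exact: natural_l.
- apply: continuous_subspaceT.
  apply: (@slide_cls_continuous R X BP BXX PX _ _ _ _ _ _ id); last exact: id_cts.
  exact: pathspace_locally_path_connected BXP.
Qed.

Lemma Pi2_e_natural : is_natural_iso (barl (Pi2 BP BXX))
  (fcomp (bunit (Pi2 BP BXX)) (Sfun (Pi2_ST BP BXX))) (@e_ (Pi2 BP BXX)).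
Proof.
split => //=.
- by move=> f _; rewrite vsrcE slide_e0.
- by move=> f _; rewrite vtgtE slide_e1.
- by move=> a _; exact: natural_e.
- apply: continuous_subspaceT.
  apply: (@slide_cls_continuous R X BP BXX PX _ _ _ _ _ _ id); last exact: id_cts.
  exact: pathspace_locally_path_connected BXP.
Qed.

Lemma Pi2_i_natural : is_natural_iso (fcomp (bunit (Pi2 BP BXX)) (Tfun (Pi2_ST BP BXX)))
  (barr (Pi2 BP BXX)) (@i_ (Pi2 BP BXX)).
Proof.
split => //=.
- by move=> f _; rewrite vsrcE slide_i0.
- by move=> f _; rewrite vtgtE slide_i1.
- by move=> a _; exact: natural_i.
- apply: continuous_subspaceT.
  apply: (@slide_cls_continuous R X BP BXX PX _ _ _ _ _ _ id); last exact: id_cts.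
  exact: pathspace_locally_path_connected BXP.
Qed.

Lemma Pi2_bigroupoid : is_topological_bigroupoid (Pi2 BP BXX).
Proof.
split.
- exact: Pi2_hom_groupoid.
- exact: Pi2_ST_functor.
- exact: Pi2_comp_functor.
- split=> [[g f] [_ _ /= gf]|[b a] [_ _ /= ba]] /=; first exact: pcat_ends.
  by rewrite vsrc_hcomp // pcat_ends.
- exact: Pi2_unit_functor.
- by split=> [x _|x _] //=; rewrite vsrc_idn.
- exact: Pi2_inv_functor.
- by split=> [f _|a _] /=; rewrite ?map_prev_src prev_ends.
- exact: Pi2_a_natural.
- exact: Pi2_r_natural.
- exact: Pi2_l_natural.
- exact: Pi2_e_natural.
- exact: Pi2_i_natural.
- by move=> k h g f _ _ _ _; exact: pentagon.
- by move=> g f _ _; exact: triangle.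
- by move=> f _; exact: inverse_law.
Qed.

End Assembly.

Theorem proposition4p17 (R : realType) (X : topologicalType)
    (BP : open_basis (pathspace R X)) (BXX : open_basis (X * X)%type) :
  semilocally_2_connected R X ->
  (forall W : set (X * X)%type, BXX W -> one_connected R W) ->
  is_topological_bigroupoid (Pi2 BP BXX).
Proof. by move=> [BX BXP] _; exact: Pi2_bigroupoid BXP BP BXX. Qed.
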